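(* Let $W=(\Delta Y,D,X)$ have law $P$, with $\Delta Y$ a random element of $\mathcal H=L^2(\mathcal T)$, $D\in\{0,1\}$, $X\in\mathbb R^p$. Assume overlap: there is $\underline c\in(0,1/2)$ with $\underline c\le\pi_0(X)\le 1-\underline c$ almost surely, and $p_0\in(0,1)$; and the moment conditions $\mathbb E\|\Delta Y\|_{\mathcal H}^2<\infty$, $\mathbb E\|\phi(W;\eta_0)\|_{\mathcal H}^2<\infty$, $\sup_x\mathbb E\{\|\Delta Y-\mu_0(X)\|_{\mathcal H}^2\mid X=x,D=0\}<\infty$. Let $\tau(P)\in\mathcal H$ be the identified functional average treatment effect on the treated, $$\tau(P)(t)=\mathbb E_P\Big\{\frac{D}{p_P}\Delta Y(t)\Big\}-\mathbb E_P\Big\{\frac{(1-D)\pi_P(X)}{p_P\{1-\pi_P(X)\}}\Delta Y(t)\Big\},\qquad t\in\mathcal T,$$ where $p_P=P(D=1)$ and $\pi_P(x)=P(D=1\mid X=x)$, and write $\tau_0=\tau(P)$ at the true law. Then for every regular parametric submodel $\{P_\epsilon:\epsilon\in(-\delta,\delta)\}$ through $P_0=P$ with score $S(W)$, $$\frac{d}{d\epsilon}\tau(P_\epsilon)\Big|_{\epsilon=0}=\mathbb E\{\phi(W;\eta_0)S(W)\}\quad\text{in }\mathcal H,$$ where $$\phi(W;\eta_0)(t)=\frac{D}{p_0}\{\Delta Y(t)-\mu_1(X)(t)\}-\frac{(1-D)\pi_0(X)}{p_0\{1-\pi_0(X)\}}\{\Delta Y(t)-\mu_0(X)(t)\}+\frac{D}{p_0}\{\mu_1(X)(t)-\mu_0(X)(t)\}-\frac{D}{p_0}\tau_0(t),$$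 or equivalently, after cancellation of $\mu_1$, $$\phi(W;\eta_0)(t)=\frac{D}{p_0}\{\Delta Y(t)-\mu_0(X)(t)-\tau_0(t)\}-\frac{(1-D)\pi_0(X)}{p_0\{1-\pi_0(X)\}}\{\Delta Y(t)-\mu_0(X)(t)\}.$$ Hence $\phi(W;\eta_0)$ is the canonical gradient, or efficient influence function, for $\tau_0$ in the nonparametric observed-data model for $W$.
   Context: $\mathcal T\subset\mathbb R$ is a compact interval and $\mathcal H=L^2(\mathcal T)$ with its usual inner product and norm $\|\cdot\|_{\mathcal H}$. $\pi_0(x)=P(D=1\mid X=x)$, $p_0=P(D=1)$, $\mu_a(x)(t)=\mathbb E\{\Delta Y(t)\mid X=x,D=a\}$ for $a\in\{0,1\}$, and $\eta_0=(\pi_0,\mu_0)$; expectations without subscript are under $P$. ''Regular parametric submodel'' is used in the usual sense of semiparametric theory: a smooth one-parameter family of laws of $W$ passing through $P$ at $\epsilon=0$, with score $S(W)$ there. In the nonparametric model the tangent space is the full mean-zero subspace $L_0^2(P)$ of $L^2(P)$. A gradient is an $\mathcal H$-valued function of $W$ representing the pathwise derivative as in the display; the canonical gradient is the gradient whose scalar projections $\langle f,\phi\rangle$, $f\in\mathcal H$, lie in the tangent space.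
   Formalization: Regular parametric submodels are taken differentiable in quadratic mean and, additionally, with overlap and a bound on E‖ΔY‖² holding uniformly along the path (constants may depend on the path); without this the derivative formula can fail. *)

(* Defs.v *)
From HB Require Import structures.
From mathcomp Require Import all_boot all_order all_algebra.
From mathcomp Require Import all_classical all_reals all_analysis.

Set Implicit Arguments.
Unset Strict Implicit.
Unset Printing Implicit Defensive.
Import Order.TTheory GRing.Theory Num.Theory.
Import numFieldNormedType.Exports.

Local Open Scope classical_set_scope.
Local Open Scope ring_scope.

(* L^2 of [a, b]: square-integrable functions for Lebesgue measure restricted
   to [a, b].  Elements are functions, not almost-everywhere classes: everything
   below depends on them through the inner product and the seminorm only, and
   identities "in L^2" are stated through the seminorm. *)
Definition lebesgue_on (R : realType) (a b : R) :
    {measure set (measurableTypeR R) -> \bar R} :=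
  mrestr (@lebesgue_measure R) (measurable_itv `[a, b]).

Definition L2 (R : realType) (a b : R) : Type :=
  LfunType (lebesgue_on a b) (lee1n 2).

HB.instance Definition _ (R : realType) (a b : R) := GRing.Lmodule.on (L2 a b).
HB.instance Definition _ (R : realType) (a b : R) :=
  isPointed.Build (L2 a b) 0.

Definition L2_inner (R : realType) (a b : R) (f g : L2 a b) : R :=
  \int[lebesgue_on a b]_t (f t * g t).

Definition L2_norm (R : realType) (a b : R) (f : L2 a b) : R :=
  fine ('N[lebesgue_on a b]_2%:E [EFin \o f]).

(* The Borel sigma-algebra of the seminorm topology; it is the preimage of the
   Borel sigma-algebra of the space of almost-everywhere classes. *)
Definition L2_open (R : realType) (a b : R) : set_system (L2 a b) :=
  [set U | forall y, U y ->
    exists2 r : R, 0 < r & forall z, L2_norm (z - y) < r -> U z].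

Definition L2_display : measure_display.
Proof. by constructor. Qed.

HB.instance Definition _ (R : realType) (a b : R) :=
  @isMeasurable.Build L2_display (L2 a b) <<s @L2_open R a b >>
    (@sigma_algebra0 _ setT _) (fun A => @sigma_algebraC _ _ A)
    (@sigma_algebra_bigcup _ setT _).

Notation covariate R p := (p.-tuple (measurableTypeR R)).

(* The sample space of W = (DeltaY, D, X), D = 1 being [true]. *)
Notation obs R a b p := (@L2 R a b * bool * covariate R p)%type.

Definition outcome (R : realType) (a b : R) (p : nat) (w : obs R a b p) : L2 a b :=
  w.1.1.
Definition treat (R : realType) (a b : R) (p : nat) (w : obs R a b p) : bool :=
  w.1.2.
Definition covar (R : realType) (a b : R) (p : nat) (w : obs R a b p) :
  covariate R p := w.2.

Definition treat_prob (R : realType) (a b : R) (p : nat)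
    (P : probability (obs R a b p) R) : R :=
  fine (P [set w | treat w]).

(* v is a version of x |-> E(Z | X = x, W in A). *)
Definition is_cond_mean (R : realType) (a b : R) (p : nat)
    (P : probability (obs R a b p) R) (A : set (obs R a b p))
    (Z : obs R a b p -> R) (v : covariate R p -> R) : Prop :=
  [/\ measurable_fun setT v,
      P.-integrable A (fun w => (v (covar w))%:E) &
      forall B : set (covariate R p), measurable B ->
        (\int[P]_(w in A `&` (@covar R a b p) @^-1` B) (Z w)%:E =
         \int[P]_(w in A `&` (@covar R a b p) @^-1` B) (v (covar w))%:E)%E].

Definition is_propensity (R : realType) (a b : R) (p : nat)
    (P : probability (obs R a b p) R) (pi : covariate R p -> R) : Prop :=
  is_cond_mean P setT (fun w => (treat w)%:R) pi.

(* mu is a version of x |-> E(DeltaY | X = x, D = d), a conditional expectation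
   in L^2 taken weakly. *)
Definition is_regression (R : realType) (a b : R) (p : nat)
    (P : probability (obs R a b p) R) (d : bool)
    (mu : covariate R p -> L2 a b) : Prop :=
  [/\ measurable_fun setT mu,
      (\int[P]_(w in [set w | treat w = d]) (L2_norm (mu (covar w)))%:E < +oo)%E &
      forall f : L2 a b,
        is_cond_mean P [set w | treat w = d]
          (fun w => L2_inner (outcome w) f) (fun x => L2_inner (mu x) f)].

(* h is the expectation of g(W) in L^2, as a weak (Pettis) integral; it is
   determined up to almost-everywhere equality. *)
Definition is_L2_mean (R : realType) (a b : R) (p : nat)
    (P : probability (obs R a b p) R) (g : obs R a b p -> L2 a b) (h : L2 a b) :
    Prop :=
  forall f : L2 a b,
    P.-integrable setT (fun w => (L2_inner (g w) f)%:E) /\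
    ((L2_inner h f)%:E = \int[P]_w (L2_inner (g w) f)%:E)%E.

Definition is_att (R : realType) (a b : R) (p : nat)
    (P : probability (obs R a b p) R) (tau : L2 a b) : Prop :=
  exists (pi : covariate R p -> R) (h1 h0 : L2 a b),
    [/\ is_propensity P pi,
        is_L2_mean P
          (fun w => ((treat w)%:R / treat_prob P) *: outcome w) h1,
        is_L2_mean P
          (fun w => ((~~ treat w)%:R * pi (covar w) /
                     (treat_prob P * (1 - pi (covar w)))) *: outcome w) h0 &
        tau = h1 - h0].

(* The functional P |-> tau(P).  The default 0 is used only if P admits no
   such tau; two values satisfying [is_att P] agree almost everywhere. *)
Definition att (R : realType) (a b : R) (p : nat)
    (P : probability (obs R a b p) R) : L2 a b :=
  xget 0 [set tau | is_att P tau].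

Definition eif (R : realType) (a b : R) (p : nat)
    (P : probability (obs R a b p) R)
    (pi0 : covariate R p -> R) (mu0 : covariate R p -> L2 a b)
    (w : obs R a b p) : L2 a b :=
  ((treat w)%:R / treat_prob P) *: (outcome w - mu0 (covar w) - att P) -
  ((~~ treat w)%:R * pi0 (covar w) / (treat_prob P * (1 - pi0 (covar w)))) *:
    (outcome w - mu0 (covar w)).

Definition eif_mu1 (R : realType) (a b : R) (p : nat)
    (P : probability (obs R a b p) R)
    (pi0 : covariate R p -> R) (mu0 mu1 : covariate R p -> L2 a b)
    (w : obs R a b p) : L2 a b :=
  ((treat w)%:R / treat_prob P) *: (outcome w - mu1 (covar w)) -
  ((~~ treat w)%:R * pi0 (covar w) / (treat_prob P * (1 - pi0 (covar w)))) *: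
    (outcome w - mu0 (covar w)) +
  ((treat w)%:R / treat_prob P) *: (mu1 (covar w) - mu0 (covar w)) -
  ((treat w)%:R / treat_prob P) *: att P.

Definition overlap (R : realType) (a b : R) (p : nat)
    (P : probability (obs R a b p) R) (pi : covariate R p -> R) (c : R) : Prop :=
  {ae P, forall w, c <= pi (covar w) <= 1 - c}.

(* Differentiability in quadratic mean at 0 with score S (so that E S = 0), for
   a family given by densities with respect to a common sigma-finite measure. *)
Definition qmd (R : realType) (a b : R) (p : nat) (delta : R)
    (Pe : R -> probability (obs R a b p) R) (S : obs R a b p -> R) : Prop :=
  exists (nu : {sigma_finite_measure set (obs R a b p) -> \bar R})
         (q : R -> obs R a b p -> R),
    (forall e, `|e| < delta ->
      [/\ measurable_fun setT (q e),
          forall w, 0 <= q e w &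
          forall A, measurable A ->
            (Pe e A = \int[nu]_(w in A) (q e w)%:E)%E]) /\
    (fun e : R => (\int[nu]_w
        (((Num.sqrt (q e w) - Num.sqrt (q 0%R w)) / e -
          S w * Num.sqrt (q 0%R w) / 2) ^+ 2)%:E)%E) @ 0^' --> 0%E.

(* Regular parametric submodels {Pe e : |e| < delta} through P, within the
   model given by overlap and a finite second moment of DeltaY; the constants
   of the two conditions depend on the submodel and are uniform along it.
   Without the uniformity the derivative may fail to be the stated one: mass
   e^3 moved to outcomes of norm e^-3 is invisible to the score at 0. *)
Definition regular_submodel (R : realType) (a b : R) (p : nat)
    (P : probability (obs R a b p) R) (delta : R)
    (Pe : R -> probability (obs R a b p) R) (S : obs R a b p -> R) : Prop :=
  [/\ 0 < delta,
      forall A, measurable A -> Pe 0 A = P A,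
      S \in Lfun P 2%:E /\ qmd delta Pe S,
      exists2 c : R, 0 < c < 1 / 2 & (forall e, `|e| < delta ->
        exists2 pi, is_propensity (Pe e) pi & overlap (Pe e) pi c) &
      exists M : R, forall e, `|e| < delta ->
        (\int[Pe e]_w (L2_norm (outcome w) ^+ 2)%:E <= M%:E)%E].

(* d/de att (Pe e) at e = 0 exists in L^2 and equals E{g(W) S(W)}. *)
Definition represents_derivative (R : realType) (a b : R) (p : nat)
    (P : probability (obs R a b p) R) (Pe : R -> probability (obs R a b p) R)
    (S : obs R a b p -> R) (g : obs R a b p -> L2 a b) : Prop :=
  exists2 D : L2 a b,
    is_L2_mean P (fun w => S w *: g w) D &
    (fun e : R => L2_norm (e^-1 *: (att (Pe e) - att P) - D)) @ 0^' --> (0 : R).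

Definition is_gradient (R : realType) (a b : R) (p : nat)
    (P : probability (obs R a b p) R) (g : obs R a b p -> L2 a b) : Prop :=
  forall (delta : R) (Pe : R -> probability (obs R a b p) R) (S : obs R a b p -> R),
    regular_submodel P delta Pe S -> represents_derivative P Pe S g.

(* The L^2(P)-closed linear span of the scores of the regular submodels. *)
Definition tangent_space (R : realType) (a b : R) (p : nat)
    (P : probability (obs R a b p) R) : set (obs R a b p -> R) :=
  [set g | g \in Lfun P 2%:E /\
    forall eta : R, 0 < eta ->
      exists (n : nat) (k : 'I_n -> R) (S : 'I_n -> obs R a b p -> R),
        (forall i, exists delta Pe, regular_submodel P delta Pe (S i)) /\
        ('N[P]_2%:E [(fun w => (g w - \sum_(i < n) k i * S i w)%:E)] < eta%:E)%E].

Definition is_canonical_gradient (R : realType) (a b : R) (p : nat)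
    (P : probability (obs R a b p) R) (g : obs R a b p -> L2 a b) : Prop :=
  is_gradient P g /\
  forall f : L2 a b, tangent_space P (fun w => L2_inner (g w) f).

(* Main.v *)
(** Fix f in L^2 and write Y = <DeltaY, f>, m(X) = <mu0(X), f>, D for the
    treatment, r = pi / (1 - pi), and weight = D - (1 - D) r(X).  The weight is
    orthogonal to functions of X, so p <tau(P), f> = E{weight (Y - g(X))} for every
    bounded g.  Along a submodel, p_e <tau(P_e) - tau(P), f> is therefore the mean
    under P_e of Z_e = weight_e (Y - g(X)) - D <tau(P), f>, where weight_e uses the
    propensity of P_e.  Differentiability in quadratic mean gives
    (E_e Z_e - E Z_e) / e - E(Z_e S) -> 0 as soon as the second moments of Z_e are
    bounded under both laws; this is uniform over |f| <= 1, hence yields convergence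
    in norm.  Since mu0 is a regression under P only, g is mu0 truncated at level K:
    then E Z_e = - E{(1 - D) (r_e - r)(X) (m - g)(X)} is O(e) times a tail of mu0,
    because r_e - r is O(e) in L^2(P) by comparison with the Hellinger distance.

    For canonicity, every bounded mean-zero s is the score of the submodel with
    density 1 + e s, and such s are dense among the mean-zero functions of L^2(P).
    Elements of L^2 defined by their inner products exist by the Riesz
    representation theorem, deduced from Radon-Nikodym. *)

Require Import Defs.
From HB Require Import structures.
From mathcomp Require Import all_boot all_order all_algebra.
From mathcomp Require Import all_classical all_reals all_analysis.
From mathcomp Require Import measurable_realfun.
From mathcomp Require Import ring lra.

Set Implicit Arguments.
Unset Strict Implicit.
Unset Printing Implicit Defensive.
Import Order.TTheory GRing.Theory Num.Theory.
Import numFieldNormedType.Exports HBNNSimple.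

Local Open Scope classical_set_scope.
Local Open Scope ring_scope.

(** * Square-integrable functions *)

(** Only second moments are available: the score and the outcome are merely square-integrable, and
    the change of the odds is small only in L^2. A product of the three is therefore handled by
    truncating the score at a second level [K'], at the price of an L^2 tail of [S]. The mean of [Z]
    under [P] does not vanish after division by [e]: it stays a bounded multiple of the tail of
    [mu0] beyond [K]. Hence the order of choices: [K] first, then [K'], which may depend on [K], and
    [e] last. Uniformity in [f] requires truncating [mu0] according to its norm, so that the level
    set does not depend on [f]. No law of the submodel need dominate another, so no likelihood ratio
    is used: a function [f] in L^2(P) is replaced by [f] times the square root of the density, and
    all comparisons are Cauchy-Schwarz inequalities in L^2(nu). Overlap holds almost surely only;
    clipping a propensity gives another version of it for which the bounds hold everywhere. *)

Lemma sqr_le_of_quadratic_ge0 (R : realType) (A B c : R) :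
  (forall s, 0 <= s ^+ 2 * A + 2 * s * c + B) -> c ^+ 2 <= A * B.
Proof.
move=> h; have B0 : 0 <= B by have := h 0; rewrite expr0n /= mulr0 !mul0r !add0r.
have [A0|A0|A0] := ltgtP A 0.
(* For A < 0 this [s] is at least 1, so that s^2 A + B <= A - 1 < 0; choosing between [s] and [- s]
   makes the linear term nonpositive. *)
- exfalso; set s := (B + 1 - A) / - A.
  have s1 : 1 <= s by rewrite /s ler_pdivlMr ?oppr_gt0// mul1r; lra.
  have sA : s * A = - (B + 1 - A) by rewrite /s; field; lra.
  have sB : B + 1 - A <= s * (B + 1 - A) by rewrite ler_peMl//; lra.
  have s2A : s ^+ 2 * A = - (s * (B + 1 - A)) by rewrite expr2 -mulrA sA mulrN.
  have [c0|c0] := lerP c 0.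
    by have := h s; rewrite s2A; have : s * c <= 0 by [rewrite pmulr_rle0//; lra]; lra.
  have := h (- s); rewrite sqrrN s2A.
  by have : 0 <= s * c by [rewrite pmulr_rge0 ?ltW//; lra]; lra.
- have := h (- c / A); have AN0 : A != 0 by rewrite gt_eqF.
  have -> : (- c / A) ^+ 2 * A + 2 * (- c / A) * c + B = (A * B - c ^+ 2) / A.
    by field.
  by rewrite pmulr_lge0 ?invr_gt0// subr_ge0.
- subst A; rewrite mul0r; have [->|c0] := eqVneq c 0; first by rewrite expr0n.
  have := h (- (B + 1) / (2 * c)).
  have -> : (- (B + 1) / (2 * c)) ^+ 2 * 0 + 2 * (- (B + 1) / (2 * c)) * c + B = -1.
    by field.
  lra.
Qed.

Section square_integrable.
Context d (T : measurableType d) (R : realType).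
Implicit Types (mu : {measure set T -> \bar R}) (f g : T -> R).

Definition sqint mu f : Prop :=
  measurable_fun setT f /\ mu.-integrable setT (EFin \o (fun x => f x ^+ 2)).

(** [Rintegral] sends an infinite integral to 0, so this is a seminorm on [sqint] functions only;
    the norm estimates below carry [sqint] hypotheses for that reason. *)
Definition l2n mu f : R := Num.sqrt (\int[mu]_x (f x ^+ 2)).

Lemma l2n_ge0 mu f : 0 <= l2n mu f. Proof. exact: sqrtr_ge0. Qed.

Lemma sqr_l2n mu f : l2n mu f ^+ 2 = \int[mu]_x (f x ^+ 2).
Proof. by rewrite sqr_sqrtr// Rintegral_ge0// => x _; exact: sqr_ge0. Qed.

Lemma sqintP mu f : measurable_fun setT f ->
  (\int[mu]_x ((f x) ^+ 2)%:E < +oo)%E -> sqint mu f.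
Proof.
move=> mf fi; split=> //; apply/integrableP; split.
  by apply/measurable_EFinP; exact: measurable_funX.
apply: le_lt_trans fi; apply: ge0_le_integral => //=.
- by apply/measurable_EFinP; apply: measurableT_comp => //; exact: measurable_funX.
- by apply/measurable_EFinP; exact: measurable_funX.
- by move=> x _; rewrite ger0_norm// sqr_ge0.
Qed.

Lemma integrable_le mu f g : measurable_fun setT f ->
  (forall x, `|f x| <= g x) -> mu.-integrable setT (EFin \o g) ->
  mu.-integrable setT (EFin \o f).
Proof.
move=> mf fg; apply: le_integrable => //; first exact/measurable_EFinP.
by move=> x _ /=; rewrite lee_fin (le_trans (fg x))// ler_norm.
Qed.

Lemma integrable_plus mu f g : mu.-integrable setT (EFin \o f) ->
  mu.-integrable setT (EFin \o g) ->
  mu.-integrable setT (EFin \o (fun x => f x + g x)).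
Proof. by move=> mf mg; exact: (integrableD measurableT mf mg). Qed.

Lemma integrable_minus mu f g : mu.-integrable setT (EFin \o f) ->
  mu.-integrable setT (EFin \o g) ->
  mu.-integrable setT (EFin \o (fun x => f x - g x)).
Proof. by move=> mf mg; exact: (integrableB measurableT mf mg). Qed.

Lemma integrable_scale mu f (k : R) : mu.-integrable setT (EFin \o f) ->
  mu.-integrable setT (EFin \o (fun x => k * f x)).
Proof. by move=> mf; exact: (integrableZl measurableT k mf). Qed.

Lemma integrable_measurable mu f : mu.-integrable setT (EFin \o f) ->
  measurable_fun setT f.
Proof. by move=> /measurable_int/measurable_EFinP. Qed.

Lemma sqint_le mu f g (C : R) : measurable_fun setT f ->
  (forall x, `|f x| <= C * `|g x|) -> sqint mu g -> sqint mu f.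
Proof.
move=> mf fg [mg ig]; split=> //.
apply: (@integrable_le _ _ (fun x => C ^+ 2 * g x ^+ 2)).
- exact: measurable_funX.
- move=> x; rewrite -exprMn ger0_norm ?sqr_ge0//.
  rewrite -real_normK ?num_real// -[leRHS]real_normK ?num_real//.
  rewrite lerXn2r ?nnegrE// (le_trans (fg x))// normrM ler_wpM2r//.
  exact: ler_norm.
- exact: integrable_scale.
Qed.

Lemma sqintM mu f g : sqint mu f -> sqint mu g ->
  mu.-integrable setT (EFin \o (fun x => f x * g x)).
Proof.
move=> [mf f2] [mg g2]; apply: (@integrable_le _ _ (fun x => f x ^+ 2 + g x ^+ 2)).
- exact: measurable_funM.
- move=> x; have := sqr_ge0 (f x + g x); have := sqr_ge0 (f x - g x).
  have := sqr_ge0 (f x); have := sqr_ge0 (g x).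
  rewrite (sqrrD (f x) (g x)) (sqrrB (f x) (g x)) => *.
  by rewrite ler_norml; apply/andP; split; lra.
- exact: integrable_plus.
Qed.

Lemma sqintD mu f g : sqint mu f -> sqint mu g -> sqint mu (fun x => f x + g x).
Proof.
move=> [mf f2] [mg g2]; split; first exact: measurable_funD.
apply: (@integrable_le _ _ (fun x => 2 * f x ^+ 2 + 2 * g x ^+ 2)).
- by apply: measurable_funX; exact: measurable_funD.
- move=> x; rewrite ger0_norm ?sqr_ge0//; have := sqr_ge0 (f x - g x).
  by rewrite (sqrrD (f x) (g x)) (sqrrB (f x) (g x)); lra.
- by apply: integrable_plus; exact: integrable_scale.
Qed.

Lemma sqintZ mu f (k : R) : sqint mu f -> sqint mu (fun x => k * f x).
Proof.
move=> sf; apply: (@sqint_le mu _ f `|k|) => //.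
  by apply: measurable_funM => //; case: sf.
by move=> x; rewrite normrM.
Qed.

Lemma sqintB mu f g : sqint mu f -> sqint mu g -> sqint mu (fun x => f x - g x).
Proof.
move=> sf /(@sqintZ _ _ (-1)) sg; have := sqintD sf sg.
by under eq_fun do rewrite mulN1r.
Qed.

Lemma sqint0 mu : sqint mu (fun=> 0).
Proof.
split=> //; rewrite (_ : _ \o _ = cst 0%E); first exact: integrable0.
by apply/funext => x /=; rewrite expr0n.
Qed.

Lemma cauchy_schwarz_sqr mu f g : sqint mu f -> sqint mu g ->
  (\int[mu]_x (f x * g x)) ^+ 2 <=
  (\int[mu]_x (f x ^+ 2)) * \int[mu]_x (g x ^+ 2).
Proof.
move=> sf sg; apply: sqr_le_of_quadratic_ge0 => s.
have fg := sqintM sf sg; have [_ f2] := sf; have [_ g2] := sg.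
have -> : s ^+ 2 * (\int[mu]_x f x ^+ 2) + 2 * s * (\int[mu]_x (f x * g x)) +
    \int[mu]_x g x ^+ 2 = \int[mu]_x (s * f x + g x) ^+ 2.
  rewrite -!RintegralZl// -!RintegralD//.
  - by apply: eq_Rintegral => x _; ring.
  - by apply: integrable_plus; exact: integrable_scale.
  - exact: integrable_scale.
  - exact: integrable_scale.
by apply: Rintegral_ge0 => x _; exact: sqr_ge0.
Qed.

Lemma cauchy_schwarz mu f g : sqint mu f -> sqint mu g ->
  `|\int[mu]_x (f x * g x)| <= l2n mu f * l2n mu g.
Proof.
move=> sf sg; rewrite -sqrtr_sqr -sqrtrM ?Rintegral_ge0//.
  by apply: ler_wsqrtr; exact: cauchy_schwarz_sqr.
by move=> x _; exact: sqr_ge0.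
Qed.

Lemma ler_l2n mu f g (C : R) : 0 <= C -> measurable_fun setT f ->
  (forall x, `|f x| <= C * `|g x|) -> sqint mu g -> l2n mu f <= C * l2n mu g.
Proof.
move=> C0 mf fg sg; have sf := sqint_le mf fg sg.
rewrite -[leLHS]ger0_norm ?l2n_ge0// -[leRHS]ger0_norm ?mulr_ge0 ?l2n_ge0//.
rewrite -ler_sqr ?nnegrE// !real_normK ?num_real// exprMn !sqr_l2n.
have [_ f2] := sf; have [_ g2] := sg.
rewrite -RintegralZl//; apply: le_Rintegral => //; first exact: integrable_scale.
move=> x _; rewrite -exprMn -real_normK ?num_real// -[leRHS]real_normK ?num_real//.
by rewrite lerXn2r ?nnegrE// normrM (ger0_norm C0).
Qed.

Lemma ler_l2nD mu f g : sqint mu f -> sqint mu g ->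
  l2n mu (fun x => f x + g x) <= l2n mu f + l2n mu g.
Proof.
move=> sf sg; have ge0 := @l2n_ge0 mu.
rewrite -[leLHS]ger0_norm// -[leRHS]ger0_norm ?addr_ge0//.
rewrite -ler_sqr ?nnegrE// !real_normK ?num_real// sqrrD !sqr_l2n.
have [_ f2] := sf; have [_ g2] := sg; have fg := sqintM sf sg.
have -> : \int[mu]_x (f x + g x) ^+ 2 = \int[mu]_x f x ^+ 2 +
    2 * (\int[mu]_x (f x * g x)) + \int[mu]_x g x ^+ 2.
  rewrite -RintegralZl// -!RintegralD//.
  - by apply: eq_Rintegral => x _; ring.
  - by apply: integrable_plus => //; exact: integrable_scale.
  - exact: integrable_scale.
have := cauchy_schwarz sf sg; have := ler_norm (\int[mu]_x (f x * g x)); lra.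
Qed.

Lemma l2nZ mu f (k : R) : sqint mu f -> l2n mu (fun x => k * f x) = `|k| * l2n mu f.
Proof.
move=> [_ f2]; rewrite -sqrtr_sqr -sqrtrM ?sqr_ge0// -RintegralZl//.
by congr Num.sqrt; apply: eq_Rintegral => x _; rewrite exprMn.
Qed.

Lemma ler_l2nB mu f g : sqint mu f -> sqint mu g ->
  l2n mu (fun x => f x - g x) <= l2n mu f + l2n mu g.
Proof.
move=> sf sg; have := ler_l2nD sf (sqintZ (-1) sg).
by rewrite l2nZ// normrN1 mul1r; under eq_fun do rewrite mulN1r.
Qed.

End square_integrable.

(** * Truncation at a level and its L^2 error *)

Section tails.
Context d (T : measurableType d) (R : realType).
Variable mu : {measure set T -> \bar R}.

(** The truncation of [f], bounded by [K], is [f - tail K f], so that the truncation error is the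
    tail itself. *)
Definition tail (K : R) (f : T -> R) (x : T) : R :=
  if `|f x| <= K then 0 else f x.

Lemma measurable_le_norm (K : R) (f : T -> R) : measurable_fun setT f ->
  measurable_fun setT (fun x => `|f x| <= K).
Proof. by move=> mf; apply: measurable_fun_ler => //; exact: measurableT_comp. Qed.

Lemma measurable_tail K f : measurable_fun setT f -> measurable_fun setT (tail K f).
Proof. by move=> mf; apply: measurable_fun_ifT => //; exact: measurable_le_norm. Qed.

Lemma tail_le K f x : `|tail K f x| <= 1 * `|f x|.
Proof. by rewrite /tail mul1r; case: ifP => // _; rewrite normr0. Qed.

Lemma sqint_tail K f : sqint mu f -> sqint mu (tail K f).
Proof.
move=> sf; apply: (sqint_le _ (tail_le K f)) => //.
by apply: measurable_tail; case: sf.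
Qed.

Lemma l2n_tail (f : T -> R) (eta : R) : sqint mu f -> 0 < eta ->
  exists2 K, 0 < K & l2n mu (tail K f) < eta.
Proof.
move=> sf eta0; have [mf f2] := sf.
have h : (\int[mu]_x ((tail n%:R f x ^+ 2)%:E))%E @[n --> \oo] --> 0%E.
  rewrite -(@integral0 _ _ _ mu setT).
  apply: (@dominated_cvg _ _ _ mu setT measurableT _ _ (EFin \o (fun x => f x ^+ 2))) => //.
  - by move=> n; apply/measurable_EFinP; apply: measurable_funX; exact: measurable_tail.
  - move=> x _; apply: cvg_near_cst; near=> n.
    rewrite /tail ifT ?expr0n//; near: n.
    by apply: nbhs_infty_ger.
  - move=> n x _ /=; rewrite lee_fin ger0_norm ?sqr_ge0// /tail.
    by case: ifP => // _; rewrite expr0n sqr_ge0.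
move/fine_cvgP : h => [_ /cvgrPdist_lt/(_ (eta ^+ 2))].
(* The index [N.+1] instead of [N] makes the level positive. *)
rewrite exprn_gt0// => /(_ isT)[N _ /(_ N.+1)].
rewrite /= sub0r normrN => /(_ (leqnSn N)) h.
exists N.+1%:R; first exact: ltr0Sn.
rewrite -(@gtr0_norm _ eta)// -sqrtr_sqr ltr_sqrt ?exprn_gt0//.
by apply: le_lt_trans h; exact: ler_norm.
Unshelve. all: by end_near. Qed.

End tails.

(** * Riesz representation *)

Section simple_approximation.
Context d (T : measurableType d) (R : realType).

(** A simple function is the finite sum of its values times the indicators of its level sets. [Q]
    ranges over plain functions because the partial sums met in the induction are not packaged as
    nonnegative simple functions. *)
Lemma simple_fun_ind (Q : (T -> R) -> Prop) :
  Q (fun=> 0) ->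
  (forall f k A, Q f -> measurable A -> Q (fun x => f x + k * \1_A x)) ->
  forall s : {nnsfun T >-> R}, Q s.
Proof.
move=> Q0 QS s.
have -> : (s : T -> R) = fun x => \sum_(y <- finmap.enum_fset (fset_set (range s)))
    y * \1_(s @^-1` [set y]) x.
  by apply/funext => x; rewrite [LHS]fimfunE fsbig_finite.
elim: (finmap.enum_fset _) => [|y r IH].
  by rewrite (_ : (fun _ => _) = fun=> 0)//; apply/funext => x; rewrite big_nil.
rewrite (_ : (fun _ => _) = fun x => \sum_(y <- r) y * \1_(s @^-1` [set y]) x +
   y * \1_(s @^-1` [set y]) x); first exact: QS.
by apply/funext => x; rewrite big_cons addrC.
Qed.

Lemma simple_approx (f : T -> R) : measurable_fun setT f -> (forall x, 0 <= f x) ->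
  exists s : nat -> {nnsfun T >-> R},
    (forall n x, 0 <= s n x <= f x) /\ (forall x, s n x @[n --> \oo] --> f x).
Proof.
move=> mf f0; have /measurable_EFinP mf' := mf.
have f0' x : setT x -> (0%R <= (EFin \o f) x)%E by move=> _; rewrite lee_fin.
pose s := nnsfun_approx measurableT mf'.
have cs x : EFin \o s ^~ x @ \oo --> (EFin \o f) x.
  exact: (cvg_nnsfun_approx measurableT mf' f0').
have cs' x : s n x @[n --> \oo] --> f x by exact: fine_cvg (cs x).
exists s; split=> // n x; apply/andP; split=> //.
have nd : nondecreasing_seq (fun n => s n x).
  by move=> i j ij; have /lefP/(_ x) := nd_nnsfun_approx measurableT mf' ij.
have := nondecreasing_cvgn_le nd (cvgP _ (cs' x)) n.
by rewrite (cvg_lim _ (cs' x)).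
Qed.

Lemma simple_approx_l2n (mu : {measure set T -> \bar R}) (f : T -> R) (eta : R) :
  sqint mu f -> (forall x, 0 <= f x) -> 0 < eta ->
  exists s : {nnsfun T >-> R},
    (forall x, 0 <= s x <= f x) /\ l2n mu (fun x => f x - s x) < eta.
Proof.
move=> [mf f2] f0 eta0; have [s [sf cs]] := simple_approx mf f0.
have h : (\int[mu]_x (((f x - s n x) ^+ 2)%:E))%E @[n --> \oo] --> 0%E.
  rewrite -(@integral0 _ _ _ mu setT).
  apply: (@dominated_cvg _ _ _ mu setT measurableT _ _ (EFin \o (fun x => f x ^+ 2))) => //.
  - move=> n; apply/measurable_EFinP; apply: measurable_funX.
    by apply: measurable_funB => //; exact: measurable_funP.
  - move=> x _; apply: cvg_EFin; first by near=> n.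
    rewrite (_ : _ \o _ = fun n => (f x - s n x) ^+ 2)//.
    have h : (f x - s n x) @[n --> \oo] --> f x - f x.
      by apply: cvgB => //; exact: cvg_cst.
    by have h2 := cvgM h h; rewrite subrr mul0r in h2; exact: h2.
  - move=> n x _ /=; have /andP[s0 sfx] := sf n x.
    by rewrite lee_fin ger0_norm ?sqr_ge0// lerXn2r ?nnegrE ?subr_ge0//; lra.
move/fine_cvgP : h => [_ /cvgrPdist_lt/(_ (eta ^+ 2))].
rewrite exprn_gt0// => /(_ isT)[N _ /(_ N)].
rewrite /= sub0r normrN => /(_ (leqnn N)) h.
exists (s N); split=> //.
rewrite -(@gtr0_norm _ eta)// -sqrtr_sqr ltr_sqrt ?exprn_gt0//.
by apply: le_lt_trans h; exact: ler_norm.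
Unshelve. all: by end_near. Qed.

End simple_approximation.

Lemma trivIset_bigcup_disjoint (T : Type) (F : nat -> set T) n : trivIset setT F ->
  \bigcup_(i in `I_n) F i `&` F n = set0.
Proof.
move=> tF; rewrite -subset0 => x [[i /= ilt Fi] Fn].
have ein := tF i n I I (ex_intro _ x (conj Fi Fn)).
by rewrite ein ltnn in ilt.
Qed.

(** * The Riesz theorem for a finite measure *)

Section riesz.
Context d (T : measurableType d) (R : realType).
Variable mu : {measure set T -> \bar R}.
Hypothesis mufin : (mu setT < +oo)%E.
Variables (L : (T -> R) -> R) (C : R).
Hypothesis LD : forall f g, sqint mu f -> sqint mu g ->
  L (fun x => f x + g x) = L f + L g.
Hypothesis LZ : forall k f, sqint mu f -> L (fun x => k * f x) = k * L f.
Hypothesis LC : forall f, sqint mu f -> `|L f| <= C * l2n mu f.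
Hypothesis C0 : 0 <= C.

(** Radon-Nikodym is applied to a bundled finite measure; restricting [mu] to the whole space yields
    this bundle with the same values. *)
Let mu' : {finite_measure set T -> \bar R} := mfrestr measurableT mufin.

Let mu'E A : mu' A = mu A.
Proof. by change (mu (A `&` setT) = mu A); rewrite setIT. Qed.

Let int_mu' D (F : T -> \bar R) :
  (\int[mu]_(x in D) F x = \int[mu']_(x in D) F x)%E.
Proof. by apply: eq_measure_integral => A mA _; rewrite -mu'E. Qed.

Lemma finite_measure_fin_num A : measurable A -> mu A \is a fin_num.
Proof.
move=> mA; rewrite ge0_fin_numE//; apply: le_lt_trans mufin.
by apply: le_measure; rewrite ?inE.
Qed.

Lemma sqint_bounded (f : T -> R) (K : R) : measurable_fun setT f ->
  (forall x, `|f x| <= K) -> sqint mu f.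
Proof.
move=> mf fK; split=> //.
apply: (@integrable_le _ _ _ _ _ (cst (K ^+ 2))).
- exact: measurable_funX.
- move=> x; rewrite normrX lerXn2r ?nnegrE//; exact: le_trans (fK x).
- apply/integrableP; split; first exact/measurable_EFinP.
  have h := integral_cst mu measurableT (`|K ^+ 2|)%:E.
  rewrite [X in (X < _)%E](_ : _ = `|K ^+ 2|%:E * mu setT)%E; last exact: h.
  by rewrite lte_mul_pinfty// lee_fin.
Qed.

Lemma sqint_indic A : measurable A -> sqint mu (\1_A : T -> R).
Proof.
move=> mA; apply: (@sqint_bounded _ 1).
  exact: measurable_indic.
by move=> x; rewrite indicE ger0_norm// lern1; case: (_ \in _).
Qed.

Lemma sqr_l2n_indic A : measurable A -> l2n mu (\1_A : T -> R) ^+ 2 = fine (mu A).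
Proof.
move=> mA; rewrite sqr_l2n /Rintegral.
under eq_integral => x _ do rewrite indicE expr2 -natrM mulnb andbb -indicE.
by rewrite integral_indic// setIT.
Qed.

(** If [L] is integration against some [h], this is the charge of density [h]; conversely [h] is
    recovered as its Radon-Nikodym derivative. *)
Let nu (A : set T) : \bar R := (L (\1_A : T -> R))%:E.

Let L_zero : L (fun=> 0) = 0.
Proof.
rewrite -[RHS](mul0r (L (fun=> 0))) -LZ; last exact: sqint0.
congr L.
by apply/funext => x; rewrite mul0r.
Qed.

Let LN f : sqint mu f -> L (fun x => - f x) = - L f.
Proof. by move=> sf; rewrite -mulN1r -LZ//; congr L; apply/funext => x; rewrite mulN1r. Qed.

Let LB f g : sqint mu f -> sqint mu g -> L (fun x => f x - g x) = L f - L g.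
Proof.
move=> sf sg; rewrite -LN// -LD//.
by have := sqintZ (-1) sg; under eq_fun do rewrite mulN1r.
Qed.

Let nu0 : nu set0 = 0%E.
Proof. by rewrite /nu indic0 L_zero. Qed.

Let nufin A : measurable A -> nu A \is a fin_num. Proof. by []. Qed.

Let L_bigsetU (F : nat -> set T) n : (forall i, measurable (F i)) ->
  trivIset setT F ->
  \sum_(0 <= i < n) L (\1_(F i) : T -> R) = L (\1_(\big[setU/set0]_(i < n) F i) : T -> R).
Proof.
move=> mF tF; elim: n => [|n IH]; first by rewrite big_nil big_ord0 indic0 L_zero.
rewrite big_nat_recr//= big_ord_recr/= IH -LD; last 2 first.
- by apply: sqint_indic; exact: bigsetU_measurable.
- exact: sqint_indic.
congr L; apply/funext => x; rewrite !indicE in_setU.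
have dis : \big[setU/set0]_(i < n) F i `&` F n = set0.
  by rewrite -bigcup_mkord; exact: trivIset_bigcup_disjoint.
have [xU|] := boolP (x \in _); last by rewrite add0r.
have [xF|] := boolP (x \in F n); last by rewrite addr0.
have : x \in (set0 : set T) by rewrite -dis in_setI xU.
by rewrite in_set0.
Qed.

(** What is left of the union after n sets has a value under [L] of at most [C] times the square
    root of its measure, and this measure tends to 0 because [mu] is finite. *)
Let nu_sigma : semi_sigma_additive nu.
Proof.
move=> F mF tF mUF; rewrite /nu.
have := @measure_semi_sigma_additive _ _ _ mu F mF tF mUF.
rewrite -[X in _ --> X](fineK (finite_measure_fin_num mUF)) => /fine_cvgP[] hfin hcv.
apply: cvg_EFin; first by near=> n; rewrite sumEFin.
apply/cvgrPdist_le => e e0.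
(* The tolerance on the measure is [(e / C) ^+ 2], which makes no sense for C = 0; in that case [L]
   vanishes. *)
have [C00|Cpos] := eqVneq C 0.
  near=> n; rewrite /= sumEFin/= L_bigsetU// -LB; last 2 first.
  - exact: sqint_indic.
  - by apply: sqint_indic; exact: bigsetU_measurable.
  apply: le_trans (LC _) _; last by rewrite C00 mul0r ltW.
  by apply: sqintB; apply: sqint_indic => //; exact: bigsetU_measurable.
have {}Cpos : 0 < C by rewrite lt_neqAle eq_sym Cpos.
have eC : 0 < (e / C) ^+ 2 by rewrite exprn_gt0// divr_gt0.
move/cvgrPdist_le : hcv => /(_ _ eC) hcv.
near=> n; rewrite /= sumEFin/= L_bigsetU// -LB; last 2 first.
- exact: sqint_indic.
- by apply: sqint_indic; exact: bigsetU_measurable.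
set G := \big[setU/set0]_(i < n) F i.
have mG : measurable G by exact: bigsetU_measurable.
have GF : G `<=` \bigcup_n F n by rewrite /G -bigcup_mkord => x [i _ Fi]; exists i.
have -> : (fun x => \1_(\bigcup_n F n) x - \1_G x) =
    \1_(\bigcup_n F n `\` G) :> (T -> R).
  apply/funext => x; rewrite !indicE in_setD.
  have [xG|] := boolP (x \in G); last by rewrite subr0 andbT.
  by rewrite (mem_set (GF _ (set_mem xG))) subrr andbF.
have mD : measurable (\bigcup_n F n `\` G) by exact: measurableD.
apply: le_trans (LC (sqint_indic mD)) _.
rewrite mulrC -ler_pdivlMr//.
rewrite -[leLHS]ger0_norm ?l2n_ge0// -[leRHS]ger0_norm; last by rewrite divr_ge0 ?ltW.
rewrite -ler_sqr ?nnegrE// !real_normK ?num_real// sqr_l2n_indic//.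
have : `|fine (mu (\bigcup_n F n)) - fine (\sum_(0 <= i < n) mu (F i))| <= (e / C) ^+ 2.
  by near: n.
apply: le_trans.
rewrite measureD//; last by rewrite -ge0_fin_numE// finite_measure_fin_num.
rewrite (setIidr GF) fineB ?finite_measure_fin_num// big_mkord /G measure_bigsetU//.
exact: ler_norm.
Unshelve. all: by end_near. Qed.

HB.instance Definition _ := isCharge.Build _ _ _ nu nu0 nufin nu_sigma.

Let nuC : {charge set T -> \bar R} := nu.

Let nu_dominates : nuC `<< mu'.
Proof.
apply/null_content_dominatesP => A mA A0'.
have A0 : mu A = 0%E by rewrite -mu'E; exact: A0'.
suff : L (\1_A : T -> R) = 0 by rewrite /nuC/= /nu => ->.
apply/eqP; rewrite -normr_le0; apply: le_trans (LC (sqint_indic mA)) _.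
have : l2n mu (\1_A : T -> R) ^+ 2 = 0 by rewrite sqr_l2n_indic// A0.
by move/eqP; rewrite sqrf_eq0 => /eqP ->; rewrite mulr0.
Qed.

Let h (x : T) : R := fine (Radon_Nikodym nuC mu' x).

Let h_int : mu.-integrable setT (EFin \o h).
Proof.
have hi := Radon_Nikodym_integrable nu_dominates.
have hE : EFin \o h = Radon_Nikodym nuC mu'.
  by apply/funext => x; rewrite /h /= fineK// Radon_Nikodym_fin_num.
rewrite hE; move/integrableP : hi => [mh hi]; apply/integrableP; split=> //.
by rewrite int_mu'; exact: hi.
Qed.

Let h_indic A : measurable A -> L (\1_A : T -> R) = \int[mu]_x (h x * \1_A x).
Proof.
move=> mA; have := Radon_Nikodym_integral nu_dominates mA.
rewrite /nuC/= /nu => /(congr1 fine)/= ->.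
have -> : (fun x => h x * \1_A x) = h \_ A by rewrite patch_indic.
rewrite -Rintegral_mkcond /Rintegral.
congr fine; rewrite int_mu'.
by apply: eq_integral => x _; rewrite /h fineK// Radon_Nikodym_fin_num.
Qed.

(** The factor [\1_B] is carried along so that the identity applies to a simple function times the
    sign of [h], through the set where [h] is nonnegative and its complement. *)
Let h_simple (s : {nnsfun T >-> R}) (B : set T) : measurable B ->
  L (fun x => s x * \1_B x) = \int[mu]_x (h x * (s x * \1_B x)).
Proof.
move=> mB.
pose Q (f : T -> R) := [/\ sqint mu (fun x => f x * \1_B x),
  mu.-integrable setT (EFin \o (fun x => h x * (f x * \1_B x))) &
  L (fun x => f x * \1_B x) = \int[mu]_x (h x * (f x * \1_B x))].
suff [] : Q s by [].
apply: simple_fun_ind => [|f k A [sf hf Lf] mA].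
  have e : (fun x : T => 0 * \1_B x : R) = fun=> 0 by apply/funext => x; rewrite mul0r.
  have e' : (fun x : T => h x * (0 * \1_B x) : R) = fun=> 0.
    by apply/funext => x; rewrite mul0r mulr0.
  rewrite /Q e e'; split; [exact: sqint0|exact: integrable0|].
  by rewrite L_zero /Rintegral integral0.
have mAB : measurable (A `&` B) by exact: measurableI.
have sAB := sqint_indic mAB.
have hAB : mu.-integrable setT (EFin \o (fun x => h x * \1_(A `&` B) x)).
  have mh := integrable_measurable h_int.
  apply: (@integrable_le _ _ _ _ _ (fun x => `|h x|)).
  - by apply: measurable_funM => //; exact: measurable_indic.
  - by move=> x; rewrite normrM ler_piMr// indicE; case: (_ \in _); rewrite ?normr1 ?normr0.
  - exact: integrable_norm.
have e : (fun x => (f x + k * \1_A x) * \1_B x) =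
    fun x => f x * \1_B x + k * \1_(A `&` B) x.
  by apply/funext => x; rewrite indicI mulrDl mulrA.
have e' : (fun x => h x * ((f x + k * \1_A x) * \1_B x)) =
    fun x => h x * (f x * \1_B x) + k * (h x * \1_(A `&` B) x).
  by apply/funext => x; rewrite indicI /=; ring.
rewrite /Q e e'; split.
- by apply: sqintD => //; exact: sqintZ.
- by apply: integrable_plus => //; exact: integrable_scale.
- rewrite LD//; last exact: sqintZ.
  rewrite LZ// Lf h_indic// RintegralD//; last exact: integrable_scale.
  by rewrite RintegralZl.
Qed.

Let integrableTM (s : T -> R) (K : R) : measurable_fun setT s ->
  (forall x, `|s x| <= K) ->
  mu.-integrable setT (EFin \o (fun x => h x * s x)).
Proof.
move=> ms sK; have mh := integrable_measurable h_int.
apply: (@integrable_le _ _ _ _ _ (fun x => K * `|h x|)).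
- exact: measurable_funM.
- by move=> x; rewrite normrM mulrC ler_wpM2r.
- by apply: integrable_scale; exact: integrable_norm.
Qed.

Lemma simple_bounded (s : {nnsfun T >-> R}) : exists K, forall x, `|s x| <= K.
Proof.
apply: (simple_fun_ind (Q := fun f => exists K, forall x, `|f x| <= K)) s.
  by exists 0 => x; rewrite normr0.
move=> f k A [K fK] mA; exists (K + `|k|) => x.
apply: le_trans (ler_normD _ _) _; apply: lerD => //.
by rewrite normrM ler_piMr// indicE; case: (_ \in _); rewrite ?normr1 ?normr0.
Qed.

(** Duality with bounded test functions, since [h] is only known to be integrable so far: [phi],
    which is [s] times the sign of [h], has the norm of [s], and s <= |h| makes the squared norm of
    [s] at most the integral of [h phi], that is [L phi], hence at most [C] times the norm of
    [s]. *)
Let h_l2n_le (s : {nnsfun T >-> R}) : (forall x, s x <= `|h x|) -> l2n mu s <= C.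
Proof.
move=> sh; have [K sK] := simple_bounded s.
have ms : measurable_fun setT s by exact: measurable_funP.
have ss : sqint mu s by exact: (sqint_bounded ms sK).
have mh := integrable_measurable h_int.
have mB : measurable [set x | 0 <= h x].
  rewrite -[X in measurable X]setTI; exact: measurable_fun_ler.
pose B := [set x | 0 <= h x].
pose phi x : R := s x * \1_B x - s x * \1_(~` B) x.
have phiE x : phi x = if 0 <= h x then s x else - s x.
  rewrite /phi !indicE in_setC; case: ifPn => hx.
    by rewrite mem_set// mulr1 mulr0 subr0.
  by rewrite memNset ?mulr0 ?mulr1 ?sub0r//; exact/negP.
have mC : measurable (~` B) by exact: measurableC.
have mphi : measurable_fun setT phi.
  by apply: measurable_funB; apply: measurable_funM => //; exact: measurable_indic.
have nphi x : `|phi x| = s x by rewrite phiE; case: ifP => _; rewrite ?normrN ger0_norm.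
have sphi : sqint mu phi by apply: (sqint_bounded mphi) => x; rewrite nphi (le_trans (ler_norm _)).
have s1b (D : set T) x : `|s x * \1_D x| <= K.
  rewrite normrM; apply: le_trans (sK x).
  by rewrite ler_piMr// indicE; case: (_ \in _); rewrite ?normr1 ?normr0.
have s1 D : measurable D -> sqint mu (fun x => s x * \1_D x).
  move=> mD; apply: (@sqint_bounded _ K) => //.
  by apply: measurable_funM => //; exact: measurable_indic.
have Lphi : L phi = \int[mu]_x (h x * phi x).
  rewrite /phi LB; [|exact: s1|exact: s1].
  rewrite !h_simple// -RintegralB//.
  - by apply: eq_Rintegral => x _; ring.
  - by apply: (@integrableTM _ K) => //; case: (s1 B mB).
  - by apply: (@integrableTM _ K) => //; case: (s1 _ mC).
have : l2n mu s ^+ 2 <= C * l2n mu s.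
  have -> : l2n mu s = l2n mu phi.
    congr Num.sqrt; apply: eq_Rintegral => x _.
    by rewrite -[in RHS]real_normK ?num_real// nphi.
  apply: (le_trans _ (LC sphi)); apply: (le_trans _ (ler_norm _)).
  rewrite Lphi sqr_l2n.
  apply: le_Rintegral => //; first by case: sphi.
    by apply: (@integrableTM _ K mphi) => x; rewrite nphi (le_trans (ler_norm _)).
  move=> x _; rewrite -real_normK ?num_real// nphi phiE; case: ifPn => hx.
    rewrite expr2 ler_wpM2r// (le_trans (sh x))// ger0_norm//.
  rewrite -ltNge in hx; rewrite mulrN -mulNr expr2 ler_wpM2r// (le_trans (sh x))// ltr0_norm//.
have [->//|n0] := eqVneq (l2n mu s) 0.
by rewrite expr2 ler_pM2r// lt_neqAle eq_sym n0 l2n_ge0.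
Qed.

(** Fatou's lemma along simple functions tending to |h| from below, each of norm at most [C]. *)
Let h_sqint : sqint mu h.
Proof.
have mh := integrable_measurable h_int; apply: sqintP => //.
have mnh : measurable_fun setT (fun x => `|h x|) by exact: measurableT_comp.
have [s [sh cs]] := simple_approx mnh (fun x => normr_ge0 (h x)).
apply: (@le_lt_trans _ _ (C ^+ 2)%:E); last exact: ltry.
have cv x : ((s n x) ^+ 2)%:E @[n --> \oo] --> ((h x) ^+ 2)%:E.
  apply: cvg_EFin; first by near=> n.
  have h2 := cvgM (cs x) (cs x); rewrite -expr2 real_normK ?num_real// in h2.
  exact: h2.
have -> : (\int[mu]_x (h x ^+ 2)%:E = \int[mu]_x limn_einf (fun n => (s n x ^+ 2)%:E))%E.
  by apply: eq_integral => x _; rewrite (is_cvg_limn_einfE (cvgP _ (cv x))) (cvg_lim _ (cv x)).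
have ms n : measurable_fun setT (fun x => (s n x ^+ 2)%:E).
  by apply/measurable_EFinP; apply: measurable_funX; exact: measurable_funP.
apply: le_trans (fatou _ _ _ _) _ => //.
  by move=> n x _; rewrite lee_fin sqr_ge0.
have le n : (\int[mu]_x (s n x ^+ 2)%:E <= (C ^+ 2)%:E)%E.
  have sC : l2n mu (s n) <= C.
    by apply: h_l2n_le => x; have /andP[] := sh n x.
  have [K sK] := simple_bounded (s n).
  have [_ s2] : sqint mu (s n) by apply: (sqint_bounded _ sK); exact: measurable_funP.
  rewrite -(fineK (integrable_fin_num measurableT s2)) lee_fin.
  have -> : fine (\int[mu]_x (EFin \o (fun x => s n x ^+ 2)%R) x)%E = l2n mu (s n) ^+ 2.
    by rewrite sqr_l2n.
  by rewrite lerXn2r// nnegrE l2n_ge0.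
rewrite limn_einf_lim; apply: lime_le; first exact: is_cvg_einfs.
by near=> n; apply: le_trans (le n); apply: ereal_inf_lbound; exists n => /=.
Unshelve. all: by end_near. Qed.

Let h_nonneg f : sqint mu f -> (forall x, 0 <= f x) -> L f = \int[mu]_x (h x * f x).
Proof.
move=> sf f0; apply/eqP; rewrite -subr_eq0 -normr_le0; apply/ler_addgt0Pr => e e0.
rewrite add0r.
(* [L] and integration against [h] are bounded by [C] and by the norm of [h], so replacing [f] by
   [s] costs at most the sum of these bounds times the distance; the 1 keeps the divisor
   positive. *)
have K0 : 0 < C + l2n mu h + 1 by rewrite ltr_pwDr// addr_ge0// l2n_ge0.
have [s [sf' /ltW sl]] := simple_approx_l2n sf f0 (divr_gt0 e0 K0).
have [K sK] := simple_bounded s.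
have ms : measurable_fun setT s by exact: measurable_funP.
have ss : sqint mu s by exact: (sqint_bounded ms sK).
have sfs := sqintB sf ss.
have Ls : L s = \int[mu]_x (h x * s x).
  have := @h_simple s setT measurableT.
  have -> : (fun x => s x * \1_setT x) = s.
    by apply/funext => x; rewrite indicT /= mulr1.
  by move=> ->; apply: eq_Rintegral => x _; rewrite indicT /= mulr1.
have -> : L f - \int[mu]_x (h x * f x) =
    L (fun x => f x - s x) - \int[mu]_x (h x * (f x - s x)).
  rewrite LB// Ls.
  have -> : \int[mu]_x (h x * (f x - s x)) =
      \int[mu]_x (h x * f x) - \int[mu]_x (h x * s x).
    rewrite -RintegralB//; [|exact: sqintM|exact: sqintM].
    by apply: eq_Rintegral => x _; rewrite mulrBr.
  by rewrite opprB addrA subrK.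
apply: le_trans (ler_normB _ _) _.
apply: le_trans (lerD (LC sfs) (cauchy_schwarz h_sqint sfs)) _.
rewrite -mulrDl; apply: le_trans (ler_wpM2l _ sl) _.
  by rewrite addr_ge0// l2n_ge0.
by rewrite mulrA ler_pdivrMr// mulrC ler_wpM2l ?(ltW e0)// lerDl.
Qed.

Theorem riesz_representation : exists2 h : T -> R, sqint mu h &
  forall f, sqint mu f -> L f = \int[mu]_x (h x * f x).
Proof.
exists h => // f sf; have [mf _] := sf.
have sp : sqint mu (f^\+)%R.
  apply: (@sqint_le _ _ _ _ _ f 1) => //; first exact: measurable_funrpos.
  by move=> x; rewrite mul1r /funrpos; case: (leP (f x) 0) => _; rewrite ?normr0.
have sn : sqint mu (f^\-)%R.
  apply: (@sqint_le _ _ _ _ _ f 1) => //; first exact: measurable_funrneg.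
  by move=> x; rewrite mul1r /funrneg; case: (leP (- f x) 0) => _; rewrite ?normr0 ?normrN.
have fE x : f x = (f^\+)%R x - (f^\-)%R x by rewrite -[in LHS](funrposBneg f).
have -> : L f = L (fun x => (f^\+)%R x - (f^\-)%R x) by congr L; apply/funext.
rewrite LB// !h_nonneg// -RintegralB//; [|exact: sqintM|exact: sqintM].
by apply: eq_Rintegral => x _; rewrite -mulrBr -fE.
Qed.

End riesz.

(** * The space L2 a b *)

Section Lfun2.
Context d (T : measurableType d) (R : realType).
Variable mu : {measure set T -> \bar R}.

Lemma sqint_int (f : T -> R) : sqint mu f ->
  (\int[mu]_x (f x ^+ 2)%:E)%E = (l2n mu f ^+ 2)%:E.
Proof. by move=> [_ f2]; rewrite sqr_l2n /Rintegral fineK// integrable_fin_num. Qed.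

Lemma Lnorm2_l2n (f : T -> R) : sqint mu f ->
  'N[mu]_2%:E[EFin \o f]%E = (l2n mu f)%:E.
Proof.
move=> sf; rewrite unlock /Lnorm.
under eq_integral => x _ do rewrite /= powR_mulrn// real_normK ?num_real//.
rewrite sqint_int// poweR_EFin; congr EFin.
rewrite -powR_mulrn ?l2n_ge0// -powRrM mulfV// powRr1//; exact: l2n_ge0.
Qed.

Lemma Lfun2P (f : T -> R) : f \in Lfun mu 2%:E <-> sqint mu f.
Proof.
split=> [fL|sf].
  split; last exact: Lfun2_integrable_sqr.
  by move: fL; rewrite inE => /andP[/[!inE]].
rewrite inE; apply/andP; split; rewrite inE /=; first by case: sf.
by rewrite /finite_norm Lnorm2_l2n// ltry.
Qed.

End Lfun2.

Section L2_space.
Context (R : realType) (a b : R).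
Local Notation leb := (lebesgue_on a b).
Implicit Types f g h : L2 a b.

Lemma lebesgue_on_finite : (leb setT < +oo)%E.
Proof.
by change ((@lebesgue_measure R (setT `&` `[a, b]) < +oo)%E); rewrite setTI lebesgue_measure_itv /=; case: ifP => _; rewrite -?EFinB ltry.
Qed.

Lemma L2_sqint f : sqint leb f.
Proof. by apply/Lfun2P; exact: LfunP. Qed.

Lemma L2_of (f : R -> R) : sqint leb f -> exists g : L2 a b, g =1 f.
Proof. by move=> /Lfun2P fL; exists (Lfun_Sub (lee1n 2) fL). Qed.

Lemma L2_normE f : L2_norm f = l2n leb f.
Proof. by rewrite /L2_norm Lnorm2_l2n//; exact: L2_sqint. Qed.

Lemma L2_norm_ge0 f : 0 <= L2_norm f. Proof. by rewrite L2_normE l2n_ge0. Qed.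

Lemma L2_innerC f g : L2_inner f g = L2_inner g f.
Proof. by apply: eq_Rintegral => t _; rewrite mulrC. Qed.

Lemma L2_innerDl f g h : L2_inner (f + g) h = L2_inner f h + L2_inner g h.
Proof.
rewrite /L2_inner -RintegralD//.
- by apply: eq_Rintegral => t _; rewrite mulrDl.
- by apply: sqintM; exact: L2_sqint.
- by apply: sqintM; exact: L2_sqint.
Qed.

Lemma L2_innerZl k f h : L2_inner (k *: f) h = k * L2_inner f h.
Proof.
rewrite /L2_inner -RintegralZl//.
- by apply: eq_Rintegral => t _; rewrite mulrA.
- by apply: sqintM; exact: L2_sqint.
Qed.

Lemma L2_innerNl f h : L2_inner (- f) h = - L2_inner f h.
Proof. by rewrite -scaleN1r L2_innerZl mulN1r. Qed.

Lemma L2_innerBl f g h : L2_inner (f - g) h = L2_inner f h - L2_inner g h.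
Proof. by rewrite L2_innerDl L2_innerNl. Qed.

Lemma L2_innerDr f g h : L2_inner h (f + g) = L2_inner h f + L2_inner h g.
Proof. by rewrite L2_innerC L2_innerDl !(L2_innerC h). Qed.

Lemma L2_innerZr k f h : L2_inner h (k *: f) = k * L2_inner h f.
Proof. by rewrite L2_innerC L2_innerZl (L2_innerC h). Qed.

Lemma L2_inner_self f : L2_inner f f = L2_norm f ^+ 2.
Proof. by rewrite L2_normE sqr_l2n; apply: eq_Rintegral => t _; rewrite expr2. Qed.

Lemma L2_cauchy_schwarz f g : `|L2_inner f g| <= L2_norm f * L2_norm g.
Proof. by rewrite !L2_normE; apply: cauchy_schwarz; exact: L2_sqint. Qed.

Lemma L2_normD f g : L2_norm (f + g) <= L2_norm f + L2_norm g.
Proof. by rewrite !L2_normE; apply: ler_l2nD; exact: L2_sqint. Qed.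

Lemma L2_normZ k f : L2_norm (k *: f) = `|k| * L2_norm f.
Proof. by rewrite !L2_normE -l2nZ//; exact: L2_sqint. Qed.

Lemma L2_normN f : L2_norm (- f) = L2_norm f.
Proof. by rewrite -scaleN1r L2_normZ normrN1 mul1r. Qed.

(** The extremal direction is [f] divided by its norm. This reduces convergence in norm to scalar
    estimates uniform over the unit ball. *)
Lemma L2_norm_le_dual f (e : R) : 0 <= e ->
  (forall g, L2_norm g <= 1 -> L2_inner f g <= e) -> L2_norm f <= e.
Proof.
move=> e0 h; have [->//|f0] := eqVneq (L2_norm f) 0.
have fp : 0 < L2_norm f by rewrite lt_neqAle eq_sym f0 L2_norm_ge0.
have := h ((L2_norm f)^-1 *: f).
rewrite L2_normZ gtr0_norm ?invr_gt0// mulVf// => /(_ (lexx _)).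
by rewrite L2_innerZr L2_inner_self expr2 mulrA mulVf// mul1r.
Qed.

(** The preimage of an open half-line is open for the seminorm, hence a generator of the
    sigma-algebra. [C] has no prescribed sign, whence the radius with divisor [|C| + 1]. *)
Lemma measurable_L2_lipschitz (F : L2 a b -> R) (C : R) :
  (forall y z, `|F z - F y| <= C * L2_norm (z - y)) -> measurable_fun setT F.
Proof.
move=> FC; apply: (measurability _ (RGenOInfty.measurableE R)).
move=> _ [_ [r ->] <-]; rewrite setTI; apply: sub_sigma_algebra => y /=.
rewrite in_itv/= andbT => rF.
have K0 : 0 < `|C| + 1 by rewrite ltr_pwDr.
exists ((F y - r) / (`|C| + 1)); first by rewrite divr_gt0// subr_gt0.
move=> z; rewrite ltr_pdivlMr// => zy; rewrite /= in_itv/= andbT.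
have : `|F z - F y| < F y - r.
  apply: le_lt_trans (FC y z) _; apply: le_lt_trans zy; rewrite mulrC.
  by apply: ler_wpM2l; [exact: L2_norm_ge0|rewrite (le_trans (ler_norm C))// lerDl].
by rewrite ltr_norml => /andP[]; lra.
Qed.

Lemma measurable_L2_inner f : measurable_fun setT (fun y : L2 a b => L2_inner y f).
Proof.
apply: (@measurable_L2_lipschitz _ (L2_norm f)) => y z.
by rewrite -L2_innerBl mulrC L2_cauchy_schwarz.
Qed.

Lemma measurable_L2_norm : measurable_fun setT (@L2_norm R a b).
Proof.
apply: (@measurable_L2_lipschitz _ 1) => y z; rewrite mul1r ler_norml.
have := L2_normD (z - y) y; have := L2_normD (y - z) z.
rewrite !subrK -(opprB z y) L2_normN => *; apply/andP; split; lra.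
Qed.

Theorem L2_riesz (L : L2 a b -> R) (C : R) :
  (forall f g, L (f + g) = L f + L g) -> (forall k f, L (k *: f) = k * L f) ->
  (forall f, `|L f| <= C * L2_norm f) ->
  exists h : L2 a b, forall f, L2_inner h f = L f.
Proof.
move=> LD LZ LC.
(* The Riesz theorem concerns functionals of plain functions, so [L] is read through any pointwise
   equal element of [L2]; the default 0 is taken only on functions that are not
   square-integrable. *)
pose L' (f : R -> R) : R :=
  if pselect (exists g : L2 a b, g =1 f) is left e then L (sval (cid e)) else 0.
have L'E (f : L2 a b) (f' : R -> R) : f =1 f' -> L' f' = L f.
  move=> ff; rewrite /L'; case: pselect => [e|[]]; last by exists f.
  by congr L; apply/LfuneqP => t; rewrite (svalP (cid e)) ff.
have [||||h sh hL] := @riesz_representation _ _ _ leb lebesgue_on_finite L' `|C|.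
- move=> f' g' /L2_of[f ff] /L2_of[g gg]; rewrite (L'E _ _ ff) (L'E _ _ gg).
  by rewrite -LD; apply: L'E => t; rewrite -ff -gg.
- move=> k f' /L2_of[f ff]; rewrite (L'E _ _ ff) -LZ.
  by apply: L'E => t; rewrite -ff.
- move=> f' /L2_of[f ff]; rewrite (L'E _ _ ff).
  have -> : f' = f by apply/funext => t; rewrite ff.
  rewrite -L2_normE (le_trans (LC f))// ler_wpM2r ?L2_norm_ge0//; exact: ler_norm.
- exact: normr_ge0.
have [g gh] := L2_of sh; exists g => f.
rewrite -(L'E f f)// hL; last exact: L2_sqint.
by apply: eq_Rintegral => t _; rewrite gh.
Qed.

End L2_space.

(** * Densities and differentiability in quadratic mean *)

Section density.
Context d (T : measurableType d) (R : realType).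
Variables (nu : {sigma_finite_measure set T -> \bar R}).
Implicit Types (P : probability T R) (q : T -> R).

Definition has_density P q : Prop :=
  [/\ measurable_fun setT q, forall w, 0 <= q w &
      forall A, measurable A -> (P A = \int[nu]_(w in A) (q w)%:E)%E].

Lemma has_density_dominates P q : has_density P q -> P `<< nu.
Proof.
move=> [mq q0 Pq]; apply/null_content_dominatesP => A mA nA; rewrite Pq//.
by apply: null_set_integral => //; apply: measurable_funTS; exact/measurable_EFinP.
Qed.

(** By uniqueness [q] agrees [nu]-almost everywhere with the Radon-Nikodym derivative, for which the
    change of variables is known. *)
Lemma ge0_integral_density P q (f : T -> R) : has_density P q ->
  measurable_fun setT f -> (forall w, 0 <= f w) ->
  (\int[P]_w (f w)%:E = \int[nu]_w (f w * q w)%:E)%E.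
Proof.
move=> hq mf f0; have [mq q0 Pq] := hq; have dom := has_density_dominates hq.
have f0' x : (0%R <= (EFin \o f) x)%E by rewrite lee_fin.
have mf' : measurable_fun setT (EFin \o f) by exact/measurable_EFinP.
have mq' : measurable_fun setT (EFin \o q) by exact/measurable_EFinP.
rewrite -(Radon_Nikodym_SigmaFinite.change_of_variables dom f0' measurableT mf').
have mg : measurable_fun setT (Radon_Nikodym_SigmaFinite.f P nu).
  by apply: measurable_int; exact: Radon_Nikodym_SigmaFinite.f_integrable.
apply: ae_eq_integral => //.
- exact: emeasurable_funM.
- by apply/measurable_EFinP; exact: measurable_funM.
have : ae_eq nu setT (Radon_Nikodym_SigmaFinite.f P nu) (EFin \o q).
  apply: integral_ae_eq => //.
    exact: Radon_Nikodym_SigmaFinite.f_integrable.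
  move=> A _ mA; rewrite -Radon_Nikodym_SigmaFinite.f_integral//; exact: Pq.
by apply: filterS => x /= -> //.
Qed.

Lemma integrable_density P q (f : T -> R) : has_density P q ->
  P.-integrable setT (EFin \o f) -> nu.-integrable setT (EFin \o (fun w => f w * q w)).
Proof.
move=> hq fi; have mf := integrable_measurable fi; have [mq q0 _] := hq.
apply/integrableP; split; first by apply/measurable_EFinP; exact: measurable_funM.
under eq_integral => w _ do rewrite /= normrM (ger0_norm (q0 w)).
rewrite -(@ge0_integral_density _ _ (fun w => `|f w|) hq)//; last exact: measurableT_comp.
by have /integrableP[] := fi.
Qed.

Lemma Rintegral_density P q (f : T -> R) : has_density P q ->
  P.-integrable setT (EFin \o f) -> \int[P]_w f w = \int[nu]_w (f w * q w).
Proof.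
move=> hq fi; have mf := integrable_measurable fi; have [mq q0 _] := hq.
have ip := integrable_funrpos measurableT fi.
have in_ := integrable_funrneg measurableT fi.
have e g : P.-integrable setT (EFin \o g) -> (forall w, 0 <= g w) ->
    \int[P]_w g w = \int[nu]_w (g w * q w).
  move=> gi g0; rewrite /Rintegral (ge0_integral_density hq)//.
  exact: integrable_measurable gi.
have -> : \int[P]_w f w = \int[P]_w (f^\+%R w - f^\-%R w).
  by apply: eq_Rintegral => w _; rewrite -[in LHS](funrposBneg f).
rewrite RintegralB// !e//.
rewrite -RintegralB//; [|exact: (integrable_density hq)|exact: (integrable_density hq)].
by apply: eq_Rintegral => w _; rewrite -mulrBl -[in RHS](funrposBneg f).
Qed.

(** Multiplication by the square root of the density embeds L^2(P) into L^2(nu), isometrically by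
    [l2n_density]. Functions under different laws thus meet in one Hilbert space. *)
Lemma sqint_density P q (f : T -> R) : has_density P q ->
  sqint P f -> sqint nu (fun w => f w * Num.sqrt (q w)).
Proof.
move=> hq [mf fi]; have [mq q0 _] := hq; split.
  apply: measurable_funM => //; apply: measurableT_comp => //.
  by apply: continuous_measurable_fun; exact: sqrt_continuous.
have := integrable_density hq fi; congr integrable; apply/funext => w /=.
by rewrite exprMn sqr_sqrtr.
Qed.

Lemma l2n_density P q (f : T -> R) : has_density P q -> sqint P f ->
  l2n nu (fun w => f w * Num.sqrt (q w)) = l2n P f.
Proof.
move=> hq [mf fi]; have [mq q0 _] := hq; congr Num.sqrt.
rewrite (Rintegral_density hq fi); apply: eq_Rintegral => w _.
by rewrite exprMn sqr_sqrtr.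
Qed.

Lemma sqint_prob P (f : T -> R) (K : R) : measurable_fun setT f ->
  (forall x, `|f x| <= K) -> sqint P f.
Proof.
move=> mf fK; apply: (sqint_bounded _ mf fK).
by rewrite [X in (X < _)%E]probability_setT ltry.
Qed.

Lemma sqint_cst P (k : R) : sqint P (cst k).
Proof. exact: (@sqint_prob _ _ `|k|). Qed.

Lemma sqint_integrable P (f : T -> R) : sqint P f -> P.-integrable setT (EFin \o f).
Proof.
move=> sf; have := sqintM sf (sqint_cst P 1).
by under [X in integrable _ _ (_ \o X)]eq_fun do rewrite mulr1.
Qed.

Lemma Rintegral_le_l2n P (f : T -> R) : sqint P f -> `|\int[P]_w f w| <= l2n P f.
Proof.
move=> sf; have := cauchy_schwarz sf (sqint_cst P 1).
have -> : l2n P (cst 1) = 1.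
  by rewrite /l2n; under eq_Rintegral do rewrite /= expr1n; rewrite Rintegral_cst//= probability_setT/= mulr1 sqrtr1.
by rewrite mulr1; under eq_Rintegral do rewrite mulr1.
Qed.

(** * Square roots of two densities and the Hellinger distance *)

Section two_densities.
Variables (P0 P1 : probability T R) (q0 q1 S : T -> R) (e : R).
Hypotheses (hq0 : has_density P0 q0) (hq1 : has_density P1 q1).
Hypotheses (sS : sqint P0 S) (e0 : e != 0).

Let u0 w := Num.sqrt (q0 w).
Let u1 w := Num.sqrt (q1 w).

Let su0 : sqint nu u0.
Proof.
have := sqint_density hq0 (sqint_cst P0 1).
by under [X in sqint _ X]eq_fun do rewrite mul1r.
Qed.

Let su1 : sqint nu u1.
Proof.
have := sqint_density hq1 (sqint_cst P1 1).
by under [X in sqint _ X]eq_fun do rewrite mul1r.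
Qed.

Let sqru0 w : u0 w * u0 w = q0 w.
Proof. by rewrite -expr2 sqr_sqrtr//; case: hq0. Qed.

Let sqru1 w : u1 w * u1 w = q1 w.
Proof. by rewrite -expr2 sqr_sqrtr//; case: hq1. Qed.

(** The Hellinger distance without the customary factor 1 / sqrt 2. *)
Definition hellinger : R := l2n nu (fun w => u1 w - u0 w).

Definition qmd_remainder (w : T) : R := (u1 w - u0 w) / e - S w * u0 w / 2.

Lemma sqint_qmd_remainder : sqint nu qmd_remainder.
Proof.
rewrite (_ : qmd_remainder = fun w => e^-1 * (u1 w - u0 w) - 2^-1 * (S w * u0 w)).
  apply: sqintB; apply: sqintZ; first exact: sqintB.
  exact: sqint_density sS.
by apply/funext => w; rewrite /qmd_remainder mulrC (mulrC 2^-1).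
Qed.

(** The remainder is defined so that u1 - u0 = e ([qmd_remainder] + S u0 / 2), and [S u0] has in
    L^2(nu) the norm of [S] in L^2(P0). *)
Lemma hellinger_le : hellinger <= `|e| * (l2n nu qmd_remainder + l2n P0 S / 2).
Proof.
have sr := sqint_qmd_remainder; have sw := sqint_density hq0 sS.
rewrite /hellinger (_ : (fun w => _) = fun w => e * (qmd_remainder w + 2^-1 * (S w * u0 w))).
  rewrite l2nZ; last by apply: sqintD => //; exact: sqintZ.
  rewrite ler_wpM2l//; apply: le_trans (ler_l2nD sr (sqintZ _ sw)) _.
  rewrite lerD2l l2nZ// (l2n_density hq0 sS) mulrC ger0_norm//.
by apply/funext => w; rewrite /qmd_remainder; field.
Qed.

Section test_function.
Variable Z : T -> R.
Hypotheses (sZ0 : sqint P0 Z) (sZ1 : sqint P1 Z).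

Let z0 w := Z w * u0 w.
Let z1 w := Z w * u1 w.
Let sz0 : sqint nu z0. Proof. exact: sqint_density sZ0. Qed.
Let sz1 : sqint nu z1. Proof. exact: sqint_density sZ1. Qed.

Let z10_le : l2n nu (fun w => z1 w + z0 w) <= l2n P1 Z + l2n P0 Z.
Proof.
by apply: le_trans (ler_l2nD sz1 sz0) _; rewrite /z1 /z0 (l2n_density hq1 sZ1) (l2n_density hq0 sZ0).
Qed.

(** The factorization q1 - q0 = (u1 - u0)(u1 + u0), with [Z] distributed over the second factor. *)
Lemma mean_diffE : \int[P1]_w Z w - \int[P0]_w Z w =
  \int[nu]_w ((u1 w - u0 w) * (z1 w + z0 w)).
Proof.
rewrite (Rintegral_density hq1 (sqint_integrable sZ1)).
rewrite (Rintegral_density hq0 (sqint_integrable sZ0)) -RintegralB//.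
- by apply: eq_Rintegral => w _; rewrite -sqru0 -sqru1 /z0 /z1; ring.
- exact: (integrable_density hq1 (sqint_integrable sZ1)).
- exact: (integrable_density hq0 (sqint_integrable sZ0)).
Qed.

Lemma mean_diff_le : `|\int[P1]_w Z w - \int[P0]_w Z w| <=
  hellinger * (l2n P1 Z + l2n P0 Z).
Proof.
rewrite mean_diffE; apply: le_trans (cauchy_schwarz (sqintB su1 su0) (sqintD sz1 sz0)) _.
by rewrite ler_wpM2l// l2n_ge0.
Qed.

(* The score is truncated, rather than Z, so that only second moments of Z
   under both laws are needed. *)
Lemma mean_derivative_le (K : R) : 0 < K ->
  `|(\int[P1]_w Z w - \int[P0]_w Z w) / e - \int[P0]_w (Z w * S w)| <=
  (l2n nu qmd_remainder + l2n P0 (tail K S)) * (l2n P1 Z + l2n P0 Z) +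
  K * hellinger * l2n P0 Z.
Proof.
move=> K0; have sr := sqint_qmd_remainder; have sw := sqint_density hq0 sS.
have [mS _] := sS; have [mZ _] := sZ0.
have st : sqint nu (fun w => tail K S w * u0 w).
  by apply: (sqint_density hq0); exact: sqint_tail.
pose s w := S w - tail K S w.
have sK w : `|s w| <= K.
  by rewrite /s /tail; case: ifP => ?; rewrite ?subr0// subrr normr0 ltW.
have ms : measurable_fun setT s by apply: measurable_funB => //; exact: measurable_tail.
have ssz : sqint nu (fun w => s w * z0 w).
  apply: (@sqint_le _ _ _ _ _ z0 K) => //.
    by apply: measurable_funM => //; case: sz0.
  by move=> w; rewrite normrM ler_wpM2r.
have sd := sqintB su1 su0; have sm := sqintB sz1 sz0; have sp := sqintD sz1 sz0.
have E0ZS : \int[P0]_w (Z w * S w) = \int[nu]_w (z0 w * (S w * u0 w)).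
  rewrite (Rintegral_density hq0 (sqintM sZ0 sS)); apply: eq_Rintegral => w _.
  by rewrite -sqru0 /z0; ring.
(* Replacing (u1 - u0) / e by the remainder plus S u0 / 2 leaves S u0 (z1 - z0) / 2 beside the
   remainder term. On the bounded part [s] of the score, u0 (z1 - z0) is rewritten as z0 (u1 - u0),
   which exhibits a Hellinger factor. *)
have -> : (\int[P1]_w Z w - \int[P0]_w Z w) / e - \int[P0]_w (Z w * S w) =
    \int[nu]_w (qmd_remainder w * (z1 w + z0 w)) +
    (2^-1 * \int[nu]_w (tail K S w * u0 w * (z1 w - z0 w)) +
     2^-1 * \int[nu]_w ((s w * z0 w) * (u1 w - u0 w))).
  rewrite mean_diffE E0ZS mulrC -!RintegralZl//;
    [|exact: sqintM|exact: sqintM|exact: sqintM].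
  have i1 := sqintM st sm; have i2 := sqintM ssz sd; have i3 := sqintM sd sp.
  have i4 := sqintM sz0 sw.
  rewrite -RintegralB//; [|exact: integrable_scale].
  rewrite -RintegralD//; [|exact: integrable_scale|exact: integrable_scale].
  rewrite -RintegralD//; [|exact: sqintM|].
    apply: eq_Rintegral => w _; rewrite /qmd_remainder /s /z0 /z1; field.
    exact: e0.
  by apply: integrable_plus; exact: integrable_scale.
apply: le_trans (ler_normD _ _) _; rewrite mulrDl -addrA.
apply: lerD.
  by apply: le_trans (cauchy_schwarz sr sp) _; rewrite ler_wpM2l// l2n_ge0.
have half (x : R) : `|2^-1 * x| <= `|x|.
  by rewrite normrM ger0_norm// ler_piMl// invf_le1// ler1n.
apply: le_trans (ler_normD _ _) _; apply: lerD; apply: le_trans (half _) _.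
  apply: le_trans (cauchy_schwarz st sm) _.
  rewrite (l2n_density hq0 (sqint_tail K sS)) ler_wpM2l ?l2n_ge0//.
  by apply: le_trans (ler_l2nB sz1 sz0) _; rewrite (l2n_density hq1 sZ1) (l2n_density hq0 sZ0).
apply: le_trans (cauchy_schwarz ssz sd) _.
rewrite mulrAC mulrC -/hellinger [leRHS]mulrC ler_wpM2l ?l2n_ge0//.
rewrite -(l2n_density hq0 sZ0); apply: ler_l2n => //.
- exact: ltW.
- by case: ssz.
- by move=> w; rewrite normrM ler_wpM2r.
Qed.

End test_function.
End two_densities.
End density.

(** * Conditional means and weights *)

Section orthogonality.
Context d d' (T : measurableType d) (T' : measurableType d') (R : realType).
Variables (mu : {measure set T -> \bar R}) (X : T -> T').
Hypothesis mX : measurable_fun setT X.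
Variable W : T -> R.
Hypothesis iW : mu.-integrable setT (EFin \o W).
Hypothesis W0 : forall B, measurable B ->
  (\int[mu]_(w in X @^-1` B) (W w)%:E)%E = 0%E.

Let bounded_integrable (k : T' -> R) (K : R) : measurable_fun setT k ->
  (forall x, `|k x| <= K) ->
  mu.-integrable setT (EFin \o (fun w => k (X w) * W w)).
Proof.
move=> mk kK; have mW := integrable_measurable iW.
apply: (@integrable_le _ _ _ _ _ (fun w => K * `|W w|)).
- by apply: measurable_funM => //; exact: measurableT_comp.
- by move=> w; rewrite normrM ler_wpM2r.
- by apply: integrable_scale; exact: integrable_norm.
Qed.

Let indic_orth B : measurable B -> \int[mu]_w (\1_B (X w) * W w) = 0.
Proof.
move=> mB; rewrite -[RHS](congr1 fine (W0 mB)) /= -/(Rintegral mu (X @^-1` B) W).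
rewrite [RHS]Rintegral_mkcond patch_indic; apply: eq_Rintegral => w _ /=.
by rewrite mulrC !indicE; congr (_ * (nat_of_bool _)%:R); apply/idP/idP; rewrite !inE.
Qed.

Let simple_orth (s : {nnsfun T' >-> R}) : \int[mu]_w (s (X w) * W w) = 0.
Proof.
pose Q (k : T' -> R) := [/\ measurable_fun setT k, exists K, forall x, `|k x| <= K &
  \int[mu]_w (k (X w) * W w) = 0].
suff [] : Q s by [].
apply: simple_fun_ind => [|f k A [mf [K fK] f0] mA].
  split=> //; first by exists 0 => x; rewrite normr0.
  by under eq_Rintegral do rewrite mul0r; rewrite Rintegral_cst// mul0r.
have mi : measurable_fun setT (\1_A : T' -> R) by exact: measurable_indic.
have i1 (x : T') : `|\1_A x| <= 1 :> R.
  by rewrite indicE; case: (_ \in _); rewrite ?normr1 ?normr0.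
split.
- by apply: measurable_funD => //; exact: measurable_funM.
- exists (K + `|k| * 1) => x; apply: le_trans (ler_normD _ _) _.
  by apply: lerD => //; rewrite normrM ler_wpM2l.
- under eq_Rintegral do rewrite mulrDl -mulrA.
  rewrite RintegralD//; last first.
    by apply: integrable_scale; exact: (bounded_integrable mi i1).
    exact: (bounded_integrable mf fK).
  rewrite f0 add0r RintegralZl//; first by rewrite indic_orth// mulr0.
  exact: (bounded_integrable mi i1).
Qed.

Let dominated_orth (k : T' -> R) (kn : nat -> T' -> R) (g : T -> R) :
  (forall n, measurable_fun setT (kn n)) ->
  (forall x, kn n x @[n --> \oo] --> k x) ->
  (forall n w, `|kn n (X w) * W w| <= g w) ->
  mu.-integrable setT (EFin \o g) ->
  (forall n, \int[mu]_w (kn n (X w) * W w) = 0) ->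
  \int[mu]_w (k (X w) * W w) = 0.
Proof.
move=> mk kc kg gi k0; have mW := integrable_measurable iW.
have h : (\int[mu]_w (kn n (X w) * W w)%:E)%E @[n --> \oo] -->
    (\int[mu]_w (k (X w) * W w)%:E)%E.
  apply: (@dominated_cvg _ _ _ mu setT measurableT _ _ (EFin \o g)) => //.
  - move=> n; apply/measurable_EFinP; apply: measurable_funM => //.
    by apply: measurableT_comp.
  - move=> w _; apply: cvg_EFin; first by near=> n.
    have h := cvgM (kc (X w)) (@cvg_cst _ (W w) nat \oo _).
    exact: h.
  - by move=> n w _; rewrite lee_fin.
have e n : (\int[mu]_w (kn n (X w) * W w)%:E)%E = 0%E.
  have ki : mu.-integrable setT (EFin \o (fun w => kn n (X w) * W w)).
    apply: (integrable_le _ (kg n) gi).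
    by apply: measurable_funM => //; apply: measurableT_comp.
  by rewrite -(fineK (integrable_fin_num measurableT ki)) -[fine _]/(Rintegral _ _ _) k0.
have : (\int[mu]_w (k (X w) * W w)%:E)%E = 0%E.
  by rewrite -(cvg_lim _ h)//; under eq_fun do rewrite e; exact: lim_cst.
by rewrite /Rintegral => ->.
Unshelve. all: by end_near. Qed.

Let bounded_orth (k : T' -> R) (K : R) : measurable_fun setT k ->
  (forall x, `|k x| <= K) -> \int[mu]_w (k (X w) * W w) = 0.
Proof.
move=> mk kK.
have nonneg (l : T' -> R) (L : R) : measurable_fun setT l ->
    (forall x, 0 <= l x) -> (forall x, `|l x| <= L) -> \int[mu]_w (l (X w) * W w) = 0.
  move=> ml l0 lL; have [s [sl cs]] := simple_approx ml l0.
  apply: (@dominated_orth l (fun n => s n) (fun w => L * `|W w|)) => //.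
  - move=> n w; rewrite normrM ler_wpM2r// ger0_norm; last by case/andP: (sl n (X w)).
    by apply: le_trans (le_trans (ler_norm _) (lL (X w))); case/andP: (sl n (X w)).
  - by apply: integrable_scale; exact: integrable_norm.
(* Adding [K] makes [k] nonnegative, and the subtracted constant is itself a nonnegative bounded
   function, so the nonnegative case covers both pieces. *)
have -> : \int[mu]_w (k (X w) * W w) = \int[mu]_w ((k (X w) + K) * W w - cst K (X w) * W w).
  by apply: eq_Rintegral => w _ /=; ring.
have mkK : measurable_fun setT (fun x => k x + K) by exact: measurable_funD.
have bK x : `|k x + K| <= K + `|K| by apply: le_trans (ler_normD _ _) _; exact: lerD.
have mc : measurable_fun setT (cst K : T' -> R) by [].
have bc (x : T') : `|cst K x| <= `|K| by [].
have K0 : T' -> 0 <= K by move=> x; exact: le_trans (kK x).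
rewrite RintegralB//; [|exact: (bounded_integrable mkK bK)|exact: (bounded_integrable mc bc)].
have kK0 x : 0 <= k x + K.
  by rewrite -lerBlDr sub0r; have := kK x; rewrite ler_norml => /andP[].
by rewrite (nonneg _ _ mkK kK0 bK) (nonneg _ _ mc K0 bc) subr0.
Qed.

(** The truncations of [k] at integer levels are bounded, and |k(X) W| dominates them once
    multiplied by [W]. *)
Lemma orthogonal (k : T' -> R) : measurable_fun setT k ->
  mu.-integrable setT (EFin \o (fun w => k (X w) * W w)) ->
  \int[mu]_w (k (X w) * W w) = 0.
Proof.
move=> mk ki.
apply: (@dominated_orth k (fun n x => k x - tail n%:R k x)
  (fun w => `|k (X w) * W w|)) => //.
- by move=> n; apply: measurable_funB => //; exact: measurable_tail.
- move=> x; apply: cvg_near_cst; near=> n.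
  by rewrite /tail ifT ?subr0//; near: n; exact: nbhs_infty_ger.
- move=> n w; rewrite !normrM ler_wpM2r// /tail.
  by case: ifP => _; rewrite ?subr0// subrr normr0.
- exact: integrable_norm.
- move=> n; apply: (@bounded_orth (fun x => k x - tail n%:R k x) n%:R).
    by apply: measurable_funB => //; exact: measurable_tail.
  move=> x; rewrite /tail; case: ifP => ?; rewrite ?subr0//.
  by rewrite subrr normr0.
Unshelve. all: by end_near. Qed.

End orthogonality.

Section measure_facts.
Context d (T : measurableType d) (R : realType).
Variable mu : {measure set T -> \bar R}.

(* The squared L^2 norm of the influence function is not known to be measurable:
   its integral is only used as an upper bound. *)
Lemma ge0_le_integral_nonmeasurable (f g : T -> \bar R) :
  (forall x, 0 <= f x)%E -> (forall x, f x <= g x)%E ->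
  (\int[mu]_x f x <= \int[mu]_x g x)%E.
Proof.
move=> f0 fg; rewrite !ge0_integralTE//; last by move=> x; exact: le_trans (fg x).
apply: le_ereal_sup => _ [s sf <-]; exists s => // x; exact: le_trans (fg x).
Qed.

Lemma integrable_ae_eq (f g : T -> R) : measurable_fun setT g ->
  {ae mu, forall x, f x = g x} -> mu.-integrable setT (EFin \o f) ->
  mu.-integrable setT (EFin \o g).
Proof.
move=> mg fg /integrableP[mf fi]; apply/integrableP; split; first exact/measurable_EFinP.
rewrite -(@ae_eq_integral _ _ _ mu setT _ (fun x => `|(EFin \o f) x|%E))//.
- exact: measurableT_comp.
- by apply: measurableT_comp => //; exact/measurable_EFinP.
- by apply: filterS fg => x /= -> .
Qed.

Lemma Rintegral_ae_eq (f g : T -> R) : measurable_fun setT f -> measurable_fun setT g ->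
  {ae mu, forall x, f x = g x} -> \int[mu]_x f x = \int[mu]_x g x.
Proof.
move=> mf mg fg; congr fine; apply: ae_eq_integral => //; try exact/measurable_EFinP.
by apply: filterS fg => x /= ->.
Qed.

End measure_facts.

Section observations.
Context (R : realType) (a b : R) (p : nat).
Local Notation obsT := (obs R a b p).
Implicit Types (P : probability obsT R) (f : L2 a b).

Lemma measurable_outcome : measurable_fun setT (@outcome R a b p).
Proof. exact: (measurableT_comp measurable_fst measurable_fst). Qed.

Lemma measurable_covar : measurable_fun setT (@covar R a b p).
Proof. exact: measurable_snd. Qed.

Lemma measurable_treat : measurable_fun setT (@treat R a b p).
Proof. exact: (measurableT_comp measurable_snd measurable_fst). Qed.

Lemma measurable_treat_set (d : bool) : measurable [set w : obsT | treat w = d].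
Proof.
rewrite -[X in measurable X]setTI.
exact: (measurable_treat measurableT (_ : measurable [set d])).
Qed.

Definition treated (w : obsT) : R := (treat w)%:R.
Definition control (w : obsT) : R := (~~ treat w)%:R.

Lemma treatedE w : treated w = \1_[set w | treat w = true] w.
Proof.
rewrite indicE /treated; congr (nat_of_bool _)%:R.
by apply/idP/idP; rewrite inE.
Qed.

Lemma controlE w : control w = \1_[set w | treat w = false] w.
Proof.
rewrite indicE /control; congr (nat_of_bool _)%:R.
by apply/idP/idP; rewrite inE /=; case: (treat w).
Qed.

Lemma controlB w : control w = 1 - treated w.
Proof. by rewrite /control /treated; case: (treat w); rewrite ?subr0 ?subrr. Qed.

Lemma treated_le1 w : `|treated w| <= 1.
Proof. by rewrite /treated; case: (treat w); rewrite ?normr1 ?normr0. Qed.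

Lemma control_le1 w : `|control w| <= 1.
Proof. by rewrite /control; case: (treat w); rewrite ?normr1 ?normr0. Qed.

Lemma measurable_treated : measurable_fun setT treated.
Proof.
rewrite (_ : treated = \1_[set w | treat w = true]); last exact/funext/treatedE.
by apply: measurable_indic; exact: measurable_treat_set.
Qed.

Lemma measurable_control : measurable_fun setT control.
Proof.
rewrite (_ : control = \1_[set w | treat w = false]); last exact/funext/controlE.
by apply: measurable_indic; exact: measurable_treat_set.
Qed.

Lemma measurable_outcome_inner f :
  measurable_fun setT (fun w : obsT => L2_inner (outcome w) f).
Proof. exact: (measurableT_comp (measurable_L2_inner f) measurable_outcome). Qed.

Lemma measurable_outcome_norm :
  measurable_fun setT (fun w : obsT => L2_norm (outcome w)).
Proof. exact: (measurableT_comp (@measurable_L2_norm R a b) measurable_outcome). Qed.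

Lemma measurable_covar_comp (k : covariate R p -> R) : measurable_fun setT k ->
  measurable_fun setT (fun w : obsT => k (covar w)).
Proof. by move=> mk; exact: (measurableT_comp mk measurable_covar). Qed.

Lemma treat_probE P : treat_prob P = \int[P]_w treated w.
Proof.
rewrite /treat_prob /Rintegral.
under eq_integral do rewrite treatedE.
by rewrite integral_indic ?setIT//; exact: measurable_treat_set.
Qed.

(** The case W = 1_A (Z - v(X)) of [orthogonal]: the identity defining a conditional mean passes
    from events in X to every function of X for which the product is integrable. *)
Lemma cond_mean_orthogonal P A (Z : obsT -> R) v (k : covariate R p -> R) :
  measurable A -> P.-integrable A (EFin \o Z) -> is_cond_mean P A Z v ->
  measurable_fun setT k ->
  P.-integrable setT (EFin \o (fun w => k (covar w) * (\1_A w * (Z w - v (covar w))))) ->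
  \int[P]_w (k (covar w) * (\1_A w * (Z w - v (covar w)))) = 0.
Proof.
move=> mA iZ [mv iv hB] mk ki.
have iW : P.-integrable A (EFin \o (fun w => Z w - v (covar w))).
  exact: (integrableB mA iZ iv).
have e : (fun w => \1_A w * (Z w - v (covar w))) = (fun w => Z w - v (covar w)) \_ A.
  by rewrite patch_indic; apply/funext => w /=; rewrite mulrC.
apply: (@orthogonal _ _ _ _ _ P (@covar R a b p) measurable_covar
  (fun w => \1_A w * (Z w - v (covar w)))) => //.
  rewrite e; have /(integrable_mkcond _ mA) := iW; congr integrable.
  by rewrite restrict_EFin.
move=> B mB.
have mXB : measurable (@covar R a b p @^-1` B).
  by rewrite -[X in measurable X]setTI; exact: measurable_covar.
rewrite integral_mkcond.
rewrite [X in integral _ _ X](_ : _ =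
   (fun w => (Z w - v (covar w))%:E) \_ (A `&` @covar R a b p @^-1` B)); last first.
  apply/funext => w; rewrite !patchE /= in_setI indicE.
  by case: (w \in A); case: (w \in _ @^-1` _); rewrite ?mul1r ?mul0r.
rewrite -integral_mkcond.
have mAB : measurable (A `&` @covar R a b p @^-1` B) by exact: measurableI.
under eq_integral do rewrite EFinB.
rewrite integralB_EFin//.
- rewrite hB// subee//; apply: integrable_fin_num => //.
  exact: (integrableS mA).
- exact: (integrableS mA).
- exact: (integrableS mA).
Qed.

Lemma propensity_orthogonal P pi (k : covariate R p -> R) : is_propensity P pi ->
  measurable_fun setT k ->
  P.-integrable setT (EFin \o (fun w => k (covar w) * (treated w - pi (covar w)))) ->
  \int[P]_w (k (covar w) * (treated w - pi (covar w))) = 0.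
Proof.
move=> hpi mk ki.
have iD : P.-integrable setT (EFin \o treated).
  by apply: sqint_integrable; apply: (sqint_prob P measurable_treated treated_le1).
have := @cond_mean_orthogonal P setT treated pi k measurableT iD hpi mk.
under [X in integrable _ _ (_ \o X)]eq_fun do rewrite indicT /= mul1r.
by under eq_Rintegral do rewrite indicT /= mul1r; exact.
Qed.

Lemma regression_orthogonal P mu f (k : covariate R p -> R) : is_regression P false mu ->
  P.-integrable setT (EFin \o (fun w => L2_inner (outcome w) f)) ->
  measurable_fun setT k ->
  P.-integrable setT (EFin \o (fun w => k (covar w) *
    (control w * (L2_inner (outcome w) f - L2_inner (mu (covar w)) f)))) ->
  \int[P]_w (k (covar w) *
    (control w * (L2_inner (outcome w) f - L2_inner (mu (covar w)) f))) = 0.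
Proof.
move=> [_ _ /(_ f) hmu] iY mk ki.
have mA := measurable_treat_set false.
have iD := integrableS measurableT mA (@subsetT _ _) iY.
have := cond_mean_orthogonal mA iD hmu mk.
under [X in integrable _ _ (_ \o X)]eq_fun do rewrite -controlE.
by under eq_Rintegral do rewrite -controlE; exact.
Qed.

(** Testing both residuals against the sign of pi - pi' and subtracting shows that |pi(X) - pi'(X)|
    has mean 0. *)
Lemma propensity_unique P pi pi' : is_propensity P pi -> is_propensity P pi' ->
  {ae P, forall w, pi (covar w) = pi' (covar w)}.
Proof.
move=> hpi hpi'; have [mpi ipi _] := hpi; have [mpi' ipi' _] := hpi'.
have iD : P.-integrable setT (EFin \o treated).
  by apply: sqint_integrable; apply: (sqint_prob P measurable_treated treated_le1).
have iB := integrable_minus ipi ipi'.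
pose k (x : covariate R p) : R := if pi' x <= pi x then 1 else -1.
have mk : measurable_fun setT k.
  by apply: measurable_fun_ifT => //; exact: measurable_fun_ler.
have k1 x : `|k x| <= 1 by rewrite /k; case: ifP => _; rewrite ?normrN normr1.
have ik Z : P.-integrable setT (EFin \o Z) ->
    P.-integrable setT (EFin \o (fun w => k (covar w) * Z w)).
  move=> iZ; have mZ := integrable_measurable iZ.
  apply: (@integrable_le _ _ _ _ _ (fun w => `|Z w|)).
  - by apply: measurable_funM => //; exact: measurable_covar_comp.
  - by move=> w; rewrite normrM ler_piMl.
  - exact: integrable_norm.
have i1 := ik _ (integrable_minus iD ipi); have i2 := ik _ (integrable_minus iD ipi').
have h1 := propensity_orthogonal hpi mk i1.
have h2 := propensity_orthogonal hpi' mk i2.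
have h3 : \int[P]_w `|pi (covar w) - pi' (covar w)| = 0.
  rewrite -[RHS](subrr 0) -[X in X - _]h2 -[X in _ - X]h1 -RintegralB//.
  apply: eq_Rintegral => w _; rewrite -mulrBr /k.
  by case: ifPn => h; [rewrite ger0_norm ?subr_ge0//|rewrite ltr0_norm ?subr_lt0 ?ltNge//]; ring.
have /ae_eq_integral_abs : (\int[P]_w `|(pi (covar w) - pi' (covar w))%:E| = 0)%E.
  have := integrable_fin_num measurableT (integrable_norm iB) => /= /fineK <-.
  by congr EFin.
move=> /(_ measurableT (measurable_int _ iB)).
by apply: filterS => w /= /(_ I) [/eqP]; rewrite subr_eq0 => /eqP.
Qed.

End observations.

(** Inversion is the real power -1 on nonnegative numbers, 0 included by the convention that its
    inverse is 0, and it is odd. *)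
Lemma measurable_invr d (T : measurableType d) (R : realType) (f : T -> R) :
  measurable_fun setT f -> measurable_fun setT (fun x => (f x)^-1).
Proof.
move=> mf; rewrite (_ : (fun x => _) = fun x =>
  if 0 <= f x then f x `^ (-1) else - ((- f x) `^ (-1))); last first.
  apply/funext => x; case: ifPn => [h|]; first by rewrite powR_inv1.
  by rewrite -ltNge => /ltW h; rewrite powR_inv1 ?oppr_ge0// invrN opprK.
apply: measurable_fun_ifT.
- exact: measurable_fun_ler.
- exact: (measurableT_comp (measurable_powR _) mf).
- apply: measurable_funN; apply: (measurableT_comp (measurable_powR _)).
  exact: measurable_funN.
Qed.

(** * Clipped propensities, odds weights and the weak form of the functional *)

Section weights.
Context (R : realType) (a b : R) (p : nat).
Local Notation obsT := (obs R a b p).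
Implicit Types (P : probability obsT R) (f : L2 a b) (pi k : covariate R p -> R).

(** Turns the almost sure overlap bounds into bounds at every point: under overlap the clipped
    function is still a version of the propensity, and the odds become bounded everywhere. *)
Definition clip (c x : R) : R := Num.max c (Num.min x (1 - c)).

Lemma clip_id c x : c <= x <= 1 - c -> clip c x = x.
Proof. by move=> /andP[cx xc]; rewrite /clip min_l// max_r. Qed.

Lemma clip_bounds c x : c < 1 / 2 -> c <= clip c x <= 1 - c.
Proof.
move=> c2; rewrite /clip le_max lexx /= ge_max ge_min lexx orbT andbT.
by rewrite lerBrDr -mulr2n -mulr_natr -ler_pdivlMr// ltW.
Qed.

Lemma measurable_clip c pi : measurable_fun setT pi ->
  measurable_fun setT (fun x => clip c (pi x)).
Proof.
by move=> mpi; apply: measurable_maxr => //; exact: measurable_minr.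
Qed.

Lemma overlap_clip P pi c : overlap P pi c ->
  {ae P, forall w, pi (covar w) = clip c (pi (covar w))}.
Proof. by apply: filterS => w h; rewrite clip_id. Qed.

Lemma propensity_ae P pi pi' : is_propensity P pi -> measurable_fun setT pi' ->
  {ae P, forall w, pi (covar w) = pi' (covar w)} -> is_propensity P pi'.
Proof.
move=> [mpi ipi hB] mpi' e.
have m1 := measurable_covar_comp (a := a) (b := b) mpi.
have m1' := measurable_covar_comp (a := a) (b := b) mpi'.
split=> //; first exact: integrable_ae_eq ipi.
move=> B mB; rewrite hB//.
have mXB : measurable (setT `&` @covar R a b p @^-1` B) by exact: measurable_covar.
apply: ae_eq_integral => //.
- by apply: measurable_funTS; exact/measurable_EFinP.
- by apply: measurable_funTS; exact/measurable_EFinP.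
- by apply: filterS e => w /= ->.
Qed.

Lemma propensity_clip P pi c : is_propensity P pi -> overlap P pi c ->
  is_propensity P (fun x => clip c (pi x)).
Proof.
move=> hpi ho; have [mpi _ _] := hpi; apply: (propensity_ae hpi).
  exact: measurable_clip.
exact: overlap_clip.
Qed.

Definition odds pi x : R := pi x / (1 - pi x).

Definition weight pi (w : obsT) : R := treated w - control w * odds pi (covar w).

Lemma measurable_odds pi : measurable_fun setT pi -> measurable_fun setT (odds pi).
Proof.
move=> mpi; apply: measurable_funM => //.
by apply: measurable_invr; exact: measurable_funB.
Qed.

Lemma measurable_weight pi : measurable_fun setT pi -> measurable_fun setT (weight pi).
Proof.
move=> mpi; apply: measurable_funB; first exact: measurable_treated.
apply: measurable_funM; first exact: measurable_control.
apply: measurable_covar_comp; exact: measurable_odds.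
Qed.

Section bounded_weights.
Variables (P : probability obsT R) (pi : covariate R p -> R) (c : R).
Hypotheses (c0 : 0 < c) (pic : forall x, c <= pi x <= 1 - c).
Hypothesis hpi : is_propensity P pi.

Let mpi : measurable_fun setT pi. Proof. by case: hpi. Qed.

Lemma onem_pi_ge x : c <= 1 - pi x.
Proof. by have /andP[_] := pic x; rewrite lerBrDl -lerBrDr. Qed.

Lemma onem_pi_gt0 x : 0 < 1 - pi x. Proof. exact: lt_le_trans (onem_pi_ge x). Qed.

Lemma odds_ge0 x : 0 <= odds pi x.
Proof.
have /andP[pc _] := pic x; apply: divr_ge0; first exact: le_trans (ltW c0) pc.
by apply: ltW; exact: onem_pi_gt0.
Qed.

Lemma odds_le x : odds pi x <= c^-1.
Proof.
have h := onem_pi_ge x; have /andP[pc pc'] := pic x.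
rewrite /odds ler_pdivrMr ?onem_pi_gt0//.
apply: (@le_trans _ _ 1); first by rewrite (le_trans pc')// gerBl ltW.
by rewrite mulrC ler_pdivlMr// mul1r.
Qed.

Lemma weight_le w : `|weight pi w| <= 1 + c^-1.
Proof.
apply: le_trans (ler_normB _ _) _; apply: lerD; first exact: treated_le1.
rewrite normrM (ger0_norm (odds_ge0 _)); apply: le_trans (odds_le (covar w)).
by rewrite ler_piMl ?odds_ge0// control_le1.
Qed.

(** The controls being the complement of the treated, the weight is the residual of the propensity
    divided by 1 - pi(X). Its orthogonality to functions of X is thus inherited from the
    residual. *)
Lemma weightE w : weight pi w = (1 - pi (covar w))^-1 * (treated w - pi (covar w)).
Proof.
have := onem_pi_gt0 (covar w); rewrite /weight /odds controlB => h.
rewrite /treated; case: (treat w) => /=; field; lra.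
Qed.

Lemma weight_orthogonal k : measurable_fun setT k ->
  P.-integrable setT (EFin \o (fun w => k (covar w))) ->
  \int[P]_w (k (covar w) * weight pi w) = 0.
Proof.
move=> mk ki.
have E w : k (covar w) * weight pi w =
    (fun x => k x / (1 - pi x)) (covar w) * (treated w - pi (covar w)).
  by rewrite weightE mulrA.
under eq_Rintegral do rewrite E.
apply: (propensity_orthogonal (k := fun x => k x / (1 - pi x)) hpi).
  apply: measurable_funM => //.
  by apply: measurable_invr; exact: measurable_funB.
under [X in integrable _ _ (_ \o X)]eq_fun do rewrite -E.
apply: (@integrable_le _ _ _ _ _ (fun w => (1 + c^-1) * `|k (covar w)|)).
- apply: measurable_funM; first exact: measurable_covar_comp.
  exact: measurable_weight.
- by move=> w; rewrite normrM mulrC ler_wpM2r// weight_le.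
- by apply: integrable_scale; exact: integrable_norm.
Qed.

End bounded_weights.

(** The Riesz theorem applied to the mean of the scalar projections of [g]; only these projections
    have to be measurable. *)
Lemma pettis_mean P (g : obsT -> L2 a b) (C : R) :
  (forall f, P.-integrable setT (EFin \o (fun w => L2_inner (g w) f))) ->
  (forall f, `|\int[P]_w L2_inner (g w) f| <= C * L2_norm f) ->
  exists h, is_L2_mean P g h.
Proof.
move=> gi gC.
have [|||h hh] := @L2_riesz R a b (fun f => \int[P]_w L2_inner (g w) f) C => //.
- move=> f1 f2; rewrite -RintegralD//.
  by apply: eq_Rintegral => w _; rewrite L2_innerDr.
- move=> k f1; rewrite -RintegralZl//.
  by apply: eq_Rintegral => w _; rewrite L2_innerZr.
exists h => f; split; first exact: gi.
by rewrite hh /Rintegral fineK//; exact: (integrable_fin_num measurableT (gi f)).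
Qed.

Lemma sqint_outcome_inner P f : sqint P (fun w => L2_norm (outcome w)) ->
  sqint P (fun w => L2_inner (outcome w) f).
Proof.
apply: (@sqint_le _ _ _ _ _ _ (L2_norm f)); first exact: measurable_outcome_inner.
move=> w; rewrite (ger0_norm (L2_norm_ge0 _)) mulrC; exact: L2_cauchy_schwarz.
Qed.

Lemma l2n_outcome_inner P f : sqint P (fun w => L2_norm (outcome w)) ->
  l2n P (fun w => L2_inner (outcome w) f) <= L2_norm f * l2n P (fun w => L2_norm (outcome w)).
Proof.
apply: ler_l2n; [exact: L2_norm_ge0|exact: measurable_outcome_inner|].
move=> w; rewrite (ger0_norm (L2_norm_ge0 _)) mulrC; exact: L2_cauchy_schwarz.
Qed.

Lemma weighted_mean P (v : obsT -> R) (K : R) : measurable_fun setT v ->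
  (forall w, `|v w| <= K) -> sqint P (fun w => L2_norm (outcome w)) ->
  exists h, is_L2_mean P (fun w => v w *: outcome w) h.
Proof.
move=> mv vK sY; have sv := sqint_prob P mv vK.
have K0 : 0 <= K by apply: le_trans (vK point).
apply: (@pettis_mean _ _ (l2n P v * l2n P (fun w => L2_norm (outcome w)))) => f.
  under [X in integrable _ _ (_ \o X)]eq_fun do rewrite L2_innerZl.
  by apply: sqintM => //; exact: sqint_outcome_inner.
under eq_Rintegral do rewrite L2_innerZl.
apply: le_trans (cauchy_schwarz sv (sqint_outcome_inner f sY)) _.
by rewrite -mulrA ler_wpM2l ?l2n_ge0// mulrC l2n_outcome_inner.
Qed.

(** The weak form in which all laws are compared. Bounded weights and a second moment of the outcome
    make both weighted means exist, so [att] does not take its default value; multiplying by the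
    treatment probability clears the denominators. *)
Lemma att_inner P pi c f : 0 < c -> (forall x, c <= pi x <= 1 - c) ->
  is_propensity P pi -> treat_prob P != 0 ->
  sqint P (fun w => L2_norm (outcome w)) ->
  treat_prob P * L2_inner (att P) f = \int[P]_w (weight pi w * L2_inner (outcome w) f).
Proof.
move=> c0 pic hpi pn0 sY; have [mpi _ _] := hpi.
pose pP := treat_prob P.
pose w1 (w : obsT) : R := treated w / pP.
pose w0 pi (w : obsT) : R := control w * pi (covar w) / (pP * (1 - pi (covar w))).
have w0E w : w0 pi w = pP^-1 * (control w * odds pi (covar w)).
  by rewrite /w0 /odds invfM; ring.
have mw1 : measurable_fun setT w1 by apply: measurable_funM => //; exact: measurable_treated.
have mw0 : measurable_fun setT (w0 pi).
  rewrite (_ : w0 pi = fun w => pP^-1 * (control w * odds pi (covar w))); last exact/funext.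
  apply: measurable_funM => //; apply: measurable_funM; first exact: measurable_control.
  apply: measurable_covar_comp; exact: measurable_odds.
have bw1 w : `|w1 w| <= `|pP^-1| by rewrite /w1 normrM ler_piMl// treated_le1.
have bw0 w : `|w0 pi w| <= `|pP^-1| * c^-1.
  rewrite w0E normrM ler_wpM2l// normrM (ger0_norm (odds_ge0 c0 pic _)).
  apply: le_trans (odds_le c0 pic (covar w)).
  by rewrite ler_piMl ?(odds_ge0 c0 pic)// control_le1.
have [h1 hh1] := weighted_mean mw1 bw1 sY.
have [h0 hh0] := weighted_mean mw0 bw0 sY.
(* The value chosen by [att] may come with another version [pi'] of the propensity; it agrees with
   [pi] almost surely, which is enough for the integrals. *)
have [pi' [h1' [h0' [hpi' hh1' hh0' attE]]]] : is_att P (att P).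
  apply: (@xgetPex _ 0 [set tau | is_att P tau]).
  exists (h1 - h0); exists pi, h1, h0.
  split; [exact: hpi|exact: hh1|exact: hh0|exact: erefl].
have [i1 e1] := hh1' f; have [i0 e0] := hh0' f.
rewrite attE L2_innerBl.
have -> : L2_inner h1' f = \int[P]_w (w1 w * L2_inner (outcome w) f).
  rewrite -[LHS]/(fine (L2_inner h1' f)%:E) e1; congr fine.
  by apply: eq_integral => w _; rewrite L2_innerZl.
have sYf := sqint_outcome_inner f sY.
have [mYf _] := sYf.
have s1 := sqintM (sqint_prob P mw1 bw1) sYf.
have s0 := sqintM (sqint_prob P mw0 bw0) sYf.
have -> : L2_inner h0' f = \int[P]_w (w0 pi w * L2_inner (outcome w) f).
  rewrite -[LHS]/(fine (L2_inner h0' f)%:E) e0 -[LHS]/(Rintegral _ _ _).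
  apply: Rintegral_ae_eq; first by have /integrable_measurable := i0.
    exact: measurable_funM.
  apply: filterS (propensity_unique hpi' hpi) => w h.
  by rewrite L2_innerZl h.
rewrite -RintegralB// -RintegralZl//; last exact: integrable_minus.
apply: eq_Rintegral => w _; rewrite w0E /w1 /weight.
by rewrite -/pP; field.
Qed.

End weights.

(** * Comparison of two laws *)

Section truncation.
Context d (T : measurableType d) (R : realType).

Lemma ge0_integral_le_truncations (mu : {measure set T -> \bar R}) (g : T -> R) (B : R) :
  measurable_fun setT g -> (forall x, 0 <= g x) ->
  (forall n : nat, (\int[mu]_x (Num.min (g x) n%:R)%:E <= B%:E)%E) ->
  (\int[mu]_x (g x)%:E <= B%:E)%E.
Proof.
move=> mg g0 hB.
have cv x : (Num.min (g x) n%:R)%:E @[n --> \oo] --> (g x)%:E.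
  apply: cvg_near_cst; near=> n; congr EFin.
  by apply: min_l; near: n; exact: nbhs_infty_ger.
have -> : (\int[mu]_x (g x)%:E =
    \int[mu]_x limn_einf (fun n => (Num.min (g x) n%:R)%:E))%E.
  apply: eq_integral => x _.
  by rewrite (is_cvg_limn_einfE (cvgP _ (cv x))) (cvg_lim _ (cv x)).
have mn n : measurable_fun setT (fun x => (Num.min (g x) n%:R)%:E).
  by apply/measurable_EFinP; exact: measurable_minr.
apply: le_trans (fatou _ _ _ _) _ => //.
  by move=> n x _; rewrite lee_fin le_min g0 ler0n.
rewrite limn_einf_lim; apply: lime_le; first exact: is_cvg_einfs.
by near=> n; apply: le_trans (hB n); apply: ereal_inf_lbound; exists n => /=.
Unshelve. all: by end_near. Qed.

Lemma l2n_cst (P : probability T R) (k : R) : l2n P (cst k) = `|k|.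
Proof.
rewrite /l2n (_ : \int[P]_x (cst k x ^+ 2) = \int[P]_(x in setT) (k ^+ 2))//.
by rewrite Rintegral_cst// [X in fine X]probability_setT mulr1 sqrtr_sqr.
Qed.

Lemma l2n_affine (P : probability T R) (Z g : T -> R) (al be : R) :
  measurable_fun setT Z -> sqint P g -> 0 <= al -> 0 <= be ->
  (forall w, `|Z w| <= al * `|g w| + be) ->
  sqint P Z /\ l2n P Z <= al * l2n P g + be.
Proof.
move=> mZ sg al0 be0 Zle.
have sg' : sqint P (fun w => al * `|g w|).
  apply: (@sqint_le _ _ _ _ _ g al) => //; last first.
    by move=> w; rewrite normrM normr_id ger0_norm.
  by apply: measurable_funM => //; apply: measurableT_comp => //; case: sg.
have sc := sqint_cst P be.
have su := sqintD sg' sc.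
have Zu w : `|Z w| <= 1 * `|al * `|g w| + cst be w|.
  by rewrite mul1r (le_trans (Zle w))// ler_norm.
split; first exact: (sqint_le mZ Zu).
apply: le_trans (ler_l2n ler01 mZ Zu su) _; rewrite mul1r.
apply: le_trans (ler_l2nD sg' sc) _; apply: lerD.
  apply: ler_l2n => //; first by case: sg'.
  by move=> w; rewrite normrM normr_id ger0_norm.
by rewrite l2n_cst ger0_norm.
Qed.

End truncation.

(** A rearrangement of (x + y)^2 <= 2 x^2 + 2 y^2. *)
Lemma half_sqr_le (R : realType) (n x y : R) : 0 <= n -> n <= x + y ->
  n ^+ 2 / 2 - y ^+ 2 <= x ^+ 2.
Proof.
move=> n0 nxy; have := sqr_ge0 (x - y).
have : n ^+ 2 <= (x + y) ^+ 2 by rewrite lerXn2r// nnegrE// (le_trans n0).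
rewrite (sqrrB x y) (sqrrD x y); lra.
Qed.

Lemma half_diff_le (R : realType) (x y m : R) : x / 2 - y <= m -> x <= 2 * m + 2 * y.
Proof. lra. Qed.

(** * Square-integrability of the control regression *)

Section regression.
Context (R : realType) (a b : R) (p : nat).
Local Notation obsT := (obs R a b p).
Variables (P : probability obsT R) (mu0 : covariate R p -> L2 a b).
Implicit Types (f : L2 a b).
Hypothesis hmu0 : is_regression P false mu0.
Hypothesis sY : sqint P (fun w => L2_norm (outcome w)).

Let nY (w : obsT) := L2_norm (outcome w).
Definition regression_norm (x : covariate R p) : R := L2_norm (mu0 x).
Local Notation N := regression_norm.

Lemma measurable_regression_norm : measurable_fun setT N.
Proof.
have [mmu _ _] := hmu0.
exact: (measurableT_comp (@measurable_L2_norm R a b) mmu).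
Qed.

Lemma measurable_regression_inner f : measurable_fun setT (fun x => L2_inner (mu0 x) f).
Proof.
have [mmu _ _] := hmu0.
exact: (measurableT_comp (measurable_L2_inner f) mmu).
Qed.

(** On controls the influence function is, up to sign, a multiple at least [c] of Y - mu0(X), so its
    second moment together with that of Y controls [mu0]. *)
Lemma control_regression_sqint (pi0 : covariate R p -> R) (c : R) :
  is_propensity P pi0 -> 0 < c -> overlap P pi0 c -> 0 < treat_prob P < 1 ->
  (\int[P]_w (L2_norm (eif P pi0 mu0 w) ^+ 2)%:E < +oo)%E ->
  sqint P (fun w => control w * N (covar w)).
Proof.
move=> [mpi0 _ _] c0 ho /andP[p0 p1] hphi.
have mN := measurable_covar_comp (a := a) (b := b) measurable_regression_norm.
have [mY iY] := sY; have mC := @measurable_control R a b p.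
(* A lower bound for the squared norm of Y - mu0(X) on controls, made only of the separate norms of
   Y and mu0(X), hence measurable. *)
pose m (w : obsT) : R := control w * Num.max (N (covar w) ^+ 2 / 2 - nY w ^+ 2) 0.
have mm : measurable_fun setT m.
  apply: measurable_funM => //; apply: measurable_maxr => //.
  apply: measurable_funB; last exact: measurable_funX.
  by apply: measurable_funM => //; exact: measurable_funX.
have m0 w : 0 <= m w.
  by rewrite /m mulr_ge0// ?ler0n// le_max lexx orbT.
(* The comparison of integrals without measurability needs an inequality at every point, so the
   minorant is set to 0 where overlap fails. *)
pose good (w : obsT) := c <= pi0 (covar w) <= 1 - c.
pose g w : R := if good w then c ^+ 2 * m w else 0.
have mgood : measurable_fun setT good.
  by apply: measurable_and; apply: measurable_fun_ler => //; exact: measurable_covar_comp.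
have mg : measurable_fun setT g.
  by apply: measurable_fun_ifT => //; exact: measurable_funM.
have g0 w : 0 <= g w by rewrite /g; case: ifP => // _; rewrite mulr_ge0// sqr_ge0.
have gle w : g w <= L2_norm (eif P pi0 mu0 w) ^+ 2.
  rewrite /g; case: ifPn => [/andP[h1 h2]|_]; last exact: sqr_ge0.
  rewrite /m /control /eif; case: (treat w) => /=.
    by rewrite mul0r mulr0 sqr_ge0.
  rewrite !mul0r scale0r sub0r L2_normN L2_normZ !mul1r exprMn.
  (* The product p (1 - pi) is at most 1, so the quotient is at least pi, hence at least [c]. *)
  have k1 : c <= pi0 (covar w) / (treat_prob P * (1 - pi0 (covar w))).
    have q0 : 0 < 1 - pi0 (covar w) by rewrite (lt_le_trans c0)// lerBrDl -lerBrDr.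
    rewrite ler_pdivlMr ?mulr_gt0//; apply: (le_trans _ h1).
    rewrite ler_piMr ?(ltW c0)//; apply: mulr_ile1; rewrite ?(ltW p0) ?(ltW q0) ?(ltW p1)//.
    by rewrite gerBl (le_trans (ltW c0)).
  apply: ler_pM; rewrite ?sqr_ge0 ?le_max ?lexx ?orbT//.
    by rewrite lerXn2r// ?nnegrE ?(ltW c0)// (le_trans k1)// ler_norm.
  rewrite ge_max sqr_ge0 andbT.
  apply: half_sqr_le; first exact: L2_norm_ge0.
  have := L2_normD (mu0 (covar w) - outcome w) (outcome w).
  by rewrite subrK -(opprB (outcome w)) L2_normN.
have gi : P.-integrable setT (EFin \o g).
  apply/integrableP; split; first exact/measurable_EFinP.
  apply: le_lt_trans hphi; apply: ge0_le_integral_nonmeasurable => // w.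
  by rewrite /= ger0_norm// lee_fin.
have mi : P.-integrable setT (EFin \o m).
  have : P.-integrable setT (EFin \o (fun w => c ^- 2 * g w)) by exact: integrable_scale.
  apply: integrable_ae_eq => //; apply: filterS ho => w h.
  rewrite /g ifT; last exact: h.
  by rewrite mulrA mulVf ?mul1r// expf_neq0// gt_eqF.
split; first exact: measurable_funM.
apply: (@integrable_le _ _ _ _ _ (fun w => 2 * m w + 2 * nY w ^+ 2)).
- by apply: measurable_funX; exact: measurable_funM.
- move=> w; rewrite ger0_norm ?sqr_ge0// /m /control; case: (treat w) => /=.
    by rewrite !mul0r mulr0 add0r expr0n /= mulr_ge0// sqr_ge0.
  by rewrite !mul1r; apply: half_diff_le; rewrite le_max lexx.
- by apply: integrable_plus; apply: integrable_scale.
Qed.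

(** For a function k of X, orthogonality of the weight gives E k = E{k (1 - weight)} = E{(1 - D)(1 +
    odds) k}, so the controls determine the full moment up to the factor 1 + 1 / c. It is applied to
    truncations of N^2, whose integrability is what is being proved. *)
Lemma regression_sqint (pi : covariate R p -> R) (c : R) :
  is_propensity P pi -> 0 < c -> (forall x, c <= pi x <= 1 - c) ->
  sqint P (fun w => control w * N (covar w)) ->
  sqint P (fun w => N (covar w)).
Proof.
move=> hpi c0 pic sC; have [mpi _ _] := hpi.
have mN := measurable_covar_comp (a := a) (b := b) measurable_regression_norm.
apply: sqintP => //; have [_ iC] := sC.
pose B : R := (1 + c^-1) * \int[P]_w ((control w * N (covar w)) ^+ 2).
apply: (@le_lt_trans _ _ B%:E); last exact: ltry.
apply: ge0_integral_le_truncations; first exact: measurable_funX.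
  by move=> w; exact: sqr_ge0.
move=> n; pose k (x : covariate R p) : R := Num.min (N x ^+ 2) n%:R.
have mk : measurable_fun setT k.
  apply: measurable_minr => //; apply: measurable_funX.
  exact: measurable_regression_norm.
have k0 x : 0 <= k x by rewrite le_min sqr_ge0 ler0n.
have kn x : `|k x| <= n%:R by rewrite ger0_norm// ge_min lexx orbT.
have ki : P.-integrable setT (EFin \o (fun w => k (covar w))).
  by apply: sqint_integrable; apply: (sqint_prob P (measurable_covar_comp mk)).
have worth := weight_orthogonal c0 pic hpi mk ki.
have wi : P.-integrable setT (EFin \o (fun w => k (covar w) * weight pi w)).
  apply: sqintM.
    by apply: (sqint_prob P (measurable_covar_comp mk)).
  exact: (sqint_prob P (measurable_weight mpi) (weight_le c0 pic)).
have -> : (\int[P]_w (k (covar w))%:E = (\int[P]_w k (covar w))%:E)%E.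
  by rewrite /Rintegral fineK//; exact: (integrable_fin_num measurableT ki).
rewrite lee_fin -[leLHS]subr0 -worth -RintegralB// /B -RintegralZl//.
apply: le_Rintegral => //; [exact: integrable_minus|exact: integrable_scale|move=> w _].
have o0 := odds_ge0 c0 pic (covar w); have o1 := odds_le c0 pic (covar w).
have kN : k (covar w) <= N (covar w) ^+ 2 by rewrite ge_min lexx.
have kw := k0 (covar w).
rewrite /weight /treated /control; case: (treat w) => /=.
  by rewrite !mul0r subr0 mulr1 subrr expr0n /= mulr0.
rewrite !mul1r sub0r mulrN opprK -{1}[k (covar w)]mulr1 -mulrDr mulrC.
apply: ler_pM => //; first by rewrite addr_ge0.
by rewrite lerD2l.
Qed.

End regression.

(** * Propensities and test functions under two laws *)

Section two_laws.
Context (R : realType) (a b : R) (p : nat).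
Local Notation obsT := (obs R a b p).
Variables (P0 P1 : probability obsT R) (nu : {sigma_finite_measure set obsT -> \bar R}).
Variables (q0 q1 S : obsT -> R) (e : R).
Hypotheses (hq0 : has_density nu P0 q0) (hq1 : has_density nu P1 q1).
Hypotheses (sS : sqint P0 S) (e0 : e != 0).
Variables (pi0 pi1 : covariate R p -> R) (c : R).
Hypotheses (hpi0 : is_propensity P0 pi0) (hpi1 : is_propensity P1 pi1).
Hypotheses (c0 : 0 < c) (pi0c : forall x, c <= pi0 x <= 1 - c)
  (pi1c : forall x, c <= pi1 x <= 1 - c).

Local Notation hel := (hellinger nu q0 q1).
Local Notation rem := (qmd_remainder q0 q1 S e).

Let mpi0 : measurable_fun setT pi0. Proof. by case: hpi0. Qed.
Let mpi1 : measurable_fun setT pi1. Proof. by case: hpi1. Qed.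

Let Dl (x : covariate R p) : R := pi1 x - pi0 x.

Let mDl : measurable_fun setT Dl. Proof. exact: measurable_funB. Qed.

Let pi_range (pi : covariate R p -> R) : (forall x, c <= pi x <= 1 - c) ->
  forall x, 0 <= pi x <= 1.
Proof. by move=> h x; have /andP[h1 h2] := h x; rewrite (le_trans (ltW c0) h1) (le_trans h2)// gerBl ltW. Qed.

Let Dl_le1 x : `|Dl x| <= 1.
Proof.
have /andP[h1 h2] := pi_range pi0c x; have /andP[h3 h4] := pi_range pi1c x.
by rewrite ler_norml /Dl; apply/andP; split; lra.
Qed.

Let resid_le1 (pi : covariate R p -> R) (w : obsT) : (forall x, c <= pi x <= 1 - c) ->
  `|treated w - pi (covar w)| <= 1.
Proof.
move=> h; have /andP[h1 h2] := pi_range h (covar w).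
by rewrite ler_norml /treated; case: (treat w) => /=; apply/andP; split; lra.
Qed.

(* Testing the moment condition of each propensity against pi1 - pi0 under the
   other law bounds both norms by the Hellinger distance. *)
Lemma propensity_diff_le : l2n P0 (fun w => Dl (covar w)) <= 4 * hel.
Proof.
have mD := measurable_covar_comp (a := a) (b := b) mDl.
have sD (P : probability obsT R) : sqint P (fun w => Dl (covar w)) by exact: (sqint_prob P mD (fun w => Dl_le1 (covar w))).
have mT := @measurable_treated R a b p.
pose Z (pi : covariate R p -> R) (w : obsT) := Dl (covar w) * (treated w - pi (covar w)).
have mZ pi : measurable_fun setT pi -> measurable_fun setT (Z pi).
  move=> mpi; apply: measurable_funM => //; apply: measurable_funB => //.
  exact: measurable_covar_comp.
have Zle pi w : (forall x, c <= pi x <= 1 - c) -> `|Z pi w| <= 1 * `|Dl (covar w)|.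
  by move=> h; rewrite normrM mulrC ler_wpM2r// resid_le1.
have sZ (P : probability obsT R) pi : measurable_fun setT pi -> (forall x, c <= pi x <= 1 - c) -> sqint P (Z pi).
  by move=> mpi h; apply: (@sqint_le _ _ _ _ _ (fun w => Dl (covar w)) 1) => //;
    [exact: mZ|move=> w; exact: Zle].
have nZ (P : probability obsT R) pi : measurable_fun setT pi -> (forall x, c <= pi x <= 1 - c) ->
    l2n P (Z pi) <= l2n P (fun w => Dl (covar w)).
  move=> mpi h; rewrite -[leRHS]mul1r; apply: ler_l2n => //; first exact: mZ.
  by move=> w; exact: Zle.
have orth (P : probability obsT R) pi : is_propensity P pi -> (forall x, c <= pi x <= 1 - c) ->
    \int[P]_w Z pi w = 0.
  move=> hpi h; have [mpi _ _] := hpi; apply: propensity_orthogonal => //.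
  exact: (sqint_integrable (sZ P pi mpi h)).
(* Exchanging the two propensities in [Z] adds (pi1 - pi0)^2, which is why [pi1 - pi0] itself is the
   right test function. *)
have sh (P : probability obsT R) : \int[P]_w Z pi0 w = \int[P]_w Z pi1 w + l2n P (fun w => Dl (covar w)) ^+ 2.
  rewrite sqr_l2n -RintegralD//; last by case: (sD P).
    by apply: eq_Rintegral => w _; rewrite /Z /Dl; ring.
  exact: (sqint_integrable (sZ P pi1 mpi1 pi1c)).
set a0 := l2n P0 _; set a1 := l2n P1 (fun w => Dl (covar w)).
have h0 : a0 ^+ 2 <= hel * (a1 + a0).
  have := mean_diff_le hq0 hq1 (sZ P0 pi1 mpi1 pi1c) (sZ P1 pi1 mpi1 pi1c).
  rewrite (orth P1 pi1)// sub0r normrN => h.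
  have := sh P0; rewrite (orth P0 pi0)// -/a0 => h'.
  have -> : a0 ^+ 2 = - \int[P0]_w Z pi1 w by lra.
  apply: le_trans (ler_norm _) _; rewrite normrN; apply: le_trans h _.
  by rewrite ler_wpM2l ?l2n_ge0// lerD// nZ.
have h1 : a1 ^+ 2 <= hel * (a1 + a0).
  have := mean_diff_le hq0 hq1 (sZ P0 pi0 mpi0 pi0c) (sZ P1 pi0 mpi0 pi0c).
  rewrite (orth P0 pi0)// subr0 => h.
  have := sh P1; rewrite (orth P1 pi1)// add0r -/a1 => <-.
  apply: le_trans (ler_norm _) _; apply: le_trans h _.
  by rewrite ler_wpM2l ?l2n_ge0// lerD// nZ.
have a00 : 0 <= a0 by exact: l2n_ge0.
have a10 : 0 <= a1 by exact: l2n_ge0.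
have hel0 : 0 <= hel by exact: l2n_ge0.
have [s0|s0] := eqVneq (a0 + a1) 0; first by have -> : a0 = 0 by [lra]; rewrite mulr_ge0.
have sp : 0 < a0 + a1 by rewrite lt_neqAle eq_sym s0 addr_ge0.
(* Both squares are at most hel (a0 + a1), so (a0 + a1)^2 <= 2 (a0^2 + a1^2) <= 4 hel (a0 + a1).
   Neither norm could be bounded without the other, since each test involves both laws. *)
suff : a0 + a1 <= 4 * hel by lra.
rewrite -(ler_pM2r sp); have := sqr_ge0 (a0 - a1).
rewrite sqrrB -expr2 sqrrD (addrC a0 a1) -mulrA; lra.
Qed.

Definition odds_diff (x : covariate R p) : R := odds pi1 x - odds pi0 x.

Lemma measurable_odds_diff : measurable_fun setT odds_diff.
Proof. by apply: measurable_funB; exact: measurable_odds. Qed.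

Lemma odds_diff_le x : `|odds_diff x| <= c^-1.
Proof.
have h0 := odds_ge0 c0 pi0c x; have h0' := odds_le c0 pi0c x.
have h1 := odds_ge0 c0 pi1c x; have h1' := odds_le c0 pi1c x.
by rewrite ler_norml /odds_diff; apply/andP; split; lra.
Qed.

(** The difference of the odds is pi1 - pi0 divided by (1 - pi0)(1 - pi1), and both factors are at
    least [c]. *)
Lemma odds_diff_l2n : l2n P0 (fun w => odds_diff (covar w)) <= c ^- 2 * (4 * hel).
Proof.
apply: le_trans (_ : c ^- 2 * l2n P0 (fun w => Dl (covar w)) <= _); last first.
  by rewrite ler_wpM2l ?propensity_diff_le// invr_ge0 sqr_ge0.
have mD := measurable_covar_comp (a := a) (b := b) mDl.
apply: ler_l2n.
- by rewrite invr_ge0 sqr_ge0.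
- exact: (measurable_covar_comp measurable_odds_diff).
- move=> w; set x := covar w.
  have k0 := onem_pi_ge pi0c x; have k1 := onem_pi_ge pi1c x.
  have -> : odds_diff x = ((1 - pi1 x) * (1 - pi0 x))^-1 * Dl x.
    have n0 : 1 - pi0 x != 0 by rewrite gt_eqF// (lt_le_trans c0).
    have n1 : 1 - pi1 x != 0 by rewrite gt_eqF// (lt_le_trans c0).
    by rewrite /odds_diff /odds /Dl; field; rewrite n0 n1.
  rewrite normrM ler_wpM2r// ger0_norm; last first.
    by rewrite invr_ge0 mulr_ge0// (le_trans (ltW c0)).
  rewrite lef_pV2 ?posrE ?exprn_gt0 ?mulr_gt0 ?(lt_le_trans c0)// expr2.
  by apply: ler_pM => //; exact: ltW.
- exact: (sqint_prob P0 mD (fun w => Dl_le1 (covar w))).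
Qed.

Variable mu0 : covariate R p -> L2 a b.
Hypothesis hmu0 : is_regression P0 false mu0.
Hypotheses (sY0 : sqint P0 (fun w => L2_norm (outcome w)))
  (sY1 : sqint P1 (fun w => L2_norm (outcome w))).
Hypothesis sN : sqint P0 (fun w => regression_norm mu0 (covar w)).
Variables tau0 tau1 : L2 a b.
Hypotheses
  (htau0 : forall f, treat_prob P0 * L2_inner tau0 f =
     \int[P0]_w (weight pi0 w * L2_inner (outcome w) f))
  (htau1 : forall f, treat_prob P1 * L2_inner tau1 f =
     \int[P1]_w (weight pi1 w * L2_inner (outcome w) f)).

Section test_direction.
Variable f : L2 a b.
Hypothesis f1 : L2_norm f <= 1.

Let Y (w : obsT) : R := L2_inner (outcome w) f.
Let m (x : covariate R p) : R := L2_inner (mu0 x) f.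
Let t0 : R := L2_inner tau0 f.

(** With the propensity and the effect of [P], this is the component along [f] of the influence
    function multiplied by the treatment probability, see [eif_inner]. *)
Definition score_test (w : obsT) : R :=
  weight pi0 w * (Y w - m (covar w)) - treated w * t0.

Let inner_le g : `|L2_inner g f| <= L2_norm g.
Proof.
apply: le_trans (L2_cauchy_schwarz g f) _.
by rewrite ler_piMr// L2_norm_ge0.
Qed.

Let mY : measurable_fun setT Y. Proof. exact: measurable_outcome_inner. Qed.
Let mm : measurable_fun setT m. Proof. exact: (measurable_regression_inner hmu0 f). Qed.
Let mmX : measurable_fun setT (fun w : obsT => m (covar w)).
Proof. exact: measurable_covar_comp. Qed.
Let sY (P : probability obsT R) : sqint P (fun w => L2_norm (outcome w)) -> sqint P Y.
Proof. exact: sqint_outcome_inner. Qed.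
Let sm : sqint P0 (fun w => m (covar w)).
Proof.
apply: (@sqint_le _ _ _ _ _ _ 1 mmX _ sN) => w.
by rewrite mul1r (ger0_norm (L2_norm_ge0 _)); exact: inner_le.
Qed.

Variables (K M : R).
Hypotheses (K0 : 0 < K) (Y0M : l2n P0 (fun w => L2_norm (outcome w)) <= M)
  (Y1M : l2n P1 (fun w => L2_norm (outcome w)) <= M).

Let M0 : 0 <= M. Proof. exact: le_trans (l2n_ge0 _ _) Y0M. Qed.

(* mu0 need not be integrable under P1, hence the truncation. *)
Let g (x : covariate R p) : R := if regression_norm mu0 x <= K then m x else 0.

Let mg : measurable_fun setT g.
Proof.
apply: measurable_fun_ifT => //; apply: measurable_fun_ler => //.
exact: (measurable_regression_norm hmu0).
Qed.

Let gK x : `|g x| <= K.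
Proof.
rewrite /g; case: ifP => h; last by rewrite normr0 ltW.
exact: le_trans (inner_le _) h.
Qed.

(** Cutting where the norm of [mu0], not its projection [m], exceeds [K] bounds the error by one
    function for all [f] of norm at most 1. *)
Let mg_le w : `|m (covar w) - g (covar w)| <=
  1 * `|tail K (fun w : obsT => regression_norm mu0 (covar w)) w|.
Proof.
have N0 := L2_norm_ge0 (mu0 (covar w)).
rewrite /g /tail mul1r (ger0_norm N0); case: ifP => h; first by rewrite subrr normr0.
by rewrite subr0 (ger0_norm N0); exact: inner_le.
Qed.

Let mgX : measurable_fun setT (fun w : obsT => g (covar w)).
Proof. exact: measurable_covar_comp. Qed.

Let Tl : R := l2n P0 (tail K (fun w : obsT => regression_norm mu0 (covar w))).

Let sT : sqint P0 (tail K (fun w : obsT => regression_norm mu0 (covar w))).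
Proof. exact: sqint_tail. Qed.

Let mmg : measurable_fun setT (fun w : obsT => m (covar w) - g (covar w)).
Proof. exact: measurable_funB. Qed.

Let smg : sqint P0 (fun w : obsT => m (covar w) - g (covar w)).
Proof. exact: (sqint_le mmg mg_le sT). Qed.

Let nmg : l2n P0 (fun w : obsT => m (covar w) - g (covar w)) <= Tl.
Proof. by rewrite -[leRHS]mul1r; exact: (ler_l2n ler01 mmg mg_le sT). Qed.

Let Yg (w : obsT) : R := Y w - g (covar w).

Let mYg : measurable_fun setT Yg. Proof. exact: measurable_funB. Qed.

Let Yg_le w : `|Yg w| <= 1 * `|L2_norm (outcome w)| + K.
Proof.
apply: le_trans (ler_normB _ _) _; apply: lerD; last exact: gK.
by rewrite mul1r (ger0_norm (L2_norm_ge0 _)); exact: inner_le.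
Qed.

Let Yg_l2n (P : probability obsT R) : sqint P (fun w => L2_norm (outcome w)) ->
  l2n P (fun w => L2_norm (outcome w)) <= M -> sqint P Yg /\ l2n P Yg <= M + K.
Proof.
move=> sYP YM; have [s h] := l2n_affine mYg sYP ler01 (ltW K0) Yg_le.
by split=> //; apply: le_trans h _; rewrite mul1r lerD2r.
Qed.

Let Z (w : obsT) : R := weight pi1 w * Yg w - treated w * t0.

(** A bound for the L^2 norm of [Z] under either law, independent of [f]: the weight is at most 1 +
    1 / c, [g] at most [K], and the norm of the outcome at most [M] in L^2. *)
Definition test_bound : R := (1 + c^-1) * (M + K) + L2_norm tau0.
Local Notation V := test_bound.

Let ci0 : 0 <= c^-1. Proof. by rewrite invr_ge0 ltW. Qed.

Let mZ : measurable_fun setT Z.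
Proof.
apply: measurable_funB; apply: measurable_funM => //; first exact: measurable_weight.
exact: measurable_treated.
Qed.

Let Z_l2n (P : probability obsT R) : sqint P (fun w => L2_norm (outcome w)) ->
  l2n P (fun w => L2_norm (outcome w)) <= M -> sqint P Z /\ l2n P Z <= V.
Proof.
move=> sYP YM; have [s h] := Yg_l2n sYP YM.
have wc := weight_le (a := a) (b := b) c0 pi1c.
have [||//|sz nz] := @l2n_affine _ _ _ P Z Yg (1 + c^-1) (L2_norm tau0) mZ s.
- by rewrite addr_ge0.
- exact: L2_norm_ge0.
- move=> w; apply: le_trans (ler_normB _ _) _; apply: lerD.
    by rewrite normrM ler_wpM2r.
  rewrite normrM -[leRHS]mul1r; apply: ler_pM => //; first exact: treated_le1.
  exact: inner_le.
split=> //; apply: le_trans nz _.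
by rewrite lerD2r ler_wpM2l// addr_ge0.
Qed.

(** Under [P1] the weight is orthogonal to [g(X)], so subtracting [g] costs nothing; no regression
    under [P1] intervenes. *)
Lemma E1Z : treat_prob P1 * L2_inner (tau1 - tau0) f = \int[P1]_w Z w.
Proof.
have mw := measurable_weight (a := a) (b := b) mpi1.
have sw := sqint_prob P1 mw (weight_le c0 pi1c).
have sg := sqint_prob P1 mgX (fun w => gK (covar w)).
have sT1 := sqint_prob P1 (@measurable_treated R a b p) (@treated_le1 R a b p).
have e1 := htau1 f.
have e2 := weight_orthogonal c0 pi1c hpi1 mg (sqint_integrable sg).
have iwY := sqintM sw (sY sY1).
have igw : P1.-integrable setT (EFin \o (fun w => g (covar w) * weight pi1 w)).
  exact: sqintM sg sw.
have iT := integrable_scale t0 (sqint_integrable sT1).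
have -> : treat_prob P1 * L2_inner (tau1 - tau0) f =
    \int[P1]_w (weight pi1 w * Y w) - \int[P1]_w (g (covar w) * weight pi1 w) -
    \int[P1]_w (t0 * treated w).
  rewrite e2 subr0 RintegralZl//; last exact: sqint_integrable.
  by rewrite L2_innerBl mulrBr e1 treat_probE (mulrC t0).
rewrite -RintegralB// -RintegralB//; last exact: integrable_minus.
by apply: eq_Rintegral => w _; rewrite /Z /Yg; ring.
Qed.

Let cm_le (w : obsT) : `|control w * (m (covar w) - g (covar w))| <=
  1 * `|m (covar w) - g (covar w)|.
Proof. by rewrite normrM ler_wpM2r// control_le1. Qed.

Let mcm : measurable_fun setT (fun w : obsT => control w * (m (covar w) - g (covar w))).
Proof. by apply: measurable_funM => //; exact: measurable_control. Qed.

Let scm : sqint P0 (fun w : obsT => control w * (m (covar w) - g (covar w))).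
Proof. exact: (sqint_le mcm cm_le smg). Qed.

Let mdX : measurable_fun setT (fun w : obsT => odds_diff (covar w)).
Proof. exact: measurable_covar_comp measurable_odds_diff. Qed.

Let sdX : sqint P0 (fun w : obsT => odds_diff (covar w)).
Proof. exact: (sqint_prob P0 mdX (fun w : obsT => odds_diff_le (covar w))). Qed.

Let weight_diff (w : obsT) : weight pi1 w = weight pi0 w - control w * odds_diff (covar w).
Proof. by rewrite /weight /odds_diff; ring. Qed.

Let mcd : measurable_fun setT (fun w : obsT => control w * odds_diff (covar w)).
Proof. by apply: measurable_funM => //; exact: measurable_control. Qed.

Let cd_le (w : obsT) : `|control w * odds_diff (covar w)| <= 1 * `|odds_diff (covar w)|.
Proof. by rewrite normrM ler_wpM2r// control_le1. Qed.

Let sw0 : sqint P0 (weight pi0).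
Proof.
exact: (sqint_prob P0 (measurable_weight mpi0) (weight_le c0 pi0c)).
Qed.

(** Split [weight pi1] into [weight pi0] minus [control * odds_diff]. The first part, with the term
    in [t0], has mean 0 by [htau0] and orthogonality to [g]; in the second, [mu0] being a regression
    under [P0] allows [Y] to be replaced by [m]. *)
Lemma E0Z : \int[P0]_w Z w =
  - \int[P0]_w (odds_diff (covar w) * (control w * (m (covar w) - g (covar w)))).
Proof.
have sg := sqint_prob P0 mgX (fun w : obsT => gK (covar w)).
have sT0 := sqint_prob P0 (@measurable_treated R a b p) (@treated_le1 R a b p).
have e1 := htau0 f.
have e2 := weight_orthogonal c0 pi0c hpi0 mg (sqint_integrable sg).
have iwY := sqintM sw0 (sY sY0).
have igw : P0.-integrable setT (EFin \o (fun w : obsT => g (covar w) * weight pi0 w)).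
  exact: sqintM sg sw0.
have iT := integrable_scale t0 (sqint_integrable sT0).
have sYm : sqint P0 (fun w : obsT => Y w - m (covar w)) by exact: sqintB (sY sY0) sm.
have scYm : sqint P0 (fun w : obsT => control w * (Y w - m (covar w))).
  apply: (@sqint_le _ _ _ _ _ _ 1 _ _ sYm); last first.
    by move=> w; rewrite normrM ler_wpM2r// control_le1.
  by apply: measurable_funM; [exact: measurable_control|case: sYm].
have i3 := sqintM sdX scYm.
have e3 := regression_orthogonal hmu0 (sqint_integrable (sY sY0)) measurable_odds_diff i3.
have i4 := sqintM sdX scm.
have e4 : \int[P0]_w (t0 * treated w) = treat_prob P0 * t0.
  by rewrite RintegralZl ?treat_probE 1?mulrC//; exact: sqint_integrable.
have -> : \int[P0]_w Z w =
    (\int[P0]_w (weight pi0 w * Y w) - \int[P0]_w (g (covar w) * weight pi0 w) -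
    \int[P0]_w (t0 * treated w)) -
    (\int[P0]_w (odds_diff (covar w) * (control w * (Y w - m (covar w)))) +
     \int[P0]_w (odds_diff (covar w) * (control w * (m (covar w) - g (covar w))))).
  have j1 := integrable_minus iwY igw; have j2 := integrable_minus j1 iT.
  have j3 := integrable_plus i3 i4.
  rewrite -(RintegralB measurableT iwY igw) -(RintegralB measurableT j1 iT).
  rewrite -(RintegralD measurableT i3 i4) -(RintegralB measurableT j2 j3).
  by apply: eq_Rintegral => w _; rewrite /Z /Yg weight_diff; ring.
by rewrite e2 e3 e4 subr0 add0r -e1 subrr sub0r.
Qed.

(** A product of two small factors: the Hellinger distance, of order [e], and the tail of [mu0],
    which must be small by itself since the first factor is used up by the division by [e]. *)
Lemma E0Z_le : `|\int[P0]_w Z w| <= c ^- 2 * (4 * hel) * Tl.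
Proof.
rewrite E0Z normrN; apply: le_trans (cauchy_schwarz sdX scm) _.
apply: ler_pM; [exact: l2n_ge0|exact: l2n_ge0|exact: odds_diff_l2n|].
by apply: le_trans nmg; rewrite -[leRHS]mul1r; exact: (ler_l2n ler01 mcm cm_le smg).
Qed.

Let mpsi : measurable_fun setT score_test.
Proof.
apply: measurable_funB; apply: measurable_funM => //.
- exact: measurable_weight.
- exact: measurable_funB.
- exact: measurable_treated.
Qed.

Lemma sqint_score_test : sqint P0 score_test.
Proof.
have sYm : sqint P0 (fun w : obsT => Y w - m (covar w)) by exact: sqintB (sY sY0) sm.
have wc := weight_le (a := a) (b := b) c0 pi0c.
have [||//|] := @l2n_affine _ _ _ P0 score_test _ (1 + c^-1) (L2_norm tau0) mpsi sYm.
- by rewrite addr_ge0.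
- exact: L2_norm_ge0.
- move=> w; apply: le_trans (ler_normB _ _) _; apply: lerD.
    by rewrite normrM ler_wpM2r.
  rewrite normrM -[leRHS]mul1r; apply: ler_pM => //; first exact: treated_le1.
  exact: inner_le.
- by [].
Qed.

(** [Z - score_test] is weight0 (m - g) - control odds_diff Yg. Its second term times [S] has three
    factors: on the tail of [S] the odds difference is bounded by 1 / c, while on the rest [S] is
    bounded by [K'] and the odds difference is small in L^2. *)
Lemma score_covariance_le (K' : R) : 0 < K' ->
  `|\int[P0]_w (Z w * S w) - \int[P0]_w (score_test w * S w)| <=
  (1 + c^-1) * Tl * l2n P0 S +
  (c^-1 * (M + K) * l2n P0 (tail K' S) + K' * (c ^- 2 * (4 * hel)) * (M + K)).
Proof.
move=> K'0; have [sZ _] := Z_l2n sY0 Y0M; have [sYg nYg] := Yg_l2n sY0 Y0M.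
have st := sqint_tail K' sS; have [mS _] := sS.
pose s w := S w - tail K' S w.
have sK w : `|s w| <= K'.
  by rewrite /s /tail; case: ifP => ?; rewrite ?subr0// subrr normr0 ltW.
have ms : measurable_fun setT s by apply: measurable_funB => //; exact: measurable_tail.
have mwm : measurable_fun setT (fun w : obsT => weight pi0 w * (m (covar w) - g (covar w))).
  by apply: measurable_funM => //; exact: measurable_weight.
have wm_le (w : obsT) : `|weight pi0 w * (m (covar w) - g (covar w))| <=
    (1 + c^-1) * `|m (covar w) - g (covar w)|.
  by rewrite normrM ler_wpM2r// (weight_le c0 pi0c).
have c10 : 0 <= 1 + c^-1 by rewrite addr_ge0.
have swm := sqint_le mwm wm_le smg.
have mdY : measurable_fun setT (fun w : obsT => control w * odds_diff (covar w) * Yg w).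
  exact: measurable_funM.
have dY_le (w : obsT) : `|control w * odds_diff (covar w) * Yg w| <= c^-1 * `|Yg w|.
  rewrite normrM ler_wpM2r//; apply: le_trans (cd_le w) _.
  by rewrite mul1r odds_diff_le.
have sdY := sqint_le mdY dY_le sYg.
have msd : measurable_fun setT (fun w : obsT => control w * odds_diff (covar w) * s w).
  exact: measurable_funM.
have sd_le (w : obsT) : `|control w * odds_diff (covar w) * s w| <=
    K' * `|odds_diff (covar w)|.
  rewrite normrM mulrC; apply: ler_pM => //.
  by apply: le_trans (cd_le w) _; rewrite mul1r.
have ssd := sqint_le msd sd_le sdX.
have -> : \int[P0]_w (Z w * S w) - \int[P0]_w (score_test w * S w) =
    \int[P0]_w (weight pi0 w * (m (covar w) - g (covar w)) * S w) -
    (\int[P0]_w (control w * odds_diff (covar w) * Yg w * tail K' S w) +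
     \int[P0]_w (control w * odds_diff (covar w) * s w * Yg w)).
  have i1 := sqintM sZ sS; have i2 := sqintM sqint_score_test sS.
  have i3 := sqintM swm sS; have i4 := sqintM sdY st; have i5 := sqintM ssd sYg.
  have i45 := integrable_plus i4 i5.
  rewrite -(RintegralB measurableT i1 i2) -(RintegralD measurableT i4 i5).
  rewrite -(RintegralB measurableT i3 i45).
  apply: eq_Rintegral => w _; rewrite /Z /score_test weight_diff /s /Yg; ring.
have nwm : l2n P0 (fun w : obsT => weight pi0 w * (m (covar w) - g (covar w))) <= (1 + c^-1) * Tl.
  apply: le_trans (ler_l2n c10 mwm wm_le smg) _.
  by rewrite ler_wpM2l.
have ndY : l2n P0 (fun w : obsT => control w * odds_diff (covar w) * Yg w) <= c^-1 * (M + K).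
  apply: le_trans (ler_l2n ci0 mdY dY_le sYg) _.
  by rewrite ler_wpM2l.
have nsd : l2n P0 (fun w : obsT => control w * odds_diff (covar w) * s w) <=
    K' * (c ^- 2 * (4 * hel)).
  apply: le_trans (ler_l2n (ltW K'0) msd sd_le sdX) _.
  by rewrite ler_wpM2l ?(ltW K'0)// odds_diff_l2n.
apply: le_trans (ler_normB _ _) _; apply: lerD.
  apply: le_trans (cauchy_schwarz swm sS) _.
  by rewrite ler_wpM2r// l2n_ge0.
apply: le_trans (ler_normD _ _) _; apply: lerD.
  apply: le_trans (cauchy_schwarz sdY st) _.
  by rewrite ler_wpM2r// l2n_ge0.
apply: le_trans (cauchy_schwarz ssd sYg) _.
by apply: ler_pM => //; exact: l2n_ge0.
Qed.

Lemma test_derivative_le (K' : R) : 0 < K' ->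
  `|treat_prob P1 * L2_inner (tau1 - tau0) f / e - \int[P0]_w (score_test w * S w)| <=
  (l2n nu rem + l2n P0 (tail K' S)) * (V + V) + K' * hel * V +
  c ^- 2 * (4 * hel) * Tl / `|e| +
  ((1 + c^-1) * Tl * l2n P0 S +
  (c^-1 * (M + K) * l2n P0 (tail K' S) + K' * (c ^- 2 * (4 * hel)) * (M + K))).
Proof.
move=> K'0; have [sZ0 nZ0] := Z_l2n sY0 Y0M; have [sZ1 nZ1] := Z_l2n sY1 Y1M.
have h1 := mean_derivative_le hq0 hq1 sS e0 sZ0 sZ1 K'0.
have h2 := E0Z_le; have h3 := score_covariance_le K'0.
rewrite E1Z.
set A := \int[P1]_w Z w in h1 *; set B := \int[P0]_w Z w in h1 h2 *.
set I := \int[P0]_w (Z w * S w) in h1 h3 *.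
set J := \int[P0]_w (score_test w * S w) in h3 *.
(* Three errors: the expansion of the mean of a fixed [Z], the mean of [Z] under [P0], and the
   replacement of [Z] by its limit in the covariance with the score. *)
have -> : A / e - J = ((A - B) / e - I) + B / e + (I - J) by ring.
apply: le_trans (ler_normD _ _) _; apply: lerD => //.
apply: le_trans (ler_normD _ _) _; apply: lerD.
  apply: le_trans h1 _; apply: lerD.
    by apply: ler_wpM2l; [rewrite addr_ge0// l2n_ge0|exact: lerD].
  by apply: ler_wpM2l => //; rewrite mulr_ge0 ?l2n_ge0// ltW.
by rewrite normrM normfV ler_wpM2r// invr_ge0.
Qed.

End test_direction.
End two_laws.

(** * The pathwise derivative *)

Section path_derivative.
Context (R : realType) (a b : R) (p : nat).
Local Notation obsT := (obs R a b p).

Lemma near0_cvg0 (F : R -> R) : (forall e, 0 <= F e) ->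
  (forall eta, 0 < eta -> \forall e \near (0 : R)^', F e <= eta) -> F @ 0^' --> (0 : R).
Proof.
move=> F0 h; apply/cvgrPdist_le => eta eta0; apply: filterS (h _ eta0) => e he.
by rewrite sub0r normrN ger0_norm.
Qed.

(** Here [ea] is |e|, [r] the norm of the remainder, [h] the Hellinger distance, [t] and [Tl] the
    tails of the score and of [mu0], [s] the norm of the score and [nD] that of the derivative.
    Since r <= 1, h <= ea (1 + s / 2), and the terms are grouped according to the parameter that
    makes them small: [Tl], [t], [r] or [ea]. *)
Lemma error_budget (eta r h ea t Tl s V M K K' nD c : R) :
  0 < c -> 0 < ea -> 0 <= s -> 0 <= V -> 0 <= M -> 0 <= K -> 0 <= K' -> 0 <= nD ->
  0 <= r -> 0 <= t -> 0 <= Tl -> 0 <= h -> r <= 1 -> h <= ea * (r + s / 2) ->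
  Tl * (4 * c ^- 2 * (1 + s / 2) + (1 + c^-1) * s) <= eta ->
  t * (2 * V + c^-1 * (M + K)) <= eta ->
  r * (2 * V) <= eta ->
  ea * ((1 + s / 2) * (K' * V + K' * (4 * c ^- 2) * (M + K) + 2 * nD)) <= eta ->
  (r + t) * (V + V) + K' * h * V + c ^- 2 * (4 * h) * Tl / ea +
  ((1 + c^-1) * Tl * s + (c^-1 * (M + K) * t + K' * (c ^- 2 * (4 * h)) * (M + K))) +
  h * 2 * nD <= 4 * eta.
Proof.
move=> c0 ea0 s0 V0 M0 K0 K'0 nD0 r0 t0 T0 h0 r1 hh e1 e2 e3 e4.
have ci0 : 0 <= c ^- 2 by rewrite invr_ge0 sqr_ge0.
have hs : h <= ea * (1 + s / 2) by apply: le_trans hh _; rewrite ler_wpM2l ?(ltW ea0)// lerD2r.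
have h1 : c ^- 2 * (4 * h) * Tl / ea <= Tl * (4 * c ^- 2 * (1 + s / 2)).
  rewrite ler_pdivrMr//.
  have -> : Tl * (4 * c ^- 2 * (1 + s / 2)) * ea =
    c ^- 2 * (4 * (ea * (1 + s / 2))) * Tl by ring.
  by rewrite ler_wpM2r// ler_wpM2l// ler_wpM2l.
have h2 : h * (K' * V + K' * (4 * c ^- 2) * (M + K) + 2 * nD) <= eta.
  apply: le_trans e4; rewrite mulrA ler_wpM2r//.
  by rewrite !addr_ge0 ?mulr_ge0// ?addr_ge0.
have -> : (r + t) * (V + V) + K' * h * V + c ^- 2 * (4 * h) * Tl / ea +
  ((1 + c^-1) * Tl * s + (c^-1 * (M + K) * t + K' * (c ^- 2 * (4 * h)) * (M + K))) +
  h * 2 * nD = r * (2 * V) + t * (2 * V + c^-1 * (M + K)) +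
  h * (K' * V + K' * (4 * c ^- 2) * (M + K) + 2 * nD) +
  (c ^- 2 * (4 * h) * Tl / ea + Tl * ((1 + c^-1) * s)) by ring.
rewrite mulrDr in e1; lra.
Qed.

Variables (P : probability obsT R) (Pe : R -> probability obsT R) (S : obsT -> R).
Variables (nu : {sigma_finite_measure set obsT -> \bar R}) (q : R -> obsT -> R).
Variables (delta c M : R).
Hypotheses (delta0 : 0 < delta) (c0 : 0 < c) (sS : sqint P S).
Hypotheses (hq0 : has_density nu P (q 0))
  (hq : forall e, `|e| < delta -> has_density nu (Pe e) (q e)).
Hypothesis hqmd : (fun e : R => (\int[nu]_w
  ((qmd_remainder (q 0) (q e) S e w ^+ 2)%:E))%E) @ 0^' --> 0%E.
Variables (pi0 : covariate R p -> R) (mu0 : covariate R p -> L2 a b).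
Hypotheses (hpi0 : is_propensity P pi0) (pi0c : forall x, c <= pi0 x <= 1 - c).
Hypothesis hmu0 : is_regression P false mu0.
Hypothesis sN : sqint P (fun w => regression_norm mu0 (covar w)).
Hypotheses (sY0 : sqint P (fun w => L2_norm (outcome w)))
  (sY : forall e, `|e| < delta -> sqint (Pe e) (fun w => L2_norm (outcome w))).
Hypotheses (Y0M : l2n P (fun w => L2_norm (outcome w)) <= M)
  (YM : forall e, `|e| < delta -> l2n (Pe e) (fun w => L2_norm (outcome w)) <= M).
Variables (tau0 Dv : L2 a b) (tau : R -> L2 a b).
Hypothesis p00 : 0 < treat_prob P.
Hypothesis htau0 : forall f, treat_prob P * L2_inner tau0 f =
  \int[P]_w (weight pi0 w * L2_inner (outcome w) f).
Hypothesis htau : forall e, `|e| < delta -> treat_prob (Pe e) != 0 ->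
  exists pi, [/\ is_propensity (Pe e) pi, forall x, c <= pi x <= 1 - c &
    forall f, treat_prob (Pe e) * L2_inner (tau e) f =
      \int[Pe e]_w (weight pi w * L2_inner (outcome w) f)].
Hypothesis hDv : forall f, treat_prob P * L2_inner Dv f =
  \int[P]_w (score_test pi0 mu0 tau0 f w * S w).

Let M0 : 0 <= M. Proof. exact: le_trans (l2n_ge0 _ _) Y0M. Qed.

Let rem_small eta : 0 < eta ->
  \forall e \near (0 : R)^', l2n nu (qmd_remainder (q 0) (q e) S e) < eta.
Proof.
move=> eta0; move/fine_cvgP : hqmd => [_ /cvgrPdist_lt/(_ (eta ^+ 2))].
rewrite exprn_gt0// => /(_ isT).
apply: filterS => e /=; rewrite sub0r normrN => h.
rewrite -(@gtr0_norm _ eta)// -sqrtr_sqr ltr_sqrt ?exprn_gt0//.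
by apply: le_lt_trans h; exact: ler_norm.
Qed.

Let treat_prob_diff e : `|e| < delta ->
  `|treat_prob (Pe e) - treat_prob P| <= hellinger nu (q 0) (q e) * 2.
Proof.
move=> ed.
have mT := @measurable_treated R a b p.
have sT (Q : probability obsT R) : sqint Q (@treated R a b p).
  exact: (sqint_prob Q mT (@treated_le1 R a b p)).
have nT (Q : probability obsT R) : l2n Q (@treated R a b p) <= 1.
  have : l2n Q (@treated R a b p) <= 1 * l2n Q (cst 1).
    apply: ler_l2n => //; last exact: sqint_cst.
    by move=> w; rewrite normr1 mulr1 treated_le1.
  by rewrite l2n_cst normr1 mulr1.
have := mean_diff_le hq0 (hq ed) (sT P) (sT (Pe e)).
rewrite !treat_probE => h; apply: le_trans h _.
by rewrite ler_wpM2l ?l2n_ge0//; have := nT P; have := nT (Pe e); lra.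
Qed.

Theorem path_derivative :
  (fun e : R => L2_norm (e^-1 *: (tau e - tau0) - Dv)) @ 0^' --> (0 : R).
Proof.
apply: near0_cvg0 => [e|eta eta0]; first exact: L2_norm_ge0.
(* The final bound 4 eta' is eta times half of [treat_prob P], and [treat_prob (Pe e)] is at least
   that half. *)
pose eta' : R := eta * treat_prob P / 8.
have eta'0 : 0 < eta' by rewrite divr_gt0// mulr_gt0.
pose s := l2n P S; have s0 : 0 <= s by exact: l2n_ge0.
have ci0 : 0 <= c ^- 2 by rewrite invr_ge0 sqr_ge0.
have c10 : 0 <= c^-1 by rewrite invr_ge0 ltW.
have small (G : R) : 0 <= G -> exists2 z, 0 < z & forall y, 0 <= y -> y <= z -> y * G <= eta'.
  move=> G0; exists (eta' / (G + 1)); first by rewrite divr_gt0// ltr_wpDl.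
  move=> y y0; rewrite ler_pdivlMr ?ltr_wpDl// => h; apply: le_trans h.
  by rewrite ler_wpM2l// lerDl.
have G1 : 0 <= 4 * c ^- 2 * (1 + s / 2) + (1 + c^-1) * s.
  by rewrite addr_ge0 ?mulr_ge0 ?addr_ge0// divr_ge0.
have [z1 z10 hz1] := small _ G1.
(* The coefficient of this tail depends on neither level, so [K] can be fixed first; [V] and the
   coefficient of the tail of the score depend on it, and [K'] comes next. *)
have [K K0 hK] := l2n_tail sN z10.
pose V := test_bound c tau0 K M.
have V0 : 0 <= V.
  by rewrite /V /test_bound addr_ge0 ?L2_norm_ge0// mulr_ge0// addr_ge0// ltW.
have G2 : 0 <= 2 * V + c^-1 * (M + K).
  by rewrite addr_ge0 ?mulr_ge0// addr_ge0// ltW.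
have [z2 z20 hz2] := small _ G2.
have [K' K'0 hK'] := l2n_tail sS z20.
have G3 : 0 <= 2 * V by rewrite mulr_ge0.
have [z3 z30 hz3] := small _ G3.
have nD0 := L2_norm_ge0 Dv.
have G4 : 0 <= (1 + s / 2) * (K' * V + K' * (4 * c ^- 2) * (M + K) + 2 * L2_norm Dv).
  have hK0 := ltW K0; have hK'0 := ltW K'0.
  by apply: mulr_ge0; rewrite !addr_ge0 ?divr_ge0 ?mulr_ge0// addr_ge0.
have [z4 z40 hz4] := small _ G4.
(* Below this bound for |e| the Hellinger distance is at most a quarter of [treat_prob P], so the
   treatment probability moves by at most half of it and stays positive; this also puts [att] of the
   perturbed law in its weak form. *)
have z50 : 0 < treat_prob P / (4 * (1 + s / 2)).
  by rewrite divr_gt0// mulr_gt0// ltr_pwDl// divr_ge0.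
near=> e.
have e0 : e != 0 by near: e; exact: nbhs_dnbhs_neq.
have ed : `|e| < delta by near: e; exact: dnbhs0_lt.
have ez4 : `|e| < z4 by near: e; exact: dnbhs0_lt.
have ez5 : `|e| < treat_prob P / (4 * (1 + s / 2)) by near: e; exact: dnbhs0_lt.
have r1 : l2n nu (qmd_remainder (q 0) (q e) S e) < 1 by near: e; exact: rem_small.
have rz3 : l2n nu (qmd_remainder (q 0) (q e) S e) < z3 by near: e; exact: rem_small.
set r := l2n nu _ in r1 rz3.
have r0 : 0 <= r by exact: l2n_ge0.
have hle := hellinger_le hq0 (hq ed) sS e0; rewrite -/r -/s in hle.
set h := hellinger _ _ _ in hle.
have h0 : 0 <= h by exact: l2n_ge0.
have ea0 : 0 < `|e| by rewrite normr_gt0.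
have hdiff := treat_prob_diff ed; rewrite -/h in hdiff.
have hh : h <= `|e| * (1 + s / 2).
  by apply: le_trans hle _; rewrite ler_wpM2l// lerD2r ltW.
have ph : h * 4 <= treat_prob P.
  apply: le_trans (_ : `|e| * (1 + s / 2) * 4 <= _); first by rewrite ler_wpM2r.
  by rewrite -mulrA (mulrC _ 4) -ler_pdivlMr ?ltW// mulr_gt0// ltr_pwDl// divr_ge0.
have p1 : treat_prob P / 2 <= treat_prob (Pe e).
  by move: hdiff; rewrite ler_norml => /andP[]; lra.
have p10 : 0 < treat_prob (Pe e) by apply: lt_le_trans p1; rewrite divr_gt0.
have [pi1 [hpi1 pi1c htau1]] := htau ed (lt0r_neq0 p10).
apply: L2_norm_le_dual; first exact: ltW.
move=> f f1.
have hb := test_derivative_le hq0 (hq ed) sS e0 hpi0 hpi1 c0 pi0c pi1c hmu0 sY0 (sY ed)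
  sN htau0 htau1 f1 K0 Y0M (YM ed) K'0.
rewrite -hDv -/r -/h -/s -/V in hb.
have budget := error_budget c0 ea0 s0 V0 M0 (ltW K0) (ltW K'0) nD0 r0
  (l2n_ge0 P (tail K' S)) (l2n_ge0 P _) h0 (ltW r1) hle
  (hz1 _ (l2n_ge0 P _) (ltW hK)) (hz2 _ (l2n_ge0 P _) (ltW hK'))
  (hz3 _ r0 (ltW rz3)) (hz4 _ (ltW ea0) (ltW ez4)).
have Df : `|L2_inner Dv f| <= L2_norm Dv.
  by apply: le_trans (L2_cauchy_schwarz Dv f) _; rewrite ler_piMr.
(* The difference quotient is multiplied by the treatment probability of the perturbed law, [Dv] by
   that of [P]; this bounds the discrepancy. *)
have pD : `|(treat_prob P - treat_prob (Pe e)) * L2_inner Dv f| <= h * 2 * L2_norm Dv.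
  by rewrite normrM distrC; apply: ler_pM.
have key : treat_prob (Pe e) * L2_inner (e^-1 *: (tau e - tau0) - Dv) f <= 4 * eta'.
  apply: (le_trans _ budget); apply: (le_trans _ (lerD hb pD)).
  rewrite (L2_innerBl (e^-1 *: (tau e - tau0))) L2_innerZl.
  rewrite (_ : treat_prob (Pe e) * _ =
    (treat_prob (Pe e) * L2_inner (tau e - tau0) f / e - treat_prob P * L2_inner Dv f) +
    (treat_prob P - treat_prob (Pe e)) * L2_inner Dv f); last by ring.
  by apply: lerD; exact: ler_norm.
rewrite -(ler_pM2l p10); apply: le_trans key _.
apply: le_trans (_ : treat_prob P / 2 * eta <= _).
  by rewrite /eta' le_eqVlt; apply/orP; left; apply/eqP; field.
by rewrite ler_wpM2r// ltW.
Unshelve. all: by end_near. Qed.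

End path_derivative.

(** * The influence function as a gradient *)

Section gradient.
Context (R : realType) (a b : R) (p : nat).
Local Notation obsT := (obs R a b p).

Lemma eif_mu1E (P : probability obsT R) (pi0 : covariate R p -> R)
  (mu0 mu1 : covariate R p -> L2 a b) (w : obsT) :
  eif_mu1 P pi0 mu0 mu1 w = eif P pi0 mu0 w.
Proof.
rewrite /eif_mu1 /eif; move: (att P) => tau.
rewrite [X in X - _]addrAC -scalerDr addrA subrK.
by rewrite addrAC -scalerBr.
Qed.

Variables (P : probability obsT R) (pi0 : covariate R p -> R)
  (mu0 : covariate R p -> L2 a b).
Hypotheses (hpi0 : is_propensity P pi0) (hmu0 : is_regression P false mu0).
Hypothesis p01 : 0 < treat_prob P < 1.

Lemma sqint_of_second_moment (Q : probability obsT R) :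
  (\int[Q]_w (L2_norm (outcome w) ^+ 2)%:E < +oo)%E ->
  sqint Q (fun w => L2_norm (outcome w)).
Proof. by apply: sqintP; exact: measurable_outcome_norm. Qed.

Lemma eif_inner (w : obsT) f : L2_inner (eif P pi0 mu0 w) f =
  (treat_prob P)^-1 * score_test pi0 mu0 (att P) f w.
Proof.
rewrite /eif /score_test; move: (att P) => tau.
rewrite L2_innerBl !L2_innerZl !L2_innerBl /weight /odds /treated /control invfM.
by ring.
Qed.

Lemma measurable_score_test (tau f : L2 a b) pi : measurable_fun setT pi ->
  measurable_fun setT (@score_test R a b p pi mu0 tau f).
Proof.
move=> mpi; have mm := measurable_regression_inner hmu0 f.
apply: measurable_funB; apply: measurable_funM => //.
- exact: measurable_weight.
- apply: measurable_funB; first exact: measurable_outcome_inner.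
  exact: (measurable_covar_comp mm).
- exact: measurable_treated.
Qed.

Lemma measurable_eif_inner f : measurable_fun setT (fun w => L2_inner (eif P pi0 mu0 w) f).
Proof.
have [mpi0 _ _] := hpi0.
rewrite (_ : (fun w => _) = fun w => (treat_prob P)^-1 * score_test pi0 mu0 (att P) f w).
  by apply: measurable_funM => //; exact: measurable_score_test.
by apply/funext => w; exact: eif_inner.
Qed.

Hypothesis hphi : (\int[P]_w (L2_norm (eif P pi0 mu0 w) ^+ 2)%:E < +oo)%E.

(** Projections of the influence function are measurable and bounded by its norm. The direction is
    normalized before integrating, so that no constant has to be moved through the integral of the
    squared norm; directions of norm 0 are treated apart. *)
Lemma eif_inner_l2n f : sqint P (fun w => L2_inner (eif P pi0 mu0 w) f) /\
  l2n P (fun w => L2_inner (eif P pi0 mu0 w) f) <=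
  Num.sqrt (fine (\int[P]_w (L2_norm (eif P pi0 mu0 w) ^+ 2)%:E)) * L2_norm f.
Proof.
set C := fine _; have mG := measurable_eif_inner f.
pose G w := L2_inner (eif P pi0 mu0 w) f.
have C0 : 0 <= C by rewrite fine_ge0// integral_ge0// => w _; rewrite lee_fin sqr_ge0.
have CE : (\int[P]_w (L2_norm (eif P pi0 mu0 w) ^+ 2)%:E)%E = C%:E.
  by rewrite fineK// ge0_fin_numE// integral_ge0// => w _; rewrite lee_fin sqr_ge0.
have [f0|fn0] := eqVneq (L2_norm f) 0.
  have G0 : G = fun=> 0.
    apply/funext => w; apply/eqP; rewrite -normr_le0.
    by apply: le_trans (L2_cauchy_schwarz _ _) _; rewrite f0 mulr0.
  rewrite -/G G0 f0 mulr0; split; first exact: sqint0.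
  by have := l2n_cst P (0 : R); rewrite normr0 /cst => ->.
have fp : 0 < L2_norm f by rewrite lt_neqAle eq_sym fn0 L2_norm_ge0.
pose g : L2 a b := (L2_norm f)^-1 *: f.
have g1 : L2_norm g = 1.
  by rewrite /g L2_normZ ger0_norm ?invr_ge0 ?(ltW fp)// mulVf.
have mGg := measurable_eif_inner g.
have le : (\int[P]_w (L2_inner (eif P pi0 mu0 w) g ^+ 2)%:E <= C%:E)%E.
  rewrite -CE; apply: ge0_le_integral_nonmeasurable => w; first by rewrite lee_fin sqr_ge0.
  rewrite lee_fin -real_normK ?num_real// lerXn2r ?nnegrE ?L2_norm_ge0//.
  by apply: le_trans (L2_cauchy_schwarz _ _) _; rewrite g1 mulr1.
have sg : sqint P (fun w => L2_inner (eif P pi0 mu0 w) g).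
  by apply: sqintP => //; apply: le_lt_trans le _; rewrite ltry.
have ng : l2n P (fun w => L2_inner (eif P pi0 mu0 w) g) <= Num.sqrt C.
  apply: ler_wsqrtr; rewrite -lee_fin; apply: le_trans le.
  by rewrite /Rintegral fineK//; case: sg => _ h; exact: (integrable_fin_num measurableT h).
have GE : G = fun w => L2_norm f * L2_inner (eif P pi0 mu0 w) g.
  by apply/funext => w; rewrite /G /g L2_innerZr mulrA mulfV// mul1r.
rewrite -/G GE; split; first exact: sqintZ.
by rewrite l2nZ// (ger0_norm (ltW fp)) mulrC ler_wpM2r// ltW.
Qed.

Hypothesis hY : (\int[P]_w (L2_norm (outcome w) ^+ 2)%:E < +oo)%E.

Let sY : sqint P (fun w => L2_norm (outcome w)).
Proof. exact: sqint_of_second_moment. Qed.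

Lemma score_test_ae c (tau f : L2 a b) : overlap P pi0 c ->
  {ae P, forall w, score_test pi0 mu0 tau f w =
    score_test (fun x => clip c (pi0 x)) mu0 tau f w}.
Proof.
move=> /overlap_clip; apply: filterS => w h.
by rewrite /score_test /weight /odds -h.
Qed.

Lemma overlap_le c c' (Q : probability obsT R) pi : c' <= c -> overlap Q pi c ->
  overlap Q pi c'.
Proof.
move=> cc; apply: filterS => w /andP[h1 h2].
by rewrite (le_trans cc h1) (le_trans h2)// lerB.
Qed.

Lemma regression_norm_sqint c : 0 < c < 1 / 2 -> overlap P pi0 c ->
  sqint P (fun w => regression_norm mu0 (covar w)).
Proof.
move=> /andP[c0 c2] ho.
apply: (regression_sqint hmu0 (propensity_clip hpi0 ho) c0).
  by move=> x; exact: clip_bounds.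
exact: (control_regression_sqint hmu0 sY hpi0 c0 ho p01 hphi).
Qed.

Lemma score_eif_mean (S : obsT -> R) : sqint P S ->
  exists D, is_L2_mean P (fun w => S w *: eif P pi0 mu0 w) D.
Proof.
move=> sS; set C := Num.sqrt (fine (\int[P]_w (L2_norm (eif P pi0 mu0 w) ^+ 2)%:E)).
apply: (@pettis_mean _ _ _ _ _ _ (l2n P S * C)) => f.
  have [s _] := eif_inner_l2n f.
  under [X in integrable _ _ (_ \o X)]eq_fun do rewrite L2_innerZl.
  exact: sqintM.
have [s ns] := eif_inner_l2n f.
under eq_Rintegral do rewrite L2_innerZl.
apply: le_trans (cauchy_schwarz sS s) _.
by rewrite -mulrA ler_wpM2l// l2n_ge0.
Qed.

Theorem eif_gradient : (exists2 c, 0 < c < 1 / 2 & overlap P pi0 c) ->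
  is_gradient P (eif P pi0 mu0).
Proof.
move=> [c1 /andP[c10 c12] ho1] delta Pe S
  [delta0 P0E [LS [nu [q [hq hqmd]]]] [c2 /andP[c20 c22] ho2] [M hM]].
have /Lfun2P sS := LS.
have [D hD] := score_eif_mean sS; exists D => //.
(* A common overlap constant for [P] and for the submodel, whose own constant is unrelated to that
   of [P]. *)
pose c := Num.min c1 c2.
have c0 : 0 < c by rewrite /c lt_min c10.
have ch : c < 1 / 2 by rewrite /c gt_min c12.
have c01 : 0 < c < 1 / 2 by rewrite c0.
have ho : overlap P pi0 c by apply: overlap_le ho1; rewrite /c ge_min lexx.
pose pi0' x := clip c (pi0 x).
have hpi0' : is_propensity P pi0' by exact: propensity_clip.
have pi0c x : c <= pi0' x <= 1 - c by exact: clip_bounds.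
have sN := regression_norm_sqint c01 ho.
have /andP[p0 p1] := p01.
have hq0 : has_density nu P (q 0).
  have [mq q0 hA] := hq 0 (ltac:(by rewrite normr0)).
  by split=> // A mA; rewrite -P0E// hA.
have sYe e : `|e| < delta -> sqint (Pe e) (fun w => L2_norm (outcome w)).
  by move=> ed; apply: sqint_of_second_moment; apply: le_lt_trans (hM e ed) _; rewrite ltry.
(* [P] and [Pe 0] are only known to agree on measurable sets; including the norm under [P] in the
   maximum avoids transferring the bound. *)
pose M' := Num.max (Num.sqrt M) (l2n P (fun w => L2_norm (outcome w))).
have YM e : `|e| < delta -> l2n (Pe e) (fun w => L2_norm (outcome w)) <= M'.
  move=> ed; rewrite /M' le_max; apply/orP; left; apply: ler_wsqrtr.
  have [_ s2] := sYe e ed.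
  rewrite -lee_fin /Rintegral fineK; first exact: hM.
  exact: (integrable_fin_num measurableT s2).
have Y0M : l2n P (fun w => L2_norm (outcome w)) <= M' by rewrite /M' le_max lexx orbT.
apply: (path_derivative (c := c) delta0 c0 sS hq0 hq hqmd hpi0' pi0c hmu0 sN sY sYe Y0M YM p0).
- by move=> f; apply: (att_inner f c0 pi0c hpi0' (lt0r_neq0 p0) sY).
- move=> e ed pn0; have [pi hpi hov] := ho2 e ed.
  have hov' : overlap (Pe e) pi c by apply: overlap_le hov; rewrite /c ge_min lexx orbT.
  exists (fun x => clip c (pi x)); split; first exact: propensity_clip.
    by move=> x; exact: clip_bounds.
  move=> f; apply: (att_inner f c0 _ (propensity_clip hpi hov') pn0 (sYe e ed)).
  by move=> x; exact: clip_bounds.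
- move=> f; have [iD eD] := hD f.
  have pn0 := lt0r_neq0 p0; have [mpi0 _ _] := hpi0; have [mpi0' _ _] := hpi0'.
  have [mS _] := sS.
  have -> : L2_inner D f = \int[P]_w L2_inner (S w *: eif P pi0 mu0 w) f.
    by rewrite -[LHS]/(fine (L2_inner D f)%:E) eD.
  rewrite -RintegralZl//.
  (* The influence function is written with [pi0], the derivative theorem with its clipped version;
     they agree almost surely under [P]. *)
  apply: Rintegral_ae_eq.
  + by apply: measurable_funM => //; exact: integrable_measurable iD.
  + by apply: measurable_funM => //; exact: measurable_score_test.
  apply: filterS (score_test_ae (att P) f ho) => w h.
  by rewrite -h L2_innerZl eif_inner; field.
Qed.

End gradient.

(** * Tilted submodels and the tangent space *)

(** Registers [covar] as a measurable function so that the law of the covariates can be formed as a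
    [distribution]. *)
HB.instance Definition _ (R : realType) (a b : R) (p : nat) :=
  isMeasurableFun.Build _ _ (obs R a b p) (covariate R p) (@covar R a b p)
    (@measurable_covar R a b p).

Section tilting.
Context d (T : measurableType d) (R : realType).
Variables (P : probability T R) (q : T -> R).
Hypotheses (mq : measurable_fun setT q) (q0 : forall w, 0 <= q w).
Hypothesis q1 : (\int[P]_w (q w)%:E = 1)%E.

Let tilt (A : set T) : \bar R := (\int[P]_(w in A) (q w)%:E)%E.

Let tilt0 : tilt set0 = 0%E. Proof. exact: integral_set0. Qed.

Let tilt_ge0 A : (0 <= tilt A)%E.
Proof. by apply: integral_ge0 => w _; rewrite lee_fin. Qed.

Let tilt_sigma_additive : semi_sigma_additive tilt.
Proof.
apply: semi_sigma_additive_nng_induced; first exact/measurable_EFinP.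
by move=> w; rewrite lee_fin.
Qed.

HB.instance Definition _ := isMeasure.Build _ _ _ tilt tilt0 tilt_ge0 tilt_sigma_additive.
HB.instance Definition _ := @Measure_isProbability.Build _ _ R tilt q1.

Lemma tilted_probability : exists Q : probability T R, has_density P Q q.
Proof. by exists tilt; split. Qed.

End tilting.

(** With u = sqrt(1 + x) the error is exactly (u - 1)^2 / 2, while x = (u - 1)(u + 1) with u + 1 >=
    1. *)
Lemma sqrt_taylor (R : realType) (x : R) : -1 <= x ->
  `|Num.sqrt (1 + x) - 1 - x / 2| <= x ^+ 2 / 2.
Proof.
move=> x1; set u := Num.sqrt (1 + x).
have u0 : 0 <= u by exact: sqrtr_ge0.
have xE : x = u ^+ 2 - 1 by rewrite sqr_sqrtr; lra.
clearbody u; subst x.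
have -> : u - 1 - (u ^+ 2 - 1) / 2 = - ((u - 1) ^+ 2 / 2) by field.
rewrite normrN ger0_norm; last by rewrite divr_ge0// sqr_ge0.
rewrite ler_pM2r ?invr_gt0//.
have -> : (u ^+ 2 - 1) ^+ 2 = (u - 1) ^+ 2 * (u + 1) ^+ 2 by ring.
rewrite ler_peMr ?sqr_ge0// -[leLHS](expr1n _ 2) lerXn2r ?nnegrE//; lra.
Qed.

(** * Existence of a propensity with overlap *)

Section propensity_existence.
Context (R : realType) (a b : R) (p : nat).
Local Notation obsT := (obs R a b p).
Variables (Q : probability obsT R).

Let QX : probability (covariate R p) R := distribution Q (@covar R a b p).

Let QX_sqint (k : covariate R p -> R) : sqint QX k ->
  sqint Q (fun w => k (covar w)) /\ l2n Q (fun w => k (covar w)) = l2n QX k.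
Proof.
move=> [mk ik].
have mk2 : measurable_fun setT (EFin \o (fun x => k x ^+ 2)).
  by apply/measurable_EFinP; exact: measurable_funX.
have e : (\int[QX]_x (k x ^+ 2)%:E = \int[Q]_w (k (covar w) ^+ 2)%:E)%E.
  rewrite (ge0_integral_distribution _ mk2)// => x.
  by rewrite lee_fin sqr_ge0.
split; last by rewrite /l2n /Rintegral e.
apply: sqintP; first exact: measurable_covar_comp.
rewrite -e; exact: (integrable_lty measurableT ik).
Qed.

(** The propensity represents k |-> E{D k(X)} on L^2 of the law of X, a functional bounded by
    Cauchy-Schwarz. Overlap is stated through integrals because that form survives a change of law
    by a bounded density. *)
Theorem propensity_exists (c : R) : 0 < c < 1 ->
  (forall (k : covariate R p -> R) (K : R), measurable_fun setT k ->
    (forall x, 0 <= k x <= K) ->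
    c * (\int[Q]_w k (covar w)) <= \int[Q]_w (treated w * k (covar w)) <=
    (1 - c) * \int[Q]_w k (covar w)) ->
  exists2 pi, is_propensity Q pi & overlap Q pi c.
Proof.
move=> /andP[c0 c1] hk.
have mT := @measurable_treated R a b p.
have sT : sqint Q (@treated R a b p) := sqint_prob Q mT (@treated_le1 R a b p).
pose L (k : covariate R p -> R) := \int[Q]_w (treated w * k (covar w)).
have QXfin : (QX setT < +oo)%E by rewrite [X in (X < _)%E]probability_setT ltry.
have [|||| h sh hL] := @riesz_representation _ _ _ QX QXfin L (l2n Q (@treated R a b p)).
- move=> f g /QX_sqint[sf _] /QX_sqint[sg _].
  rewrite /L -RintegralD//; [|exact: sqintM|exact: sqintM].
  by apply: eq_Rintegral => w _; rewrite mulrDr.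
- move=> k f /QX_sqint[sf _]; rewrite /L -RintegralZl//; last exact: sqintM.
  by apply: eq_Rintegral => w _; ring.
- by move=> f /QX_sqint[sf <-]; exact: cauchy_schwarz.
- exact: l2n_ge0.
have [sh' _] := QX_sqint sh; have [mh _] := sh.
have ih := sqint_integrable sh'.
have hL' k : sqint QX k -> L k = \int[Q]_w (h (covar w) * k (covar w)).
  move=> sk; rewrite hL// /Rintegral; congr fine.
  have mhk : measurable_fun setT (EFin \o (fun x => h x * k x)).
    by apply/measurable_EFinP; apply: measurable_funM => //; case: sk.
  have [sk' _] := QX_sqint sk.
  by rewrite (integral_distribution mhk)//; exact: (sqintM sh' sk').
exists h.
  split=> //; move=> B mB; rewrite setTI.
  have mI : measurable_fun setT (\1_B : covariate R p -> R) by exact: measurable_indic.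
  have sI : sqint QX (\1_B : covariate R p -> R).
    apply: (@sqint_prob _ _ _ QX _ 1 mI) => x.
    by rewrite indicE; case: (_ \in _); rewrite ?normr1 ?normr0.
  have [sI' _] := QX_sqint sI.
  have e (F : obsT -> R) : sqint Q F ->
      (\int[Q]_(w in @covar R a b p @^-1` B) (F w)%:E)%E =
      (\int[Q]_w (F w * \1_B (covar w)))%:E.
    move=> sF; rewrite /Rintegral fineK; last first.
      exact: (integrable_fin_num measurableT (sqintM sF sI')).
    rewrite [LHS]integral_mkcond; apply: eq_integral => w _.
    rewrite patchE indicE.
    have -> : (w \in @covar R a b p @^-1` B) = (covar w \in B).
      by apply/idP/idP; rewrite !inE.
    by case: (_ \in _); rewrite ?mulr1 ?mulr0.
  by rewrite (e _ sT) (e _ sh') -[in LHS]/(L \1_B) hL'.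
have lower (l : covariate R p -> R) : measurable_fun setT l ->
    sqint Q (fun w => l (covar w)) ->
    (forall (k : covariate R p -> R) (K : R), measurable_fun setT k ->
    (forall x, 0 <= k x <= K) ->
      0 <= \int[Q]_w (l (covar w) * k (covar w))) ->
    {ae Q, forall w, 0 <= l (covar w)}.
  move=> ml sl hl.
  (* Tested against the indicator of l < 0, [l] has a nonnegative mean although the product is
     nonpositive, so the product vanishes almost surely. *)
  pose k x : R := if 0 <= l x then 0 else 1.
  have mk : measurable_fun setT k by apply: measurable_fun_ifT => //; exact: measurable_fun_ler.
  have k01 x : 0 <= k x <= 1 by rewrite /k; case: ifP; rewrite ?lexx ler01.
  have kn x : `|k x| <= 1 by have /andP[h1 h2] := k01 x; rewrite ger0_norm.
  have sk := sqint_prob Q (measurable_covar_comp (a := a) (b := b) mk) (fun w => kn (covar w)).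
  have ilk := sqintM sl sk.
  have h0 := hl k 1 mk k01.
  have neg w : l (covar w) * k (covar w) = - `|l (covar w) * k (covar w)|.
    rewrite /k; case: ifPn => [_|]; first by rewrite mulr0 normr0 oppr0.
    by rewrite -ltNge mulr1 => h1; rewrite ltr0_norm// opprK.
  have z : \int[Q]_w `|l (covar w) * k (covar w)| = 0.
    apply/eqP; rewrite eq_le Rintegral_ge0// andbT.
    have i' := integrable_norm ilk.
    rewrite -oppr_ge0; apply: le_trans h0 _.
    rewrite -mulN1r -RintegralZl//.
    apply: le_Rintegral => //; first exact: integrable_scale.
    by move=> w _; rewrite mulN1r -neg.
  have /ae_eq_integral_abs : (\int[Q]_w `|(l (covar w) * k (covar w))%:E| = 0)%E.
    have := integrable_fin_num measurableT (integrable_norm ilk) => /= /fineK <-.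
    by congr EFin.
  move=> /(_ measurableT (measurable_int _ ilk)).
  apply: filterS => w /= /(_ I) [/eqP]; rewrite /k.
  by case: ifPn => // h1; rewrite mulr1 => /eqP l0; rewrite l0 lexx in h1.
have sc (k : R) : sqint Q (fun w : obsT => k) := sqint_cst Q k.
have bk (k : covariate R p -> R) K : measurable_fun setT k -> (forall x, 0 <= k x <= K) ->
    sqint QX k.
  move=> mk kK; apply: (sqint_prob QX mk (K := K)) => x.
  by have /andP[h1 h2] := kK x; rewrite ger0_norm.
have lo : {ae Q, forall w, 0 <= h (covar w) - c}.
  apply: (lower (fun x => h x - c)).
  - exact: measurable_funB.
  - exact: sqintB.
  move=> k K mk kK; have sk := bk k K mk kK; have [sk' _] := QX_sqint sk.
  have /andP[h1 _] := hk k K mk kK.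
  have i1 := sqintM sh' sk'; have i2 := integrable_scale c (sqint_integrable sk').
  have -> : \int[Q]_w ((h (covar w) - c) * k (covar w)) = L k - c * \int[Q]_w k (covar w).
    rewrite hL'// -(RintegralZl _ measurableT (sqint_integrable sk')).
    rewrite -(RintegralB measurableT i1 i2).
    by apply: eq_Rintegral => w _; rewrite mulrBl.
  by rewrite subr_ge0.
have up : {ae Q, forall w, 0 <= (1 - c) - h (covar w)}.
  apply: (lower (fun x => (1 - c) - h x)).
  - exact: measurable_funB.
  - exact: sqintB.
  move=> k K mk kK; have sk := bk k K mk kK; have [sk' _] := QX_sqint sk.
  have /andP[_ h1] := hk k K mk kK.
  have i1 := sqintM sh' sk'; have i2 := integrable_scale (1 - c) (sqint_integrable sk').
  have -> : \int[Q]_w ((1 - c - h (covar w)) * k (covar w)) =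
      (1 - c) * (\int[Q]_w k (covar w)) - L k.
    rewrite hL'// -(RintegralZl _ measurableT (sqint_integrable sk')).
    rewrite -(RintegralB measurableT i2 i1).
    by apply: eq_Rintegral => w _; rewrite mulrBl.
  by rewrite subr_ge0.
apply: filterS2 lo up => w; rewrite !subr_ge0 => -> h1.
by rewrite h1.
Qed.

End propensity_existence.

(** [A1], [A2] are the means of k(X) and D k(X) under [P], [B1], [B2] those under a law with density
    between 1/2 and 3/2. Treated and control parts are each at least c A1 / 2, and B1 <= 3 A1 / 2,
    whence c / 3. The last hypothesis is already multiplied by [c] to keep the problem linear in the
    products. *)
Lemma tilt_arith (R : realType) (c A1 A2 B1 B2 : R) :
  c * A1 <= A2 -> A2 <= (1 - c) * A1 -> 1 / 2 * A2 <= B2 ->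
  1 / 2 * (A1 - A2) <= B1 - B2 -> c * B1 <= c * (3 / 2 * A1) ->
  c / 3 * B1 <= B2 <= (1 - c / 3) * B1.
Proof. by move=> *; apply/andP; split; lra. Qed.

(** * Bounded scores and their density in the mean-zero functions *)

Section tangent.
Context (R : realType) (a b : R) (p : nat).
Local Notation obsT := (obs R a b p).
Variables (P : probability obsT R) (pi0 : covariate R p -> R).
Hypothesis hpi0 : is_propensity P pi0.
Hypothesis hov : exists2 c : R, 0 < c < 1 / 2 & overlap P pi0 c.
Hypothesis hY : (\int[P]_w (L2_norm (outcome w) ^+ 2)%:E < +oo)%E.

Section bounded_score.
Variables (s : obsT -> R) (K : R).
Hypotheses (ms : measurable_fun setT s) (K0 : 0 < K) (sK : forall w, `|s w| <= K).
Hypothesis s0 : \int[P]_w s w = 0.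

(** For |e| below this value |e s| <= 1/2, so the density stays between 1/2 and 3/2. *)
Let delta : R := (2 * K)^-1.
Let q (e : R) (w : obsT) : R := 1 + e * s w.

Let delta0 : 0 < delta. Proof. by rewrite invr_gt0 mulr_gt0. Qed.

Let es_le e w : `|e| < delta -> `|e * s w| <= 1 / 2.
Proof.
move=> ed; rewrite normrM; apply: le_trans (ler_pM _ _ (ltW ed) (sK w)) _ => //.
by rewrite /delta invfM div1r -mulrA mulVf ?mulr1// gt_eqF.
Qed.

Let q_bounds e w : `|e| < delta -> 1 / 2 <= q e w <= 3 / 2.
Proof.
move=> /(es_le w); rewrite ler_norml /q => /andP[h1 h2].
by apply/andP; split; lra.
Qed.

Let ss : sqint P s. Proof. exact: sqint_prob ms sK. Qed.

Let mq e : measurable_fun setT (q e).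
Proof. by apply: measurable_funD => //; exact: measurable_funM. Qed.

Let q_ge0 e w : `|e| < delta -> 0 <= q e w.
Proof. by move=> /(q_bounds w) /andP[h _]; apply: le_trans h; rewrite divr_ge0. Qed.

(** Outside the range of [e] the law [P] itself serves as a placeholder, so that a total family can
    be chosen. *)
Let Pe_ex e : exists Q : probability obsT R, `|e| < delta -> has_density P Q (q e).
Proof.
have [ed|/negP ned] := boolP (`|e| < delta); last by exists P => ed; exfalso; exact: ned.
have q1 : (\int[P]_w (q e w)%:E = 1)%E.
  have i1 := sqint_integrable (sqint_cst P 1).
  have i2 := integrable_scale e (sqint_integrable ss).
  have : \int[P]_w (cst 1 w + e * s w) = 1.
    rewrite (RintegralD measurableT i1 i2) (RintegralZl _ measurableT (sqint_integrable ss)).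
    by rewrite s0 mulr0 addr0 Rintegral_cst// [X in fine X]probability_setT mulr1.
  move=> <-; rewrite /Rintegral fineK//.
  exact: (integrable_fin_num measurableT (integrable_plus i1 i2)).
have [Q hQ] := tilted_probability (mq e) (fun w => q_ge0 w ed) q1.
by exists Q.
Qed.

(** Relative to [P] the density at 0 is 1, so the remainder of differentiability in quadratic mean
    is the Taylor error of sqrt(1 + e s) divided by [e], at most |e| K^2 / 2 at every point. Uniform
    overlap and second moments follow from the bounds 1/2 and 3/2 on the densities. *)
Lemma bounded_score_regular :
  exists delta Pe, @regular_submodel R a b p P delta Pe s.
Proof.
have [Pe hPe] := choice Pe_ex.
exists delta, Pe; split=> //.
- move=> A mA; have d0 : `|0 : R| < delta by rewrite normr0.
  have [_ _ ->//] := hPe 0 d0.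
  under eq_integral do rewrite /q mul0r addr0.
  by have := integral_cst P mA 1%E; rewrite mul1e.
- split; first by apply/Lfun2P.
  exists P, q; split.
    move=> e ed; have [mqe qe0 hA] := hPe e ed.
    by split=> // A mA; exact: hA.
  pose B (e : R) : R := (`|e| * K ^+ 2 / 2) ^+ 2.
  have B0 : (fun e => (B e)%:E) @ (0 : R)^' --> 0%E.
    apply: cvg_EFin; first by near=> e.
    apply: near0_cvg0 => [e|eta eta0]; first exact: sqr_ge0.
    (* The 1 gives e^2 <= |e|, so that a bound linear in |e| suffices. *)
    pose z := Num.min 1 (eta / (K ^+ 2 / 2 + 1) ^+ 2).
    have G0 : 0 < K ^+ 2 / 2 + 1 by rewrite ltr_wpDl// divr_ge0// sqr_ge0.
    have z0 : 0 < z by rewrite lt_min ltr01 divr_gt0// exprn_gt0.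
    near=> e; have : `|e| < z by near: e; exact: dnbhs0_lt.
    rewrite lt_min => /andP[e1 e2]; rewrite /= /B -mulrA exprMn.
    rewrite ltr_pdivlMr ?exprn_gt0// in e2; apply: le_trans (ltW e2).
    apply: ler_pM; rewrite ?sqr_ge0//.
      by rewrite expr2 ler_piMl// ltW.
    by rewrite lerXn2r ?nnegrE ?(ltW G0)// ?divr_ge0 ?sqr_ge0// lerDl.
  apply: (squeeze_cvge _ (@cvg_cst _ 0%E _ _ _) B0).
  near=> e.
  have ed : `|e| < delta by near: e; exact: dnbhs0_lt.
  have e0 : e != 0 by near: e; exact: nbhs_dnbhs_neq.
  apply/andP; split; first by apply: integral_ge0 => w _; rewrite lee_fin sqr_ge0.
  have -> : ((B e)%:E = \int[P]_w (cst (B e)%:E w))%E.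
    by rewrite integral_cst// [X in (_ * X)%E]probability_setT mule1.
  have le w : (((Num.sqrt (q e w) - Num.sqrt (q 0 w)) / e - s w * Num.sqrt (q 0 w) / 2) ^+ 2)
      <= B e.
    rewrite /q mul0r addr0 sqrtr1 mulr1.
    have h : -1 <= e * s w by have := es_le w ed; rewrite ler_norml => /andP[]; lra.
    have h' := sqrt_taylor h.
    have -> : (Num.sqrt (1 + e * s w) - 1) / e - s w / 2 =
      (Num.sqrt (1 + e * s w) - 1 - e * s w / 2) / e by field.
    have Bb : 0 <= `|e| * K ^+ 2 / 2 by rewrite divr_ge0// mulr_ge0// sqr_ge0.
    rewrite /B -real_normK ?num_real// lerXn2r ?nnegrE//.
    rewrite normrM normfV ler_pdivrMr ?normr_gt0//.
    apply: le_trans h' _.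
    rewrite (_ : `|e| * K ^+ 2 / 2 * `|e| = (`|e| * K) ^+ 2 / 2); last by ring.
    rewrite ler_pM2r ?invr_gt0// -real_normK ?num_real//.
    have eK0 : 0 <= `|e| * K by rewrite mulr_ge0// ltW.
    by rewrite lerXn2r ?nnegrE// normrM ler_wpM2l.
  by apply: ge0_le_integral_nonmeasurable => w; rewrite lee_fin ?sqr_ge0.
- have [c /andP[c0 c2] ho] := hov.
  have hpi' := propensity_clip hpi0 ho; set pi' := (fun x => _) in hpi'.
  have pic x : c <= pi' x <= 1 - c by exact: clip_bounds.
  have [mpi' _ _] := hpi'.
  exists (c / 3) => [|e ed]; first by apply/andP; split; lra.
  apply: propensity_exists; first by apply/andP; split; lra.
  move=> k B mk kB.
  have mkX := measurable_covar_comp (a := a) (b := b) mk.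
  have kn (w : obsT) : `|k (covar w)| <= B.
    by have /andP[h1 h2] := kB (covar w); rewrite ger0_norm.
  have k0 (w : obsT) : 0 <= k (covar w) by have /andP[] := kB (covar w).
  have sk (Q : probability obsT R) : sqint Q (fun w : obsT => k (covar w)).
    exact: (sqint_prob Q mkX kn).
  have mT := @measurable_treated R a b p.
  have sT (Q : probability obsT R) : sqint Q (@treated R a b p).
    exact: (sqint_prob Q mT (@treated_le1 R a b p)).
  have mpX := measurable_covar_comp (a := a) (b := b) mpi'.
  have sp : sqint P (fun w : obsT => pi' (covar w)).
    apply: (sqint_prob P mpX (K := 1)) => w; have /andP[h1 h2] := pic (covar w).
    by rewrite ger0_norm; lra.
  have hd := hPe e ed.
  have iTk (Q : probability obsT R) := sqintM (sT Q) (sk Q).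
  have sTk : sqint P (fun w => treated w * k (covar w)).
    apply: (@sqint_le _ _ _ _ _ (fun w => k (covar w)) 1) => //; last first.
      by move=> w; rewrite normrM ler_wpM2r// treated_le1.
    exact: measurable_funM.
  have spk : sqint P (fun w => pi' (covar w) * k (covar w)).
    apply: (@sqint_le _ _ _ _ _ (fun w => k (covar w)) 1) => //; first exact: measurable_funM.
    move=> w; have /andP[h1 h2] := pic (covar w).
    by rewrite normrM ler_wpM2r// ger0_norm; lra.
  have iT := sqint_integrable sTk; have ip := sqint_integrable spk.
  have ik := sqint_integrable (sk P).
  have orth : \int[P]_w (treated w * k (covar w)) = \int[P]_w (pi' (covar w) * k (covar w)).
    apply/eqP; rewrite -subr_eq0; apply/eqP; rewrite -(RintegralB measurableT iT ip).
    rewrite -[RHS](propensity_orthogonal hpi' mk).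
      by apply: eq_Rintegral => w _; ring.
    apply: sqintM => //; exact: sqintB.
  have b1 : c * (\int[P]_w k (covar w)) <= \int[P]_w (treated w * k (covar w)).
    rewrite orth -(RintegralZl _ measurableT ik); apply: le_Rintegral => //.
      exact: integrable_scale.
    by move=> w _; rewrite ler_wpM2r//; have /andP[] := pic (covar w).
  have b2 : \int[P]_w (treated w * k (covar w)) <= (1 - c) * (\int[P]_w k (covar w)).
    rewrite orth -(RintegralZl _ measurableT ik); apply: le_Rintegral => //.
      exact: integrable_scale.
    by move=> w _; rewrite ler_wpM2r//; have /andP[] := pic (covar w).
  have bnd (F : obsT -> R) : (forall w, 0 <= F w) -> sqint P F -> sqint (Pe e) F ->
      (1 / 2) * (\int[P]_w F w) <= \int[Pe e]_w F w <= (3 / 2) * \int[P]_w F w.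
    move=> F0 sF sFe; have iF := sqint_integrable sF; have iFe := sqint_integrable sFe.
    have j := integrable_density hd iFe.
    rewrite (Rintegral_density hd iFe) -!(RintegralZl _ measurableT iF).
    have i1 := integrable_scale (1 / 2) iF; have i3 := integrable_scale (3 / 2) iF.
    apply/andP; split; apply: le_Rintegral => // w _;
      have /andP[h1 h2] := q_bounds w ed.
      by rewrite [leLHS]mulrC ler_wpM2l.
    by rewrite [leRHS]mulrC ler_wpM2l.
  have sC (Q : probability obsT R) : sqint Q (fun w : obsT => (1 - treated w) * k (covar w)).
    have mC := @measurable_control R a b p.
    apply: (@sqint_le _ _ _ _ _ (fun w => k (covar w)) 1) => //.
      by apply: measurable_funM => //; exact: measurable_funB.
    by move=> w; rewrite normrM ler_wpM2r// -controlB control_le1.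
  have sTk' : sqint (Pe e) (fun w => treated w * k (covar w)).
    apply: (@sqint_le _ _ _ _ _ (fun w => k (covar w)) 1) => //; last first.
      by move=> w; rewrite normrM ler_wpM2r// treated_le1.
    exact: measurable_funM.
  have T0 (w : obsT) : 0 <= treated w * k (covar w) by rewrite mulr_ge0// ler0n.
  have C0 (w : obsT) : 0 <= (1 - treated w) * k (covar w).
    by rewrite mulr_ge0// -controlB ler0n.
  have split1 (Q : probability obsT R) : \int[Q]_w ((1 - treated w) * k (covar w)) =
      \int[Q]_w k (covar w) - \int[Q]_w (treated w * k (covar w)).
    rewrite -(RintegralB measurableT (sqint_integrable (sk Q)) (iTk Q)).
    by apply: eq_Rintegral => w _; ring.
  have /andP[k1 k2] := bnd _ k0 (sk P) (sk (Pe e)).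
  have /andP[t1 t2] := bnd _ T0 sTk sTk'.
  have /andP[u1 u2] := bnd _ C0 (sC P) (sC (Pe e)).
  rewrite !split1 in u1 u2.
  move: b1 b2 k1 k2 t1 t2 u1 u2.
  set A1 := \int[P]_w k (covar w); set A2 := \int[P]_w (treated w * k (covar w)).
  set B1 := \int[Pe e]_w k (covar w); set B2 := \int[Pe e]_w (treated w * k (covar w)).
  move=> b1 b2 k1 k2 t1 t2 u1 u2.
  have cB : c * B1 <= c * (3 / 2 * A1) by rewrite ler_wpM2l// ltW.
  exact: tilt_arith b1 b2 t1 u1 cB.
- have sY := sqint_of_second_moment hY.
  exists ((3 / 2) * l2n P (fun w => L2_norm (outcome w)) ^+ 2) => e ed.
  have hd := hPe e ed; have [mY iY] := sY.
  rewrite (ge0_integral_density hd (f := fun w => L2_norm (outcome w) ^+ 2)); last first.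
    by move=> w; exact: sqr_ge0.
    exact: measurable_funX.
  rewrite EFinM -sqint_int// -ge0_integralZl_EFin//; last first.
  + by apply/measurable_EFinP; exact: measurable_funX.
  + by move=> w _; rewrite lee_fin sqr_ge0.
  apply: ge0_le_integral_nonmeasurable => w; rewrite lee_fin.
    by rewrite mulr_ge0 ?sqr_ge0// q_ge0.
  by rewrite mulrC ler_wpM2r ?sqr_ge0//; have /andP[] := q_bounds w ed.
Unshelve. all: by end_near. Qed.

End bounded_score.

(** A single score is enough: truncate [G] and recentre. As [G] has mean 0, the mean [m] of the
    truncation is minus that of the tail, so recentring costs no more than truncating and each is
    allotted eta / 2. *)
Theorem mean0_tangent (G : obsT -> R) : sqint P G -> \int[P]_w G w = 0 ->
  tangent_space P G.
Proof.
move=> sG G0; split; first exact/Lfun2P.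
move=> eta eta0; have eta2 : 0 < eta / 2 by rewrite divr_gt0.
have [K K0 hK] := l2n_tail sG eta2.
pose g w := G w - tail K G w.
have [mG _] := sG.
have sT := sqint_tail K sG.
have mg : measurable_fun setT g by apply: measurable_funB => //; exact: measurable_tail.
have gK w : `|g w| <= K.
  by rewrite /g /tail; case: ifP => h; rewrite ?subr0// subrr normr0 ltW.
pose m := \int[P]_w g w.
have mE : m = - \int[P]_w tail K G w.
  rewrite /m -[RHS]sub0r -G0.
  by rewrite -(RintegralB measurableT (sqint_integrable sG) (sqint_integrable sT)).
have sg := sqint_prob P mg gK.
have sc : sqint P (fun w : obsT => m) := sqint_cst P m.
pose s w := g w - m.
have ms : measurable_fun setT s by exact: measurable_funB.
have sK w : `|s w| <= K + `|m|.
  by apply: le_trans (ler_normB _ _) _; rewrite lerD2r.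
have s0 : \int[P]_w s w = 0.
  rewrite /s (RintegralB measurableT (sqint_integrable sg) (sqint_integrable sc)).
  by rewrite Rintegral_cst// [X in fine X]probability_setT mulr1 subrr.
have Km : 0 < K + `|m| by rewrite ltr_wpDr.
exists 1%N, (fun=> 1), (fun=> s); split.
  by move=> _; exact: (bounded_score_regular ms Km sK s0).
have e w : G w - \sum_(i < 1) 1 * s w = tail K G w + m.
  by rewrite big_ord1 mul1r /s /g; ring.
rewrite (_ : (fun w => _) = EFin \o (fun w => tail K G w + m)); last first.
  by apply/funext => w /=; rewrite e.
rewrite Lnorm2_l2n; last exact: sqintD.
rewrite lte_fin; apply: le_lt_trans (ler_l2nD sT sc) _.
have -> : l2n P (fun w : obsT => m) = `|m| by exact: l2n_cst.
have mle : `|m| <= l2n P (tail K G) by rewrite mE normrN; exact: Rintegral_le_l2n.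
by lra.
Qed.

End tangent.

(** The weighted outcome has mean p <tau, f>, the term in [mu0] drops out by orthogonality of the
    weight, and D <tau, f> has mean p <tau, f> as well. *)
Lemma eif_mean0 (R : realType) (a b : R) (p : nat) (P : probability (obs R a b p) R)
    (pi0 : covariate R p -> R) (mu0 : covariate R p -> L2 a b) (f : L2 a b) :
  is_propensity P pi0 -> is_regression P false mu0 ->
  (exists2 c : R, 0 < c < 1 / 2 & overlap P pi0 c) -> 0 < treat_prob P < 1 ->
  (\int[P]_w (L2_norm (outcome w) ^+ 2)%:E < +oo)%E ->
  (\int[P]_w (L2_norm (eif P pi0 mu0 w) ^+ 2)%:E < +oo)%E ->
  \int[P]_w L2_inner (eif P pi0 mu0 w) f = 0.
Proof.
move=> hpi0 hmu0 [c c01 ho] p01 hY hphi.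
have /andP[c0 c2] := c01; have /andP[p0 _] := p01.
have sY := sqint_of_second_moment hY.
have sN := regression_norm_sqint hpi0 hmu0 p01 hphi hY c01 ho.
have hpi' := propensity_clip hpi0 ho; set pi' := (fun x => _) in hpi'.
have pic x : c <= pi' x <= 1 - c by exact: clip_bounds.
have [mpi' _ _] := hpi'; have [mpi0 _ _] := hpi0.
have ha := att_inner f c0 pic hpi' (lt0r_neq0 p0) sY.
have mm := measurable_regression_inner hmu0 f.
have sm : sqint P (fun w : obs R a b p => L2_inner (mu0 (covar w)) f).
  apply: (@sqint_le _ _ _ _ _ _ (L2_norm f) (measurable_covar_comp mm) _ sN) => w.
  rewrite (ger0_norm (L2_norm_ge0 _)) mulrC; exact: L2_cauchy_schwarz.
have hw := weight_orthogonal c0 pic hpi' mm (sqint_integrable sm).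
have hae := score_test_ae mu0 (att P) f ho.
have [sE _] := eif_inner_l2n hpi0 hmu0 hphi f.
have sw := sqint_prob P (measurable_weight (a := a) (b := b) mpi') (weight_le c0 pic).
have sT := sqint_prob P (@measurable_treated R a b p) (@treated_le1 R a b p).
have i1 := sqintM sw (sqint_outcome_inner f sY).
have i2 := sqintM sm sw.
have : \int[P]_w L2_inner (eif P pi0 mu0 w) f =
    \int[P]_w ((treat_prob P)^-1 * score_test pi' mu0 (att P) f w).
  apply: Rintegral_ae_eq; first by case: sE.
    by apply: measurable_funM => //; exact: (measurable_score_test hmu0).
  by apply: filterS hae => w h; rewrite eif_inner h.
move=> ->; move: (att P) ha => tau ha.
have i3 := integrable_scale (L2_inner tau f) (sqint_integrable sT).
have i12 := integrable_minus i1 i2; have i123 := integrable_minus i12 i3.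
have e w : score_test pi' mu0 tau f w = weight pi' w * L2_inner (outcome w) f -
   L2_inner (mu0 (covar w)) f * weight pi' w - L2_inner tau f * treated w.
  by rewrite /score_test; ring.
have -> : \int[P]_w ((treat_prob P)^-1 * score_test pi' mu0 tau f w) =
   \int[P]_w ((treat_prob P)^-1 * (weight pi' w * L2_inner (outcome w) f -
   L2_inner (mu0 (covar w)) f * weight pi' w - L2_inner tau f * treated w)).
  by apply: eq_Rintegral => w _; rewrite e.
rewrite (RintegralZl _ measurableT i123) (RintegralB measurableT i12 i3).
rewrite (RintegralB measurableT i1 i2) hw subr0 -ha.
rewrite (RintegralZl _ measurableT (sqint_integrable sT)).
have -> : \int[P]_x treated x = treat_prob P := esym (treat_probE P).
by rewrite mulrC (mulrC (L2_inner tau f)) subrr mul0r.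
Qed.

Theorem proposition1 (R : realType) (a b : R) (p : nat)
    (P : probability (obs R a b p) R)
    (pi0 : covariate R p -> R) (mu0 mu1 : covariate R p -> L2 a b)
    (hab : a <= b)
    (hpi0 : is_propensity P pi0)
    (hmu0 : is_regression P false mu0)
    (hmu1 : is_regression P true mu1)
    (hoverlap : exists2 c : R, 0 < c < 1 / 2 & overlap P pi0 c)
    (hp0 : 0 < treat_prob P < 1)
    (hY : (\int[P]_w (L2_norm (outcome w) ^+ 2)%:E < +oo)%E)
    (hphi : (\int[P]_w (L2_norm (eif P pi0 mu0 w) ^+ 2)%:E < +oo)%E)
    (hvar : exists2 v : covariate R p -> R,
      is_cond_mean P [set w | treat w = false]
        (fun w => L2_norm (outcome w - mu0 (covar w)) ^+ 2) v &
      exists C : R, forall x, v x <= C) :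
  [/\ forall (delta : R) (Pe : R -> probability (obs R a b p) R)
             (S : obs R a b p -> R),
        regular_submodel P delta Pe S ->
        represents_derivative P Pe S (eif_mu1 P pi0 mu0 mu1),
      forall w, eif_mu1 P pi0 mu0 mu1 w = eif P pi0 mu0 w &
      is_canonical_gradient P (eif P pi0 mu0)].
Proof.
have grad := eif_gradient hpi0 hmu0 hp0 hphi hY hoverlap.
have E := eif_mu1E P pi0 mu0 mu1.
split; [|exact: E|].
  have -> : eif_mu1 P pi0 mu0 mu1 = eif P pi0 mu0 by exact/funext.
  exact: grad.
split; first exact: grad.
move=> f; apply: (mean0_tangent hpi0 hoverlap hY).
  by have [] := eif_inner_l2n hpi0 hmu0 hphi f.
exact: eif_mean0.
Qed.
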